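(* Let $n\ge 6$, let $M$ be a connected Riemann surface and let $x:M\to S^n$ be a (conformally immersed) Willmore surface with flat normal bundle. Then $x(M)$ is contained in some 6-dimensional (round) sphere $S^6\subset S^n$.
   Context: Setup. $\mathbb{R}^{n+2}_1$ is $\mathbb{R}^{n+2}$ with the Lorentzian form $\langle x,y\rangle=-x_0y_0+x_1y_1+\cdots+x_{n+1}y_{n+1}$, extended complex bilinearly, and $S^n$ is identified conformally with its projectivized light cone. Let $x:M\to S^n$ be a conformal immersion. For a local complex coordinate $z$ on $M$, the canonical lift $Y$ is the local lift of $x$ into the (forward) light cone with $|dY|^2=|dz|^2$. The bundle $V=\mathrm{Span}\{Y,\mathrm{Re}\,Y_z,\mathrm{Im}\,Y_z,Y_{z\bar z}\}$ is a Lorentzian rank-4 subbundle of $M\times\mathbb{R}^{n+2}_1$ independent of $Y$ and $z$; its orthogonal complement $V^\perp$ is the conformal normal bundle, with normal connection $D$ induced by orthogonal projection. There are a unique function $s$ and section $\kappa$ of $V^\perp\otimes\mathbb{C}$ (the conformal Hopf differential) with $Y_{zz}=-\frac{s}{2}Y+\kappa$. Flat normal bundle: the curvature of $D$ on $V^\perp$ vanishes identically (conformally invariant, equivalent to flatness of the usual normal connection of $x$ in $S^n$). Willmore: $x$ is a critical point of $W(x)=2i\int_M\langle\kappa,\bar\kappa\rangle\,dz\wedge d\bar z$ under (compactly supported) variations of $x:M\to S^n$; equivalently $D_{\bar z}D_{\bar z}\kappa+\frac{\bar s}{2}\kappa=0$ for all local coordinates $z$. *)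

(* Defs.v *)
From HB Require Import structures.
From mathcomp Require Import all_boot all_order all_algebra.
From mathcomp Require Import all_classical all_reals all_analysis.
From mathcomp Require Export complex.

Set Implicit Arguments.
Unset Strict Implicit.
Unset Printing Implicit Defensive.

Import Order.TTheory GRing.Theory Num.Theory.
Import numFieldNormedType.Exports.

Local Open Scope classical_set_scope.
Local Open Scope ring_scope.

(** * Calculus on open subsets of the plane

   The complex plane with coordinate z = u + iv is modelled by [R * R], points
   being (u, v). *)

(* On a finite-dimensional [V] and an open [O], this is the usual C^k. *)
Fixpoint Ck (R : realType) (V W : normedModType R) (k : nat) (O : set V)
    (f : V -> W) : Prop :=
  (forall p, O p -> {for p, continuous f}) /\
  match k with
  | 0 => True
  | k'.+1 => forall v : V,
      (forall p, O p -> derivable f p v) /\ Ck k' O (fun p => 'D_v f p)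
  end.

Definition smooth_on (R : realType) (V W : normedModType R) (O : set V)
    (f : V -> W) : Prop := forall k, Ck k O f.

Definition e1 (R : realType) : R * R := (1, 0).
Definition e2 (R : realType) : R * R := (0, 1).

Definition du (R : realType) (W : normedModType R) (f : R * R -> W)
  (p : R * R) : W := 'D_(e1 R) f p.
Definition dv (R : realType) (W : normedModType R) (f : R * R -> W)
  (p : R * R) : W := 'D_(e2 R) f p.

Definition jacobian (R : realType) (f : R * R -> R * R) (p : R * R) : R :=
  (du f p).1 * (dv f p).2 - (dv f p).1 * (du f p).2.

(* A smooth map a + ib satisfying the Cauchy-Riemann equations. *)
Definition holomorphic_on (R : realType) (O : set (R * R))
    (f : R * R -> R * R) : Prop :=
  smooth_on O f /\
  forall p, O p -> dv f p = (- (du f p).2, (du f p).1).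

Definition cplx (R : realType) (m : nat) (x : 'rV[R]_m) : 'rV[R[i]]_m :=
  map_mx (real_complex R) x.
Definition reV (R : realType) (m : nat) (x : 'rV[R[i]]_m) : 'rV[R]_m :=
  map_mx (@complex.Re R) x.
Definition imV (R : realType) (m : nat) (x : 'rV[R[i]]_m) : 'rV[R]_m :=
  map_mx (@complex.Im R) x.
Definition conjV (R : realType) (m : nat) (x : 'rV[R[i]]_m) : 'rV[R[i]]_m :=
  map_mx (@conjc R) x.

Definition duC (R : realType) (m : nat) (f : R * R -> 'rV[R[i]]_m)
    (p : R * R) : 'rV[R[i]]_m :=
  cplx (du (fun q => reV (f q)) p)
  + ('i)%C *: cplx (du (fun q => imV (f q)) p).
Definition dvC (R : realType) (m : nat) (f : R * R -> 'rV[R[i]]_m)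
    (p : R * R) : 'rV[R[i]]_m :=
  cplx (dv (fun q => reV (f q)) p)
  + ('i)%C *: cplx (dv (fun q => imV (f q)) p).

Definition dz (R : realType) (m : nat) (f : R * R -> 'rV[R[i]]_m)
    (p : R * R) : 'rV[R[i]]_m := 2^-1 *: (duC f p - ('i)%C *: dvC f p).
Definition dzbar (R : realType) (m : nat) (f : R * R -> 'rV[R[i]]_m)
    (p : R * R) : 'rV[R[i]]_m := 2^-1 *: (duC f p + ('i)%C *: dvC f p).

(** * Euclidean and Lorentzian forms *)

Definition dot (R : realType) (m : nat) (x y : 'rV[R]_m) : R :=
  \sum_(i < m) x 0 i * y 0 i.

(* Over [R[i]] this is the complex bilinear (not Hermitian) extension. *)
Definition lorentz (K : comNzRingType) (m : nat) (x y : 'rV[K]_m.+1) : K :=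
  - (x 0 ord0 * y 0 ord0)
  + \sum_(i < m) x 0 (lift ord0 i) * y 0 (lift ord0 i).

Definition on_sphere (R : realType) (n : nat) (x : 'rV[R]_n.+1) : Prop :=
  dot x x = 1.

(** * Coordinate expressions of surfaces in the sphere

   [X : R * R -> 'rV_n.+1] is the expression in a complex coordinate,
   defined on the open set [O], of a map into the unit sphere S^n. *)

Definition immersion_on (R : realType) (n : nat) (O : set (R * R))
    (X : R * R -> 'rV[R]_n.+1) : Prop :=
  forall p, O p -> row_free (col_mx (du X p) (dv X p)).

Definition conformal_on (R : realType) (n : nat) (O : set (R * R))
    (X : R * R -> 'rV[R]_n.+1) : Prop :=
  forall p, O p ->
    [/\ 0 < dot (du X p) (du X p),
        dot (du X p) (du X p) = dot (dv X p) (dv X p)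
      & dot (du X p) (dv X p) = 0].

(* A point x of S^n is identified with the line spanned by the forward null
   vector (1, x). *)
Definition canonical_lift (R : realType) (n : nat) (O : set (R * R))
    (X : R * R -> 'rV[R]_n.+1) (Y : R * R -> 'rV[R]_n.+2) : Prop :=
  smooth_on O Y /\
  forall p, O p ->
    [/\ exists r : R, 0 < r /\ Y p = r *: row_mx (1 : 'rV[R]_1) (X p),
        lorentz (du Y p) (du Y p) = 1,
        lorentz (dv Y p) (dv Y p) = 1
      & lorentz (du Y p) (dv Y p) = 0].

Section NormalBundle.
Variables (R : realType) (m : nat).
Implicit Types (Y psi : R * R -> 'rV[R]_m.+1) (p : R * R).

Definition Yz Y : R * R -> 'rV[R[i]]_m.+1 := dz (fun q => cplx (Y q)).

(* The rows span the fibre V_p. *)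
Definition Vframe Y p : 'M[R]_(4, m.+1) :=
  \matrix_(i < 4)
    nth 0 [:: Y p; reV (Yz Y p); imV (Yz Y p); reV (dzbar (Yz Y) p)] i.

Definition in_Vperp Y p (w : 'rV[R]_m.+1) : Prop :=
  forall i, lorentz w (row i (Vframe Y p)) = 0.

Definition in_VperpC Y p (w : 'rV[R[i]]_m.+1) : Prop :=
  forall i, lorentz w (cplx (row i (Vframe Y p))) = 0.

(* Orthogonal projection to V_p^perp; the Gram matrix is invertible because
   the form is nondegenerate on V_p. *)
Definition Vperp_proj Y p (w : 'rV[R]_m.+1) : 'rV[R]_m.+1 :=
  let F := Vframe Y p in
  let G : 'M[R]_4 := \matrix_(i, j) lorentz (row i F) (row j F) in
  w - (\row_j lorentz w (row j F)) *m invmx G *m F.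

Definition Du Y psi p : 'rV[R]_m.+1 := Vperp_proj Y p (du psi p).
Definition Dv Y psi p : 'rV[R]_m.+1 := Vperp_proj Y p (dv psi p).

(* The curvature D_u D_v - D_v D_u vanishes on all local sections. *)
Definition flat_on (O : set (R * R)) Y : Prop :=
  forall (O' : set (R * R)) psi,
    open O' -> O' `<=` O -> smooth_on O' psi ->
    (forall p, O' p -> in_Vperp Y p (psi p)) ->
    forall p, O' p -> Du Y (Dv Y psi) p = Dv Y (Du Y psi) p.

(* Y_zz = - (s / 2) Y + kappa with kappa a section of V^perp (x) C. *)
Definition conformal_hopf (O : set (R * R)) Y (s : R * R -> R[i])
    (kappa : R * R -> 'rV[R[i]]_m.+1) : Prop :=
  forall p, O p ->
    dz (Yz Y) p = - (s p / 2) *: cplx (Y p) + kappa p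
    /\ in_VperpC Y p (kappa p).

End NormalBundle.

(* The members of a variation of a conformal immersion are in general not
   conformal for the given coordinate, so W is taken with respect to the
   complex structure they induce.  [d du dv] is the integrand of W for the
   immersion [X]: in any oriented isothermal coordinate w of [X] (given by its
   inverse sigma) it is 2i <kappa, conj kappa> dw /\ dw-bar, which equals
   4 <kappa, conj kappa> times the area element of w.  As isothermal
   coordinates exist near every point, [d] is uniquely determined on [O]. *)
Definition willmore_density (R : realType) (n : nat) (O : set (R * R))
    (X : R * R -> 'rV[R]_n.+1) (d : R * R -> R) : Prop :=
  forall (O' : set (R * R)) (sigma : R * R -> R * R)
      (Y : R * R -> 'rV[R]_n.+2) (s : R * R -> R[i])
      (kappa : R * R -> 'rV[R[i]]_n.+2),
    open O' -> smooth_on O' sigma ->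
    (forall q, O' q -> O (sigma q) /\ 0 < jacobian sigma q) ->
    conformal_on O' (X \o sigma) ->
    canonical_lift O' (X \o sigma) Y ->
    conformal_hopf O' Y s kappa ->
    forall q, O' q ->
      4 * lorentz (kappa q) (conjV (kappa q))
      = ((d (sigma q) * jacobian sigma q)%:C)%C.

(** * Riemann surfaces *)

Record chart (R : realType) (M : topologicalType) := Chart {
  chart_dom : set M;
  coord : M -> R * R;
  param : R * R -> M;
  open_chart_dom : open chart_dom;
  open_chart_img : open (coord @` chart_dom);
  coordK : {in chart_dom, cancel coord param};
  coord_continuous : forall p, chart_dom p -> {for p, continuous coord};
  param_continuous : forall q, (coord @` chart_dom) q ->
    {for q, continuous param} }.

Definition chart_img (R : realType) (M : topologicalType) (c : chart R M) :
  set (R * R) := coord c @` chart_dom c.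

Record riemann_surface (R : realType) (M : topologicalType) := RiemannSurface {
  atlas : set (chart R M);
  surface_hausdorff : hausdorff_space M;
  atlas_cover : forall p : M, exists2 c, atlas c & chart_dom c p;
  atlas_holomorphic : forall c c', atlas c -> atlas c' ->
    holomorphic_on (coord c @` (chart_dom c `&` chart_dom c'))
      (coord c' \o param c) }.

Section Surfaces.
Variables (R : realType) (M : topologicalType) (RS : riemann_surface R M).
Variable (n : nat).
Implicit Types (x : M -> 'rV[R]_n.+1) (F : R -> M -> 'rV[R]_n.+1).

Definition conformal_immersion x : Prop :=
  (forall p, on_sphere (x p)) /\
  forall c, atlas RS c ->
    smooth_on (chart_img c) (x \o param c) /\
    conformal_on (chart_img c) (x \o param c).

Definition flat_normal_bundle x : Prop :=
  forall c Y, atlas RS c -> canonical_lift (chart_img c) (x \o param c) Y ->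
    flat_on (chart_img c) Y.

Definition variation x (K : set M) (eps : R) F : Prop :=
  [/\ F 0 = x,
      forall t p, `|t| < eps -> on_sphere (F t p),
      forall t p, `|t| < eps -> ~ K p -> F t p = x p,
      forall c, atlas RS c ->
        smooth_on [set q : R * (R * R) | `|q.1| < eps /\ chart_img c q.2]
          (fun q : R * (R * R) => F q.1 (param c q.2))
    & forall t c, `|t| < eps -> atlas RS c ->
        immersion_on (chart_img c) (F t \o param c)].

(* R x R with the product of the Borel sigma-algebras on which the library's
   [lebesgue_measure] lives. *)
Definition borel_plane := (measurableTypeR R * measurableTypeR R)%type.

Definition plane_measure : set borel_plane -> \bar R :=
  (@lebesgue_measure R \x @lebesgue_measure R)%E.
HB.instance Definition _ := Measure.on plane_measure.

(* A cutting of K into finitely many disjoint Borel pieces, the i-th one lying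
   in the domain of the chart c i and having coordinate image B i.  It serves to
   integrate over K. *)
Definition coordinate_partition (K : set M) (k : nat) (c : 'I_k -> chart R M)
    (B : 'I_k -> set (R * R)) : Prop :=
  [/\ forall i, atlas RS (c i),
      forall i, measurable (B i : set borel_plane) /\ B i `<=` chart_img (c i),
      forall i j, i != j ->
        (param (c i) @` B i) `&` (param (c j) @` B j) = set0
    & \bigcup_(i in [set: 'I_k]) (param (c i) @` B i) = K].

(* For every variation supported in a compact K, the derivative at t = 0 of the
   Willmore energy of the part of the surface F t over K is zero. *)
Definition willmore x : Prop :=
  forall (K : set M) (eps : R) F (k : nat) (c : 'I_k -> chart R M)
      (B : 'I_k -> set (R * R)) (d : R -> 'I_k -> R * R -> R),
    compact K -> 0 < eps -> variation x K eps F ->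
    coordinate_partition K c B ->
    (forall t i, `|t| < eps ->
       willmore_density (chart_img (c i)) (F t \o param (c i)) (d t i)) ->
    is_derive (0 : R) 1
      (fun t : R => \sum_(i < k) \int[plane_measure]_(q in B i) d t i q) 0.

End Surfaces.

(* The round k-sphere of centre c and radius r in the (k+1)-dimensional affine
   subspace through c directed by the rows of L. *)
Definition round_sphere (R : realType) (n k : nat) (c : 'rV[R]_n.+1) (r : R)
    (L : 'M[R]_(k.+1, n.+1)) : set 'rV[R]_n.+1 :=
  [set y | (y - c <= L)%MS /\ dot (y - c) (y - c) = r ^+ 2].

(* Main.v *)
Require Import Defs.
From HB Require Import structures.
From mathcomp Require Import all_boot all_order all_algebra.
From mathcomp Require Import all_classical all_reals all_analysis.
From mathcomp Require Import measurable_realfun lebesgue_integral_under.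
From mathcomp Require Import ring lra.
Set Implicit Arguments.
Unset Strict Implicit.
Unset Printing Implicit Defensive.
Import Order.TTheory GRing.Theory Num.Theory.
Import numFieldNormedType.Exports.
Local Open Scope classical_set_scope.
Local Open Scope ring_scope.

(** Let Y be the canonical lift in a chart with coordinates x, y, and put
   L = Y_xx + Y_yy, P = Y_xx - Y_yy and Q = 2 Y_xy.  Everything is expressed
   through these real fields: Y, Y_x, Y_y and L span V, and the normal parts of
   P and Q are those of 4 Re Y_zz and of -4 Im Y_zz.

   Flatness.  By the Ricci equation the curvature of D vanishes exactly when
   the normal parts of P and Q are parallel, which is the equality
   (P,Q)^2 = (P,P)(Q,Q) of [flat_PQ].

   Willmore equation.  The definition of a Willmore surface refers to arbitrary
   variations, whose members are not conformal.  The integrand of W is therefore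
   written for any positive multiple of a lift in any parameter
   ([willmore_density_densY]).  For a normal field supported in a chart, a
   variation whose rescaled lift is Y + t nu + O(t^2) is constructed
   ([famt_move]); differentiating under the integral sign and integrating by
   parts shows that Lap L + (L,P) P + (L,Q) Q is a section of V
   ([willmore_equation_at]).

   Rank.  Near a point where P is not null one has Q = h P modulo Y.  Put
   xi = P.  The Willmore equation and the compatibility equation
   2 P_xy = Q_xx - Q_yy are two linear equations, of determinant 1 + h^2, for
   xi_xx - xi_yy and 2 xi_xy modulo the seven fields Y, Y_x, Y_y, L, xi, xi_x,
   xi_y.  It follows that the derivatives of these seven fields and of the
   Laplacian of xi are combinations of the same eight fields
   ([jets8_closed]).  A closed family spans a constant subspace, so that Y
   stays locally in a space of dimension at most 8.  The argument is the same
   with xi = Q, and simpler if both P and Q are everywhere null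
   ([rank_bound]).

   Propagation.  The dimension bound holds on some open set only.  Let l be a
   vector orthogonal to Y on that set.  The component y of Y along l satisfies
   a fourth order equation equivalent to a system |dbar W| <= C |W|, for
   W = (y, y_z, y_(z zbar), y_zz, y_(z z zbar)).  Dividing W by powers of
   z - q, at a point q near which W vanishes, gives a Carleman estimate
   ([carleman]) and unique continuation on squares of a uniform size
   ([lift_continuation]).  As M is connected, l is orthogonal to (1, x)
   everywhere ([annihilator_global]).

   Conclusion.  The vectors (1, x p) span a space of dimension at most 8, so
   that the points x p lie in an affine subspace of dimension at most 7, which
   cuts the unit sphere in a round sphere of dimension at most 6. *)

(** * Calculus of smooth maps *)
Section SmoothAlgebra.
Variable R : realType.
Implicit Types V W : normedModType R.

Lemma Ck_le V W k (O : set V) (f : V -> W) : Ck k.+1 O f -> Ck k O f.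
Proof.
elim: k f => [|k IH] f [fc fd]; first by split.
split => // v; have [dv [cv Cv]] := fd v; split => //; exact: IH.
Qed.

Lemma Ck_sub V W k (U O : set V) (f : V -> W) : U `<=` O -> Ck k O f -> Ck k U f.
Proof.
move=> UO; elim: k f => [|k IH] f [fc fd].
  by split => // p /UO; apply: fc.
split; first by move=> p /UO; apply: fc.
move=> v; have [dv Cv] := fd v; split; last exact: IH.
by move=> p /UO; apply: dv.
Qed.

Lemma open_near V (O : set V) (p : V) : open O -> O p -> \near p, O p.
Proof. by move=> oO Op; apply: open_nbhs_nbhs. Qed.

Lemma Ck_ext V W k (O : set V) (f g : V -> W) : open O ->
  (forall p, O p -> f p = g p) -> Ck k O f -> Ck k O g.
Proof.
move=> oO; elim: k f g => [|k IH] f g fg [fc fd].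
  split=> // p Op; have fgp : \near p, f p = g p.
    by apply: filterS (open_near oO Op) => x /fg.
  rewrite /prop_for /continuous_at -(fg _ Op); apply: cvg_trans (fc p Op).
  by apply: near_eq_cvg; apply: filterS fgp => x ->.
have fgn p : O p -> \near p, f p = g p.
  by move=> Op; apply: filterS (open_near oO Op) => x /fg.
split.
  move=> p Op; rewrite /prop_for /continuous_at -(fg _ Op); apply: cvg_trans (fc p Op).
  by apply: near_eq_cvg; apply: filterS (fgn p Op) => x ->.
move=> v; have [dv Cv] := fd v; split.
  by move=> p Op; apply: near_eq_derivable (dv p Op); exact: fgn.
apply: IH Cv => p Op; exact: near_eq_derive (fgn p Op).
Qed.

Lemma smooth_sub V W (U O : set V) (f : V -> W) :
  U `<=` O -> smooth_on O f -> smooth_on U f.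
Proof. by move=> UO sf k; apply: Ck_sub (sf k). Qed.

Lemma smooth_ext V W (O : set V) (f g : V -> W) : open O ->
  (forall p, O p -> f p = g p) -> smooth_on O f -> smooth_on O g.
Proof. by move=> oO fg sf k; apply: Ck_ext (sf k). Qed.

Lemma smooth_derivable V W (O : set V) (f : V -> W) p v :
  smooth_on O f -> O p -> derivable f p v.
Proof. by move=> /(_ 1%N)[_ /(_ v)[+ _]] Op; apply. Qed.

Lemma smooth_continuous V W (O : set V) (f : V -> W) p :
  smooth_on O f -> O p -> {for p, continuous f}.
Proof. by move=> /(_ 0%N)[+ _] Op; apply. Qed.

Lemma smooth_derive V W (O : set V) (f : V -> W) v :
  smooth_on O f -> smooth_on O ('D_v f).
Proof. by move=> sf k; have [_ /(_ v)[]] := sf k.+1. Qed.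

(** Smoothness is defined through all iterated directional derivatives, none of
   which sees more than a neighbourhood of the point. *)
Lemma smooth_local V W (O : set V) (f : V -> W) :
  (forall p, O p -> exists U, [/\ open U, U p & smooth_on U f]) ->
  smooth_on O f.
Proof.
move=> H k; have {}H : forall p, O p -> exists U, [/\ open U, U p & Ck k U f].
  by move=> p /H[U [? ? ?]]; exists U.
elim: k f H => [|k IH] f H.
  by split=> // p /H[U [_ Up [+ _]]]; apply.
split; first by move=> p /H[U [_ Up [+ _]]]; apply.
move=> v; split.
  by move=> p /H[U [_ Up [_ /(_ v)[+ _]]]]; apply.
by apply: IH => p /H[U [oU Up [_ /(_ v)[_ Cv]]]]; exists U.
Qed.

Lemma smooth_cst V W (O : set V) (c : W) : smooth_on O (fun=> c).
Proof.
move=> k; elim: k c => [|k IH] c; first by split => // p _; exact: cst_continuous.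
split; first by move=> p _; exact: cst_continuous.
move=> v; split; first by move=> p _; exact: derivable_cst.
have -> : (fun p : V => 'D_v (fun=> c) p) = fun=> 0 :> W.
  by apply/funext => p; rewrite derive_cst.
exact: IH.
Qed.

Lemma Ck_add V W k (O : set V) (f g : V -> W) : open O ->
  Ck k O f -> Ck k O g -> Ck k O (fun p => f p + g p).
Proof.
move=> oO; elim: k f g => [|k IH] f g [fc fd] [gc gd].
  by split => // p Op; apply: continuousD; [exact: fc|exact: gc].
split; first by move=> p Op; apply: continuousD; [exact: fc|exact: gc].
move=> v; have [df Cf] := fd v; have [dg Cg] := gd v; split.
  by move=> p Op; apply: derivableD; [exact: df|exact: dg].
apply: Ck_ext (IH _ _ Cf Cg) => // p Op.
by rewrite -deriveD; [|exact: df|exact: dg].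
Qed.

Lemma smooth_add V W (O : set V) (f g : V -> W) : open O ->
  smooth_on O f -> smooth_on O g -> smooth_on O (fun p => f p + g p).
Proof. by move=> oO sf sg k; apply: Ck_add. Qed.

Lemma is_derive_cvgP V W (f : V -> W) p v df : is_derive p v f df <->
  (fun t : R => t^-1 *: (f (t *: v + p) - f p)) @ 0^' --> df.
Proof.
split=> [[dfv <-]|H]; first exact: dfv.
apply: DeriveDef; last exact: (cvg_lim _ H).
by apply/cvg_ex; exists df.
Qed.

Lemma is_derive_linear_post V W W' (h : {linear W -> W'}) (f : V -> W) p v df :
  continuous h -> is_derive p v f df -> is_derive p v (h \o f) (h df).
Proof.
move=> hc /is_derive_cvgP D; apply/is_derive_cvgP.
under eq_fun do rewrite /= -linearB -linearZ/=.
by apply: (@cvg_comp _ _ _ (fun t : R => t^-1 *: (f (t *: v + p) - f p)) h _ _ _ D);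
  exact: hc.
Qed.

Lemma smooth_linear_post V W W' (h : {linear W -> W'}) (O : set V) (f : V -> W) :
  continuous h -> open O -> smooth_on O f -> smooth_on O (fun p => h (f p)).
Proof.
move=> hc oO sf k; have := sf k.
elim: k f {sf} => [|k IH] f [fc fd].
  split => // p Op; apply: continuous_comp; [exact: fc|exact: hc].
split.
  by move=> p Op; apply: continuous_comp; [exact: fc|exact: hc].
move=> v; have [df Cf] := fd v.
have dh p : O p -> is_derive p v (h \o f) (h ('D_v f p)).
  by move=> Op; apply: is_derive_linear_post => //; apply: derivableP; exact: df.
split; first by move=> p Op; have [] := dh p Op.
apply: Ck_ext (IH _ Cf) => // p Op /=.
by have [_ <-] := dh p Op.
Qed.

Lemma is_derive_linear_pre V V' W (h : {linear V' -> V}) (f : V -> W) p v df :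
  is_derive (h p) (h v) f df -> is_derive p v (f \o h) df.
Proof.
move=> /is_derive_cvgP D; apply/is_derive_cvgP.
by under eq_fun do rewrite /= linearP.
Qed.

Lemma smooth_linear_pre V V' W (h : {linear V' -> V}) (O : set V) (f : V -> W) :
  continuous h -> open O -> smooth_on O f ->
  smooth_on (h @^-1` O) (fun p => f (h p)).
Proof.
move=> hc oO sf k; have := sf k.
have oP : open (h @^-1` O) by apply: open_comp => // x _; exact: hc.
elim: k f {sf} => [|k IH] f [fc fd].
  split => // p Op; apply: continuous_comp; [exact: hc|exact: fc].
split.
  by move=> p Op; apply: continuous_comp; [exact: hc|exact: fc].
move=> v; have [df Cf] := fd (h v).
have dh p : O (h p) -> is_derive p v (f \o h) ('D_(h v) f (h p)).
  by move=> Op; apply: is_derive_linear_pre; apply: derivableP; exact: df.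
split; first by move=> p Op; have [] := dh p Op.
apply: Ck_ext (IH _ Cf) => // p Op /=.
by have [_ <-] := dh p Op.
Qed.

Lemma smooth_id V (O : set V) : open O -> smooth_on O (@id V).
Proof.
move=> oO [|k]; first by split => // p _; exact: cvg_id.
split; first by move=> p _; exact: cvg_id.
move=> v; split; first by move=> p _; exact: derivable_id.
have -> : (fun p : V => 'D_v id p) = fun=> v by apply/funext => p; rewrite derive_id.
exact: smooth_cst.
Qed.

Lemma smooth_scale V W (O : set V) (c : R) (f : V -> W) : open O ->
  smooth_on O f -> smooth_on O (fun p => c *: f p).
Proof.
move=> oO sf; apply: (@smooth_linear_post _ _ _ ( *:%R c)) => //.
exact: scaler_continuous.
Qed.

Lemma smooth_opp V W (O : set V) (f : V -> W) : open O ->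
  smooth_on O f -> smooth_on O (fun p => - f p).
Proof.
move=> oO sf; apply: (@smooth_linear_post _ _ _ -%R) => //.
exact: opp_continuous.
Qed.

Lemma smooth_subr V W (O : set V) (f g : V -> W) : open O ->
  smooth_on O f -> smooth_on O g -> smooth_on O (fun p => f p - g p).
Proof. by move=> oO sf sg; apply: smooth_add => //; apply: smooth_opp. Qed.

(** By induction on k, with the Leibniz rule. *)
Lemma Ck_mul V k (O : set V) (f g : V -> R) : open O ->
  Ck k O f -> Ck k O g -> Ck k O (fun p => f p * g p).
Proof.
move=> oO; elim: k f g => [|k IH] f g Hf Hg.
  case: Hf => fc _; case: Hg => gc _.
  by split => // p Op; apply: continuousM; [exact: fc|exact: gc].
have [fc fd] := Hf; have [gc gd] := Hg.
split; first by move=> p Op; apply: continuousM; [exact: fc|exact: gc].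
move=> v; have [df Cf] := fd v; have [dg Cg] := gd v; split.
  by move=> p Op; apply: derivableM; [exact: df|exact: dg].
apply: (@Ck_ext _ _ _ _ (fun p => f p * 'D_v g p + g p * 'D_v f p)) => //.
  move=> p Op; rewrite (_ : (fun x => f x * g x) = f * g)//.
  by rewrite deriveM; [|exact: df|exact: dg].
by apply: Ck_add => //; apply: IH => //; exact: Ck_le.
Qed.

Lemma smooth_mul V (O : set V) (f g : V -> R) : open O ->
  smooth_on O f -> smooth_on O g -> smooth_on O (fun p => f p * g p).
Proof. by move=> oO sf sg k; apply: Ck_mul. Qed.

Lemma smooth_exp V (O : set V) (f : V -> R) n : open O ->
  smooth_on O f -> smooth_on O (fun p => f p ^+ n).
Proof.
move=> oO sf; elim: n => [|n IH].
  under eq_fun do rewrite expr0; exact: smooth_cst.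
under eq_fun do rewrite exprS; exact: smooth_mul.
Qed.

Lemma smooth_sum V W (O : set V) (I : Type) (r : seq I) (f : I -> V -> W) : open O ->
  (forall i, smooth_on O (f i)) -> smooth_on O (fun p => \sum_(i <- r) f i p).
Proof.
move=> oO sf; elim: r => [|i r IH].
  under eq_fun do rewrite big_nil; exact: smooth_cst.
under eq_fun do rewrite big_cons; exact: smooth_add.
Qed.

Lemma is_derive_comp1 V (g : R -> R) (f : V -> R) p v df dg :
  is_derive p v f df -> is_derive (f p) 1 g dg ->
  is_derive p v (g \o f) (dg * df).
Proof.
move=> [fv <-] dgp.
have E (h : V -> R) dh : is_derive p v h dh <->
    is_derive (0 : R) 1 (fun t : R => h (t *: v + p)) dh.
  rewrite !is_derive_cvgP.
  under [X in _ <-> (X @ _ --> _)]eq_fun do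
    rewrite addr0 scale0r add0r [_%:A]mulr1.
  by [].
have fv' : is_derive p v f ('D_v f p) by exact: derivableP.
apply/E.
have fp : f (0 *: v + p) = f p by rewrite scale0r add0r.
have fE : is_derive (0 : R) 1 (fun t : R => f (t *: v + p)) ('D_v f p).
  by apply/E.
have gE : is_derive (f (0 *: v + p)) 1 g dg by rewrite fp.
exact: (@is_derive1_comp R g (fun t => f (t *: v + p)) 0 dg ('D_v f p)).
Qed.

Lemma smooth_comp1 V (O : set V) (U : set R) (g : R -> R) (f : V -> R) :
  open O -> open U -> (forall p, O p -> U (f p)) ->
  smooth_on U g -> smooth_on O f -> smooth_on O (fun p => g (f p)).
Proof.
move=> oO oU OU sg sf k; have := sf k; have := sg k.
elim: k g {sg} => [|k IH] g Hg Hf.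
  case: Hf => fc _; case: Hg => gc _.
  by split => // p Op; apply: continuous_comp; [exact: fc|apply: gc; exact: OU].
have [fc fd] := Hf; have [gc gd] := Hg.
split.
  by move=> p Op; apply: continuous_comp; [exact: fc|apply: gc; exact: OU].
move=> v; have [df Cf] := fd v; have [dg Cg] := gd 1.
have D p : O p -> is_derive p v (g \o f) ('D_1 g (f p) * 'D_v f p).
  move=> Op; apply: is_derive_comp1; apply: derivableP; first exact: df.
  by apply: dg; exact: OU.
split; first by move=> p /D[].
apply: (@Ck_ext _ _ _ _ (fun p => 'D_1 g (f p) * 'D_v f p)) => //.
  by move=> p /D[_ <-].
apply: Ck_mul => //; apply: (IH ('D_1 g)); first exact: Cg.
exact: Ck_le.
Qed.

Lemma derive_R (W : normedModType R) (g : R -> W) (x v : R) : derivable g x 1 ->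
  is_derive x v g (v *: 'D_1 g x).
Proof.
move=> /derivable1_diffP dg; apply: DeriveDef; first exact: diff_derivable.
by rewrite !deriveE// -[in LHS](mulr1 v) [LHS]linearZ.
Qed.

End SmoothAlgebra.

Section SmoothAlgebra2.
Variable R : realType.
Implicit Types V W : normedModType R.

(** The derivative of the inverse is a polynomial in the inverse, which allows an
   induction on the order of differentiability. *)
Lemma smooth_inv_R : smooth_on [set x : R | x != 0] (fun x => x^-1).
Proof.
have oU : open [set x : R | x != 0].
  exact: open_neq.
have D (x : R) : x != 0 -> is_derive x 1 (fun x : R => x^-1) (- (x^-1 * x^-1)).
  move=> x0; have := @derivableV R R id x 1 x0 (@derivable_id _ _ _ _).
  have := @deriveV R R id x 1 x0 (@derivable_id _ _ _ _).
  rewrite derive_id => E d; apply: DeriveDef => //.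
  by rewrite [LHS]E -exprVn expr2 scaleNr [_ *: _]mulr1.
have C (x : R) : x != 0 -> {for x, continuous (fun x : R => x^-1)}.
  by move=> x0; apply: inv_continuous.
elim=> [|k IH]; first by split.
split; first by [].
move=> v.
have Dv (x : R) : x != 0 -> is_derive x v (fun x : R => x^-1) (v * - (x^-1 * x^-1)).
  by move=> /D[d <-]; exact: derive_R.
split; first by move=> p /= /Dv[].
apply: (@Ck_ext _ _ _ _ _ (fun x : R => v * - (x^-1 * x^-1))) => //.
  by move=> p /= /Dv[_ ->].
under [X in Ck _ _ X]eq_fun do rewrite mulrN -mulNr.
apply: Ck_mul => //; first exact: smooth_cst.
exact: Ck_mul.
Qed.

Lemma smooth_inv V (O : set V) (f : V -> R) : open O -> (forall p, O p -> f p != 0) ->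
  smooth_on O f -> smooth_on O (fun p => (f p)^-1).
Proof.
move=> oO f0 sf; apply: (smooth_comp1 oO _ f0 smooth_inv_R sf).
exact: open_neq.
Qed.

Lemma open_pos : open [set x : R | 0 < x].
Proof. exact: open_gt. Qed.

Lemma smooth_sqrt_R : smooth_on [set x : R | 0 < x] (fun x => Num.sqrt x).
Proof.
have D (x : R) : 0 < x -> is_derive x 1 (fun x : R => Num.sqrt x) (2 * Num.sqrt x)^-1.
  by move=> x0; exact: is_derive1_sqrt.
elim=> [|k IH]; first by split => // x _; exact: sqrt_continuous.
split; first by move=> x _; exact: sqrt_continuous.
move=> v.
have Dv (x : R) : 0 < x -> is_derive x v (fun x : R => Num.sqrt x) (v * (2 * Num.sqrt x)^-1).
  by move=> /D[d <-]; exact: derive_R.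
split; first by move=> p /= /Dv[].
apply: (@Ck_ext _ _ _ _ _ (fun x : R => v * (2 * Num.sqrt x)^-1)).
- exact: open_pos.
- by move=> p /= /Dv[_ ->].
apply: Ck_mul; [exact: open_pos|exact: smooth_cst|].
apply: (@Ck_ext _ _ _ _ _ (fun x : R => 2^-1 * (Num.sqrt x * x^-1))).
- exact: open_pos.
- move=> x /= x0; rewrite invfM; congr (_ * _).
  have s0 : Num.sqrt x != 0 by rewrite gt_eqF// sqrtr_gt0.
  by rewrite -[X in X^-1](@sqr_sqrtr R x) ?(ltW x0)// expr2 invfM mulrA mulfV// mul1r.
apply: Ck_mul; [exact: open_pos|exact: smooth_cst|].
apply: Ck_mul; [exact: open_pos|exact: IH|].
apply: smooth_inv; [exact: open_pos| by move=> p /gt_eqF->|].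
exact: smooth_id open_pos.
Qed.

Lemma smooth_sqrt V (O : set V) (f : V -> R) : open O -> (forall p, O p -> 0 < f p) ->
  smooth_on O f -> smooth_on O (fun p => Num.sqrt (f p)).
Proof. by move=> oO f0 sf; apply: (smooth_comp1 oO open_pos f0 smooth_sqrt_R sf). Qed.

End SmoothAlgebra2.
Section SmoothRow.
Variable R : realType.
Implicit Types V W : normedModType R.

Lemma is_derive_coord V m n (f : V -> 'M[R]_(m, n)) p v (df : 'M[R]_(m, n)) i j :
  is_derive p v f df -> is_derive p v (fun q => f q i j) (df i j).
Proof.
move=> [dfv <-]; apply: DeriveDef; first by move/derivable_mxP: dfv.
by rewrite derive_mx// mxE.
Qed.

Lemma smooth_rowP V m (O : set V) (f : V -> 'rV[R]_m) : open O ->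
  smooth_on O f <-> forall j, smooth_on O (fun p => f p 0 j).
Proof.
move=> oO; split=> [sf j k|sf].
  move: (sf k); elim: k f {sf} => [|k IH] f [fc fd].
    split => // p Op; apply: (@continuous_comp _ _ _ f (fun M : 'rV[R]_m => M 0 j)).
      exact: fc.
    exact: coord_continuous.
  split.
    move=> p Op; apply: (@continuous_comp _ _ _ f (fun M : 'rV[R]_m => M 0 j)).
      exact: fc.
    exact: coord_continuous.
  move=> v; have [df Cf] := fd v; split.
    by move=> p /df/derivable_mxP.
  apply: Ck_ext (IH _ Cf) => // p Op.
  by rewrite derive_mx ?mxE//; exact: df.
have -> : f = fun p => \sum_j (f p 0 j *: delta_mx 0 j : 'rV[R]_m).
  by apply/funext => p; rewrite -row_sum_delta.
apply: smooth_sum => // j.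
pose w : 'rV[R]_m := delta_mx 0 j.
have w_lin : linear ( *:%R ^~ w : R -> _).
  by move=> u y z; rewrite scalerDl scalerA.
pose wlM := GRing.isLinear.Build _ _ _ _ _ w_lin.
pose wL : {linear R -> 'rV[R]_m} := HB.pack (fun c : R => c *: w) wlM.
apply: (@smooth_linear_post R V R 'rV[R]_m wL) => //.
exact: scalel_continuous.
Qed.

Lemma smooth_zscale V m (O : set V) (a : V -> R) (f : V -> 'rV[R]_m) : open O ->
  smooth_on O a -> smooth_on O f -> smooth_on O (fun p => a p *: f p).
Proof.
move=> oO sa sf; apply/smooth_rowP => // j.
under eq_fun do rewrite mxE; apply: smooth_mul => //.
by move/smooth_rowP : sf; apply.
Qed.

Lemma smooth_lorentz V m (O : set V) (f g : V -> 'rV[R]_m.+1) : open O ->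
  smooth_on O f -> smooth_on O g -> smooth_on O (fun p => lorentz (f p) (g p)).
Proof.
move=> oO /smooth_rowP-/(_ oO) sf /smooth_rowP-/(_ oO) sg.
apply: smooth_add => //; first by apply: smooth_opp => //; exact: smooth_mul.
by apply: smooth_sum => // i; exact: smooth_mul.
Qed.

Lemma smooth_dot V m (O : set V) (f g : V -> 'rV[R]_m) : open O ->
  smooth_on O f -> smooth_on O g -> smooth_on O (fun p => dot (f p) (g p)).
Proof.
move=> oO /smooth_rowP-/(_ oO) sf /smooth_rowP-/(_ oO) sg.
by apply: smooth_sum => // i; exact: smooth_mul.
Qed.

Lemma is_derive_row V m (f : V -> 'rV[R]_m) p v (df : 'rV[R]_m) :
  (forall j, is_derive p v (fun q => f q 0 j) (df 0 j)) -> is_derive p v f df.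
Proof.
move=> H; have D : derivable f p v.
  by apply/derivable_mxP => i j; rewrite (ord1 i); have [] := H j.
apply: DeriveDef => //; rewrite derive_mx//; apply/rowP => j; rewrite mxE.
by have [_ ->] := H j.
Qed.

Lemma is_derive_zscale V m (a : V -> R) (f : V -> 'rV[R]_m) p v (da : R) (df : 'rV[R]_m) :
  is_derive p v a da -> is_derive p v f df ->
  is_derive p v (fun q => a q *: f q) (da *: f p + a p *: df).
Proof.
move=> Ha Hf; apply: is_derive_row => j; rewrite !mxE.
under eq_fun do rewrite mxE.
have Hj := is_derive_coord 0 j Hf.
apply: (@is_derive_eq _ _ _ _ _ _ _ _ (is_deriveM Ha Hj)).
by rewrite addrC; congr (_ + _); rewrite mulrC.
Qed.

Lemma is_derive_lorentz V m (f g : V -> 'rV[R]_m.+1) p v (df dg : 'rV[R]_m.+1) :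
  is_derive p v f df -> is_derive p v g dg ->
  is_derive p v (fun q => lorentz (f q) (g q)) (lorentz df (g p) + lorentz (f p) dg).
Proof.
move=> Hf Hg.
have Hm j : is_derive p v (fun q => f q 0 j * g q 0 j)
   (df 0 j * g p 0 j + f p 0 j * dg 0 j).
  have Hfj := is_derive_coord 0 j Hf; have Hgj := is_derive_coord 0 j Hg.
  apply: (@is_derive_eq _ _ _ _ _ _ _ _ (is_deriveM Hfj Hgj)).
  by rewrite addrC; congr (_ + _); rewrite mulrC.
have Hs := is_derive_sum (fun i => Hm (lift ord0 i)).
have Hn := is_deriveN (Hm ord0).
have Hd := is_deriveD Hn Hs.
set h := (X in is_derive _ _ X _) in Hd.
have -> : (fun q => lorentz (f q) (g q)) = h.
  by apply/funext => q; rewrite /h /lorentz fctE fct_sumE.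
apply: (is_derive_eq Hd); rewrite /lorentz big_split/= opprD.
by rewrite !addrA; congr (_ + _); rewrite -!addrA; congr (_ + _); exact: addrC.
Qed.

Lemma is_derive_dot V m (f g : V -> 'rV[R]_m) p v (df dg : 'rV[R]_m) :
  is_derive p v f df -> is_derive p v g dg ->
  is_derive p v (fun q => dot (f q) (g q)) (dot df (g p) + dot (f p) dg).
Proof.
move=> Hf Hg.
have Hm j : is_derive p v (fun q => f q 0 j * g q 0 j)
   (df 0 j * g p 0 j + f p 0 j * dg 0 j).
  have Hfj := is_derive_coord 0 j Hf; have Hgj := is_derive_coord 0 j Hg.
  apply: (@is_derive_eq _ _ _ _ _ _ _ _ (is_deriveM Hfj Hgj)).
  by rewrite addrC; congr (_ + _); rewrite mulrC.
have Hs := is_derive_sum Hm.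
set h := (X in is_derive _ _ X _) in Hs.
have -> : (fun q => dot (f q) (g q)) = h.
  by apply/funext => q; rewrite /h /dot fct_sumE.
by apply: (is_derive_eq Hs); rewrite /dot big_split.
Qed.

End SmoothRow.

(** du and dv are sealed: otherwise unification compares two different partial
   derivatives by unfolding both of them down to limits of difference quotients. *)
HB.lock Definition dx (R : realType) (W : normedModType R) (f : R * R -> W)
  (p : R * R) : W := du f p.
HB.lock Definition dy (R : realType) (W : normedModType R) (f : R * R -> W)
  (p : R * R) : W := dv f p.

Section PlaneCalculus.
Variable R : realType.
Implicit Types (p : R * R) (O : set (R * R)).

Lemma nbhs_squareP p (A : set (R * R)) : nbhs p A <->
  exists2 d : R, 0 < d & forall q, `|q.1 - p.1| < d -> `|q.2 - p.2| < d -> A q.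
Proof.
split=> [/nbhs_ballP[d d0 H]|[d d0 H]].
  exists d => // q h1 h2; apply: H; split; rewrite /ball /= distrC; assumption.
apply/nbhs_ballP; exists d => // q [h1 h2].
by apply: H; rewrite distrC; [exact: h1|exact: h2].
Qed.

Lemma MVT_dist (f df : R -> R) (a h : R) :
  (forall x, `|x - a| <= `|h| -> is_derive x 1 f (df x)) ->
  exists2 c, `|c - a| <= `|h| & f (a + h) - f a = df c * h.
Proof.
move=> H.
have cf x : `|x - a| <= `|h| -> {for x, continuous f}.
  by move=> /H[/derivable1_diffP d _]; exact: differentiable_continuous.
have [h0|h0] := leP 0 h.
  have sub x : x \in `[a, a + h]%R -> `|x - a| <= `|h|.
    by rewrite in_itv/= => /andP[x1 x2]; rewrite (ger0_norm h0) ger0_norm; lra.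
  have [|||c cab E] := @MVT_segment R f df a (a + h).
  - by rewrite lerDl.
  - by move=> x xi; apply/H/sub; apply: subset_itv_oo_cc xi.
  - apply: continuous_in_subspaceT => x; rewrite inE/= => xi.
    by apply/cf/sub.
  by exists c; [exact: sub|rewrite E addrAC subrr add0r].
have sub x : x \in `[a + h, a]%R -> `|x - a| <= `|h|.
  by rewrite in_itv/= => /andP[x1 x2]; rewrite (ltr0_norm h0) ler0_norm; lra.
have [|||c cab E] := @MVT_segment R f df (a + h) a.
- lra.
- by move=> x xi; apply/H/sub; apply: subset_itv_oo_cc xi.
- apply: continuous_in_subspaceT => x; rewrite inE/= => xi.
  by apply/cf/sub.
exists c; first exact: sub.
by rewrite -opprB E; ring.
Qed.

Lemma is_derive_du (W : normedModType R) (f : R * R -> W) u v df :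
  is_derive (u, v) (e1 R) f df <-> is_derive u 1 (fun u => f (u, v)) df.
Proof.
rewrite !is_derive_cvgP.
have E t : t *: e1 R + (u, v) = (t *: 1 + u, v).
  by rewrite /e1; congr pair; rewrite /= ?scaler0 ?add0r.
by under eq_fun do rewrite E.
Qed.

Lemma is_derive_dv (W : normedModType R) (f : R * R -> W) u v df :
  is_derive (u, v) (e2 R) f df <-> is_derive v 1 (fun v => f (u, v)) df.
Proof.
rewrite !is_derive_cvgP.
have E t : t *: e2 R + (u, v) = (u, t *: 1 + v).
  by rewrite /e2; congr pair; rewrite /= ?scaler0 ?add0r.
by under eq_fun do rewrite E.
Qed.

Lemma smooth_dx (W : normedModType R) O (f : R * R -> W) : smooth_on O f -> smooth_on O (dx f).
Proof. by move=> sf; rewrite (_ : dx f = 'D_(e1 R) f); [exact: smooth_derive|apply/funext => p; rewrite dx.unlock]. Qed.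
Lemma smooth_dy (W : normedModType R) O (f : R * R -> W) : smooth_on O f -> smooth_on O (dy f).
Proof. by move=> sf; rewrite (_ : dy f = 'D_(e2 R) f); [exact: smooth_derive|apply/funext => p; rewrite dy.unlock]. Qed.

Lemma is_dx (W : normedModType R) O (f : R * R -> W) p : smooth_on O f -> O p ->
  is_derive p (e1 R) f (dx f p).
Proof. by move=> sf Op; rewrite dx.unlock; apply: derivableP; apply: smooth_derivable sf Op. Qed.
Lemma is_dy (W : normedModType R) O (f : R * R -> W) p : smooth_on O f -> O p ->
  is_derive p (e2 R) f (dy f p).
Proof. by move=> sf Op; rewrite dy.unlock; apply: derivableP; apply: smooth_derivable sf Op. Qed.

(** Continuous partial derivatives imply differentiability: the increment is split
   into a horizontal and a vertical one, and the mean value theorem is applied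
   to each. *)
Lemma smooth_diff O (f : R * R -> R) p : open O -> smooth_on O f -> O p ->
  differentiable f p /\
  'd f p = (fun v : R * R => v.1 * dx f p + v.2 * dy f p) :> (R * R -> R).
Proof.
move=> oO sf; case: p => a b; set p := (a, b) => Op.
pose L (v : R * R) := v.1 * dx f p + v.2 * dy f p.
have L_lin : linear (L : R * R -> R).
  by move=> c x y; rewrite /L /=; rewrite /GRing.scale/=; ring.
pose LM := GRing.isLinear.Build _ _ _ _ _ L_lin.
pose LL : {linear (R * R)%type -> R} := HB.pack L LM.
have Lc : continuous LL.
  move=> v; apply: (@continuousD _ _ _ (fun v : R * R => v.1 * dx f p)
    (fun v : R * R => v.2 * dy f p)); apply: continuousM;
    by [exact: cvg_fst|exact: cvg_snd|exact: cvg_cst].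
have key : f \o shift p = cst (f p) + LL +o_ (0 : R * R) id.
  apply/eqaddoP => _/posnumP[e].
  have e2 : 0 < e%:num / 2 by rewrite divr_gt0.
  have c1 := smooth_continuous (smooth_dx sf) Op.
  have c2 := smooth_continuous (smooth_dy sf) Op.
  have /nbhs_squareP[d d0 H] : \forall q \near p,
     [/\ O q, `|dx f p - dx f q| <= e%:num / 2 & `|dy f p - dy f q| <= e%:num / 2].
    have n1 : \forall q \near p, `|dx f p - dx f q| <= e%:num / 2.
      by move/cvgrPdist_le : c1; apply.
    have n2 : \forall q \near p, `|dy f p - dy f q| <= e%:num / 2.
      by move/cvgrPdist_le : c2; apply.
    have n3 := open_near oO Op.
    by near=> q; split; near: q.
  apply/nbhs_squareP; exists d => // -[h k] /=; rewrite !subr0 => hd kd.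
  have {}H (q : R * R) : `|q.1 - a| < d -> `|q.2 - b| < d -> [/\ O q,
    `|dx f p - dx f q| <= e%:num / 2 & `|dy f p - dy f q| <= e%:num / 2] := H q.
  have Hq x y : `|x - a| < d -> `|y - b| < d -> O (x, y) by move=> xd yd; case: (H (x, y)).
  have bk : `|b + k - b| < d by rewrite addrAC subrr add0r.
  have bb : `|b - b| < d by rewrite subrr normr0.
  have [c ca E1] : exists2 c, `|c - a| <= `|h| &
     f (a + h, b + k) - f (a, b + k) = dx f (c, b + k) * h.
    apply: (@MVT_dist (fun x => f (x, b + k)) (fun x => dx f (x, b + k))) => x xa.
    apply/is_derive_du; apply: is_dx sf _; apply: Hq => //.
    exact: le_lt_trans xa hd.
  have [c' cb E2] : exists2 c', `|c' - b| <= `|k| &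
     f (a, b + k) - f (a, b) = dy f (a, c') * k.
    apply: (@MVT_dist (fun x => f (a, x)) (fun x => dy f (a, x))) => x xa.
    apply/is_derive_dv; apply: is_dy sf _; apply: Hq => //.
      by rewrite subrr normr0.
    exact: le_lt_trans xa kd.
  have [_ H1 _] := H (c, b + k) (le_lt_trans ca hd) bk.
  have [_ _ H2] : [/\ O (a, c'), `|dx f (a, b) - dx f (a, c')| <= e%:num / 2
     & `|dy f (a, b) - dy f (a, c')| <= e%:num / 2].
    by apply: H; rewrite /= ?subrr ?normr0//; exact: le_lt_trans cb kd.
  rewrite [X in `|X|](_ : _ = (dx f (c, b + k) - dx f (a, b)) * h
                           + (dy f (a, c') - dy f (a, b)) * k); last first.
    rewrite !fctE /= /shift /= /L /=.
    have -> : ((h, k) + (a, b) : R * R) = (a + h, b + k).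
      by congr pair; rewrite /= addrC.
    have -> : f (a + h, b + k) = dx f (c, b + k) * h + (dy f (a, c') * k + f (a, b)).
      by rewrite -E1 -E2; ring.
    by ring.
  apply: le_trans (ler_normD _ _) _; rewrite !normrM.
  rewrite (splitr e%:num) mulrDl; apply: lerD; apply: ler_pM => //; rewrite 1?distrC//.
    by rewrite prod_normE/= le_max lexx.
  by rewrite prod_normE/= le_max lexx orbT.
have E := diff_unique Lc key.
split; last exact: E.
by apply/diff_locallyP; split; rewrite E.
Unshelve. all: by end_near. Qed.

Lemma dx_eq (W : normedModType R) (f : R * R -> W) p df :
  is_derive p (e1 R) f df -> dx f p = df.
Proof. by case=> _; rewrite dx.unlock. Qed.
Lemma dy_eq (W : normedModType R) (f : R * R -> W) p df :
  is_derive p (e2 R) f df -> dy f p = df.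
Proof. by case=> _; rewrite dy.unlock. Qed.

Lemma dx_near (W : normedModType R) (f g : R * R -> W) p :
  (\near p, f p = g p) -> dx f p = dx g p.
Proof. by rewrite dx.unlock; exact: near_eq_derive. Qed.
Lemma dy_near (W : normedModType R) (f g : R * R -> W) p :
  (\near p, f p = g p) -> dy f p = dy g p.
Proof. by rewrite dy.unlock; exact: near_eq_derive. Qed.

Lemma dx_on (W : normedModType R) O (f g : R * R -> W) p : open O ->
  (forall q, O q -> f q = g q) -> O p -> dx f p = dx g p.
Proof. by move=> oO fg Op; apply: dx_near; apply: filterS (open_near oO Op) => q /fg. Qed.
Lemma dy_on (W : normedModType R) O (f g : R * R -> W) p : open O ->
  (forall q, O q -> f q = g q) -> O p -> dy f p = dy g p.
Proof. by move=> oO fg Op; apply: dy_near; apply: filterS (open_near oO Op) => q /fg. Qed.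

End PlaneCalculus.

Section ChainRule.
Variable R : realType.
Implicit Types V W : normedModType R.

Lemma is_derive_line V W (f : V -> W) p v df :
  is_derive p v f df <-> is_derive (0 : R) 1 (fun t : R => f (t *: v + p)) df.
Proof.
rewrite !is_derive_cvgP.
have E (t : R) : t *: 1 + 0 = t by rewrite addr0 [_%:A]mulr1.
have E0 : f (0 *: v + p) = f p by rewrite scale0r add0r.
by under [X in _ <-> (X @ _ --> _)]eq_fun do rewrite E E0.
Qed.

(** Composition with a differentiable map is reduced to composition along a line,
   where the chain rule for differentials applies. *)
Lemma is_derive_chain V (g : R * R -> R) (t : V -> R * R) p v (dt : R * R) :
  differentiable g (t p) -> is_derive p v t dt ->
  is_derive p v (g \o t) ('d g (t p) dt).
Proof.
move=> dg /is_derive_line[/derivable1_diffP d1 E1]; apply/is_derive_line.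
set ga := fun _ => _ in d1 E1.
have ga0 : t p = ga 0 by rewrite /ga scale0r add0r.
rewrite ga0 in dg *.
have dd : differentiable (g \o ga) 0 by exact: differentiable_comp.
apply: DeriveDef; first exact: diff_derivable.
have E := deriveE (1 : R) dd; have Ec := diff_comp d1 dg.
rewrite -E1 (deriveE (1 : R) d1).
by apply: etrans E _; rewrite Ec.
Qed.

Lemma smooth_fst V (O : set V) (f : V -> R * R) : open O -> smooth_on O f ->
  smooth_on O (fun q => (f q).1).
Proof.
by move=> oO sf; apply: (smooth_linear_post (h := fst)) => //; move=> ?; exact: cvg_fst.
Qed.

Lemma smooth_snd V (O : set V) (f : V -> R * R) : open O -> smooth_on O f ->
  smooth_on O (fun q => (f q).2).
Proof.
by move=> oO sf; apply: (smooth_linear_post (h := snd)) => //; move=> ?; exact: cvg_snd.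
Qed.

Lemma is_derive_chain_smooth V (U : set (R * R)) (g : R * R -> R) (t : V -> R * R) p v
    (dt : R * R) : open U -> smooth_on U g -> U (t p) -> is_derive p v t dt ->
  is_derive p v (fun q => g (t q)) (dt.1 * dx g (t p) + dt.2 * dy g (t p)).
Proof.
move=> oU sg Up Dt; have [dg E] := smooth_diff oU sg Up.
by have := is_derive_chain dg Dt; rewrite E.
Qed.

Lemma smooth_comp V (O : set V) (U : set (R * R)) (g : R * R -> R) (t : V -> R * R) :
  open O -> open U -> (forall p, O p -> U (t p)) ->
  smooth_on U g -> smooth_on O t -> smooth_on O (fun p => g (t p)).
Proof.
move=> oO oU OU sg st k.
elim: k g sg => [|k IH] g sg.
  split => // p Op; apply: continuous_comp; first exact: smooth_continuous st Op.
  exact: smooth_continuous sg (OU _ Op).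
split.
  move=> p Op; apply: continuous_comp; first exact: smooth_continuous st Op.
  exact: smooth_continuous sg (OU _ Op).
move=> v.
have D p : O p -> is_derive p v (fun q => g (t q))
   (('D_v t p).1 * dx g (t p) + ('D_v t p).2 * dy g (t p)).
  move=> Op; apply: (is_derive_chain_smooth oU sg (OU _ Op)).
  by apply: derivableP; exact: smooth_derivable st Op.
split; first by move=> p /D[].
apply: (@Ck_ext _ _ _ _ _
   (fun p => ('D_v t p).1 * dx g (t p) + ('D_v t p).2 * dy g (t p))) => //.
  by move=> p /D[_ <-].
have s' := smooth_derive v st.
apply: Ck_add => //; apply: Ck_mul => //.
- exact: (smooth_fst oO s').
- by apply: (IH (dx g)); exact: smooth_dx.
- exact: (smooth_snd oO s').
- by apply: (IH (dy g)); exact: smooth_dy.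
Qed.

Lemma smooth_comp_row V m (O : set V) (U : set (R * R)) (g : R * R -> 'rV[R]_m)
    (t : V -> R * R) :
  open O -> open U -> (forall p, O p -> U (t p)) ->
  smooth_on U g -> smooth_on O t -> smooth_on O (fun p => g (t p)).
Proof.
move=> oO oU OU /smooth_rowP-/(_ oU) sg st; apply/smooth_rowP => // j.
exact: (smooth_comp oO oU OU (sg j) st).
Qed.

Lemma is_derive_chain_row V m (U : set (R * R)) (g : R * R -> 'rV[R]_m) (t : V -> R * R) p v
    (dt : R * R) : open U -> smooth_on U g -> U (t p) -> is_derive p v t dt ->
  is_derive p v (fun q => g (t q)) (dt.1 *: dx g (t p) + dt.2 *: dy g (t p)).
Proof.
move=> oU sg Up Dt; apply: is_derive_row => j.
have sgj := (smooth_rowP g oU).1 sg j.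
have mxD (a b : R) (x y : 'rV[R]_m) : (a *: x + b *: y) 0 j = a * x 0 j + b * y 0 j.
  by rewrite !mxE.
rewrite mxD -(dx_eq (is_derive_coord 0 j (is_dx sg Up))).
rewrite -(dy_eq (is_derive_coord 0 j (is_dy sg Up))).
exact: is_derive_chain_smooth oU sgj Up Dt.
Qed.

(** Both mixed derivatives are limits of the same second difference divided by the
   area h^2 of a small square, by two applications of the mean value theorem. *)
Lemma schwarz_R (O : set (R * R)) (f : R * R -> R) p : open O -> smooth_on O f -> O p ->
  dy (dx f) p = dx (dy f) p.
Proof.
have alg (w11 w10 w01 w00 A B x y h : R) : h != 0 ->
    (w11 - w10) - (w01 - w00) = A * h -> A = x * h ->
    (w11 - w01) - (w10 - w00) = B * h -> B = y * h -> x = y.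
  move=> h0 E1 EA E2 EB; apply: (mulIf h0); apply: (mulIf h0).
  by rewrite -EA -EB -E1 -E2; ring.
have tri (x y z e : R) : `|x - z| <= e / 2 -> `|y - z| <= e / 2 -> `|x - y| <= e.
  move=> n1 n2; rewrite (_ : x - y = (x - z) - (y - z)); last by ring.
  by apply: le_trans (ler_normB _ _) _; rewrite [leRHS]splitr lerD.
move=> oO sf; case: p => a b Op.
have s12 := smooth_dy (smooth_dx sf); have s21 := smooth_dx (smooth_dy sf).
apply/eqP; rewrite -subr_eq0 -normr_le0; apply/ler_addgt0Pl => e e0; rewrite addr0.
have e20 : 0 < e / 2 by rewrite divr_gt0.
have /nbhs_squareP[d d0 H] : \forall q \near ((a, b) : R * R),
  [/\ O q, `|dy (dx f) (a, b) - dy (dx f) q| <= e / 2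
   & `|dx (dy f) (a, b) - dx (dy f) q| <= e / 2].
  have n1 : \forall q \near ((a, b) : R * R),
      `|dy (dx f) (a, b) - dy (dx f) q| <= e / 2.
    by move/cvgrPdist_le : (smooth_continuous s12 Op); apply.
  have n2 : \forall q \near ((a, b) : R * R),
      `|dx (dy f) (a, b) - dx (dy f) q| <= e / 2.
    by move/cvgrPdist_le : (smooth_continuous s21 Op); apply.
  have n3 := open_near oO Op.
  by apply: filterS (filterI n3 (filterI n1 n2)) => q [? [m1 m2]]; split;
    [|exact: m1|exact: m2].
pose h := d / 2; have h0 : 0 < h by rewrite divr_gt0.
have hd : h < d by rewrite /h; lra.
have nh : `|h| = h by rewrite gtr0_norm.
have {}H x y : `|x - a| <= `|h| -> `|y - b| <= `|h| -> [/\ O (x, y),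
   `|dy (dx f) (a, b) - dy (dx f) (x, y)| <= e / 2
   & `|dx (dy f) (a, b) - dx (dy f) (x, y)| <= e / 2].
  by rewrite nh => xa yb; apply: (H (x, y)); apply: le_lt_trans hd.
have bb : `|b - b| <= `|h| by rewrite subrr normr0 normr_ge0.
have aa : `|a - a| <= `|h| by rewrite subrr normr0 normr_ge0.
have bh : `|b + h - b| <= `|h| by rewrite addrAC subrr add0r.
have ah : `|a + h - a| <= `|h| by rewrite addrAC subrr add0r.
have [c ca E1] : exists2 c, `|c - a| <= `|h| &
    (f (a + h, b + h) - f (a + h, b)) - (f (a, b + h) - f (a, b))
    = (dx f (c, b + h) - dx f (c, b)) * h.
  apply: (@MVT_dist R (fun x => f (x, b + h) - f (x, b))
    (fun x => dx f (x, b + h) - dx f (x, b))) => x xa.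
  apply: is_deriveB; apply/is_derive_du; apply: is_dx sf _.
    by have [] := H x _ xa bh.
  by have [] := H x _ xa bb.
have [c' cb E1'] : exists2 c', `|c' - b| <= `|h| &
    dx f (c, b + h) - dx f (c, b) = dy (dx f) (c, c') * h.
  apply: (@MVT_dist R (fun y => dx f (c, y)) (fun y => dy (dx f) (c, y))) => y yb.
  by apply/is_derive_dv; apply: is_dy (smooth_dx sf) _; have [] := H c y ca yb.
have [k kb E2] : exists2 k, `|k - b| <= `|h| &
    (f (a + h, b + h) - f (a, b + h)) - (f (a + h, b) - f (a, b))
    = (dy f (a + h, k) - dy f (a, k)) * h.
  apply: (@MVT_dist R (fun y => f (a + h, y) - f (a, y))
    (fun y => dy f (a + h, y) - dy f (a, y))) => y yb.
  apply: is_deriveB; apply/is_derive_dv; apply: is_dy sf _.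
    by have [] := H _ y ah yb.
  by have [] := H _ y aa yb.
have [k' ka E2'] : exists2 k', `|k' - a| <= `|h| &
    dy f (a + h, k) - dy f (a, k) = dx (dy f) (k', k) * h.
  apply: (@MVT_dist R (fun x => dy f (x, k)) (fun x => dx (dy f) (x, k))) => x xa.
  by apply/is_derive_du; apply: is_dx (smooth_dy sf) _; have [] := H x k xa kb.
have E : dy (dx f) (c, c') = dx (dy f) (k', k).
  exact: (alg _ _ _ _ _ _ _ _ _ (lt0r_neq0 h0) E1 E1' E2 E2').
have [_ + _] := H c c' ca cb; have [_ _ +] := H k' k ka kb.
rewrite E => n2 n1; exact: (tri _ _ _ _ n1 n2).
Qed.

Lemma dx_coord m (O : set (R * R)) (f : R * R -> 'rV[R]_m) p j : smooth_on O f -> O p ->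
  dx f p 0 j = dx (fun q => f q 0 j) p.
Proof. by move=> sf Op; rewrite (dx_eq (is_derive_coord 0 j (is_dx sf Op))). Qed.

Lemma dy_coord m (O : set (R * R)) (f : R * R -> 'rV[R]_m) p j : smooth_on O f -> O p ->
  dy f p 0 j = dy (fun q => f q 0 j) p.
Proof. by move=> sf Op; rewrite (dy_eq (is_derive_coord 0 j (is_dy sf Op))). Qed.

Lemma schwarz m (O : set (R * R)) (f : R * R -> 'rV[R]_m) p : open O -> smooth_on O f -> O p ->
  dy (dx f) p = dx (dy f) p.
Proof.
move=> oO sf Op; apply/rowP => j.
rewrite (dy_coord _ (smooth_dx sf) Op) (dx_coord _ (smooth_dy sf) Op).
have sfj := (smooth_rowP f oO).1 sf j.
rewrite -(dy_on oO (fun q Oq => esym (dx_coord j sf Oq)) Op).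
rewrite -(dx_on oO (fun q Oq => esym (dy_coord j sf Oq)) Op).
exact: schwarz_R oO sfj Op.
Qed.

End ChainRule.

(** * The Lorentzian form along maps of the plane *)
HB.lock Definition lor (R : realType) (m : nat) (x y : 'rV[R]_m.+1) : R := lorentz x y.

Section LorentzAlgebra.
Variables (R : realType) (m : nat).
Implicit Types x y z w : 'rV[R]_m.+1.

Lemma lorC x y : lor x y = lor y x.
Proof.
rewrite lor.unlock /lorentz; congr (- _ + _); first exact: mulrC.
by apply: eq_bigr => i _; exact: mulrC.
Qed.

Lemma lorDl x y z : lor (x + y) z = lor x z + lor y z.
Proof.
rewrite lor.unlock /lorentz !mxE mulrDl.
under eq_bigr do rewrite mxE mulrDl.
by rewrite big_split/=; ring.
Qed.

Lemma lorZl (a : R) x z : lor (a *: x) z = a * lor x z.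
Proof.
rewrite lor.unlock /lorentz !mxE.
under eq_bigr do rewrite mxE -mulrA.
by rewrite -mulr_sumr; ring.
Qed.

Lemma lorDr x y z : lor x (y + z) = lor x y + lor x z.
Proof. by rewrite lorC lorDl !(lorC _ x). Qed.

Lemma lorZr (a : R) x z : lor x (a *: z) = a * lor x z.
Proof. by rewrite lorC lorZl (lorC z). Qed.

Lemma lorNl x z : lor (- x) z = - lor x z.
Proof. by rewrite -scaleN1r lorZl mulN1r. Qed.

Lemma lorNr x z : lor x (- z) = - lor x z.
Proof. by rewrite -scaleN1r lorZr mulN1r. Qed.

Lemma lor0l x : lor 0 x = 0.
Proof. by rewrite -(scale0r 0) lorZl mul0r. Qed.

Lemma lor0r x : lor x 0 = 0.
Proof. by rewrite lorC lor0l. Qed.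

Definition lorE := (lorDl, lorDr, lorZl, lorZr, lorNl, lorNr, lor0l, lor0r).

Lemma is_derive_lor (V : normedModType R) (f g : V -> 'rV[R]_m.+1) p v (df dg : 'rV[R]_m.+1) :
  is_derive p v f df -> is_derive p v g dg ->
  is_derive p v (fun q => lor (f q) (g q)) (lor df (g p) + lor (f p) dg).
Proof. rewrite lor.unlock; exact: is_derive_lorentz. Qed.

Lemma smooth_lor (V : normedModType R) (O : set V) (f g : V -> 'rV[R]_m.+1) : open O ->
  smooth_on O f -> smooth_on O g -> smooth_on O (fun p => lor (f p) (g p)).
Proof. rewrite lor.unlock; exact: smooth_lorentz. Qed.

End LorentzAlgebra.

Section DxRules.
Variable R : realType.
Variables (O : set (R * R)) (p : R * R).
Hypothesis Op : O p.

Lemma dx_add (W : normedModType R) (f g : R * R -> W) : smooth_on O f -> smooth_on O g ->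
  dx (fun q => f q + g q) p = dx f p + dx g p.
Proof.
by move=> sf sg; apply: dx_eq; apply: is_deriveD; exact: is_dx Op.
Qed.
Lemma dy_add (W : normedModType R) (f g : R * R -> W) : smooth_on O f -> smooth_on O g ->
  dy (fun q => f q + g q) p = dy f p + dy g p.
Proof.
by move=> sf sg; apply: dy_eq; apply: is_deriveD; exact: is_dy Op.
Qed.

Lemma dx_sub (W : normedModType R) (f g : R * R -> W) : smooth_on O f -> smooth_on O g ->
  dx (fun q => f q - g q) p = dx f p - dx g p.
Proof.
by move=> sf sg; apply: dx_eq; apply: is_deriveB; exact: is_dx Op.
Qed.
Lemma dy_sub (W : normedModType R) (f g : R * R -> W) : smooth_on O f -> smooth_on O g ->
  dy (fun q => f q - g q) p = dy f p - dy g p.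
Proof.
by move=> sf sg; apply: dy_eq; apply: is_deriveB; exact: is_dy Op.
Qed.

Lemma dx_opp (W : normedModType R) (f : R * R -> W) : smooth_on O f ->
  dx (fun q => - f q) p = - dx f p.
Proof. by move=> sf; apply: dx_eq; apply: is_deriveN; exact: is_dx Op. Qed.
Lemma dy_opp (W : normedModType R) (f : R * R -> W) : smooth_on O f ->
  dy (fun q => - f q) p = - dy f p.
Proof. by move=> sf; apply: dy_eq; apply: is_deriveN; exact: is_dy Op. Qed.

Lemma dx_scale (W : normedModType R) (c : R) (f : R * R -> W) : smooth_on O f ->
  dx (fun q => c *: f q) p = c *: dx f p.
Proof. by move=> sf; apply: dx_eq; apply: is_deriveZ; exact: is_dx Op. Qed.
Lemma dy_scale (W : normedModType R) (c : R) (f : R * R -> W) : smooth_on O f ->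
  dy (fun q => c *: f q) p = c *: dy f p.
Proof. by move=> sf; apply: dy_eq; apply: is_deriveZ; exact: is_dy Op. Qed.

Lemma dx_cst (W : normedModType R) (c : W) : dx (fun=> c) p = 0.
Proof. by apply: dx_eq; exact: is_derive_cst. Qed.
Lemma dy_cst (W : normedModType R) (c : W) : dy (fun=> c) p = 0.
Proof. by apply: dy_eq; exact: is_derive_cst. Qed.

Lemma dx_mul (f g : R * R -> R) : smooth_on O f -> smooth_on O g ->
  dx (fun q => f q * g q) p = dx f p * g p + f p * dx g p.
Proof.
move=> sf sg; apply: dx_eq.
by apply: (is_derive_eq (is_deriveM (is_dx sf Op) (is_dx sg Op)));
  rewrite addrC; congr (_ + _); exact: mulrC.
Qed.
Lemma dy_mul (f g : R * R -> R) : smooth_on O f -> smooth_on O g ->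
  dy (fun q => f q * g q) p = dy f p * g p + f p * dy g p.
Proof.
move=> sf sg; apply: dy_eq.
by apply: (is_derive_eq (is_deriveM (is_dy sf Op) (is_dy sg Op)));
  rewrite addrC; congr (_ + _); exact: mulrC.
Qed.

Lemma dx_zscale m (a : R * R -> R) (f : R * R -> 'rV[R]_m) : smooth_on O a -> smooth_on O f ->
  dx (fun q => a q *: f q) p = dx a p *: f p + a p *: dx f p.
Proof. by move=> sa sf; apply: dx_eq; apply: is_derive_zscale; exact: is_dx Op. Qed.
Lemma dy_zscale m (a : R * R -> R) (f : R * R -> 'rV[R]_m) : smooth_on O a -> smooth_on O f ->
  dy (fun q => a q *: f q) p = dy a p *: f p + a p *: dy f p.
Proof. by move=> sa sf; apply: dy_eq; apply: is_derive_zscale; exact: is_dy Op. Qed.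

Lemma dx_lor m (f g : R * R -> 'rV[R]_m.+1) : smooth_on O f -> smooth_on O g ->
  dx (fun q => lor (f q) (g q)) p = lor (dx f p) (g p) + lor (f p) (dx g p).
Proof. by move=> sf sg; apply: dx_eq; apply: is_derive_lor; exact: is_dx Op. Qed.
Lemma dy_lor m (f g : R * R -> 'rV[R]_m.+1) : smooth_on O f -> smooth_on O g ->
  dy (fun q => lor (f q) (g q)) p = lor (dy f p) (g p) + lor (f p) (dy g p).
Proof. by move=> sf sg; apply: dy_eq; apply: is_derive_lor; exact: is_dy Op. Qed.

End DxRules.

Ltac smooth_tac :=
  repeat (first [ done | apply: smooth_cst | apply: smooth_add | apply: smooth_opp
    | apply: smooth_zscale | apply: smooth_lor | apply: smooth_exp | apply: smooth_mul
    | apply: smooth_dx | apply: smooth_dy ]).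

(** * Null lifts and their second derivatives *)
(** L = 4 Y_(z zbar), P = 4 Re Y_zz and Q = -4 Im Y_zz. *)
HB.lock Definition LY (R : realType) (m : nat) (Y : R * R -> 'rV[R]_m.+1) (p : R * R) :=
  dx (dx Y) p + dy (dy Y) p.
HB.lock Definition PY (R : realType) (m : nat) (Y : R * R -> 'rV[R]_m.+1) (p : R * R) :=
  dx (dx Y) p - dy (dy Y) p.
HB.lock Definition QY (R : realType) (m : nat) (Y : R * R -> 'rV[R]_m.+1) (p : R * R) :=
  2 *: dy (dx Y) p.

Section NullLift.
Variables (R : realType) (m : nat).
Implicit Types (O : set (R * R)) (Y : R * R -> 'rV[R]_m.+1).

(** What is used of a canonical lift, in the coordinates x, y.  The last two
   conditions say that the orthogonal of the null line of Y is positive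
   semi-definite with kernel that line. *)
Record null_lift O Y : Prop := NullLift {
  nl_open : open O;
  nl_smooth : smooth_on O Y;
  nl_null : forall p, O p -> lor (Y p) (Y p) = 0;
  nl_xx : forall p, O p -> lor (dx Y p) (dx Y p) = 1;
  nl_yy : forall p, O p -> lor (dy Y p) (dy Y p) = 1;
  nl_xy : forall p, O p -> lor (dx Y p) (dy Y p) = 0;
  nl_pos : forall p w, O p -> lor w (Y p) = 0 -> 0 <= lor w w;
  nl_def : forall p w, O p -> lor w (Y p) = 0 -> lor w w = 0 ->
    exists c : R, w = c *: Y p }.

(** The products of P and Q with L are the coefficients through which P and Q
   fail to be normal. *)
Definition pY Y (p : R * R) := lor (LY Y p) (PY Y p).
Definition qY Y (p : R * R) := lor (LY Y p) (QY Y p).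

Variables (O : set (R * R)) (Y : R * R -> 'rV[R]_m.+1).
Hypothesis nl : null_lift O Y.
Let oO := nl_open nl.
Let sY := nl_smooth nl.
Let s1 := smooth_dx sY.
Let s2 := smooth_dy sY.
Let s11 := smooth_dx s1.
Let s12 := smooth_dy s1.
Let s22 := smooth_dy s2.

Lemma nl_dyx p : O p -> dx (dy Y) p = dy (dx Y) p.
Proof. by move=> Op; rewrite (schwarz oO sY Op). Qed.

Lemma smooth_LY : smooth_on O (LY Y). Proof. rewrite LY.unlock; exact: smooth_add. Qed.
Lemma smooth_PY : smooth_on O (PY Y). Proof. rewrite PY.unlock; exact: smooth_subr. Qed.
Lemma smooth_QY : smooth_on O (QY Y). Proof. rewrite QY.unlock; exact: smooth_scale. Qed.
Lemma smooth_pY : smooth_on O (pY Y).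
Proof. exact: smooth_lor oO smooth_LY smooth_PY. Qed.
Lemma smooth_qY : smooth_on O (qY Y).
Proof. exact: smooth_lor oO smooth_LY smooth_QY. Qed.

(** All the relations between the second derivatives of Y result from
   differentiating constant inner products. *)
Lemma dx_lor_cst (f g : R * R -> 'rV[R]_m.+1) (c : R) p : smooth_on O f -> smooth_on O g ->
  (forall q, O q -> lor (f q) (g q) = c) -> O p ->
  lor (dx f p) (g p) + lor (f p) (dx g p) = 0.
Proof. by move=> sf sg E Op; rewrite -(dx_lor Op sf sg) (dx_on oO E Op) dx_cst. Qed.
Lemma dy_lor_cst (f g : R * R -> 'rV[R]_m.+1) (c : R) p : smooth_on O f -> smooth_on O g ->
  (forall q, O q -> lor (f q) (g q) = c) -> O p ->
  lor (dy f p) (g p) + lor (f p) (dy g p) = 0.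
Proof. by move=> sf sg E Op; rewrite -(dy_lor Op sf sg) (dy_on oO E Op) dy_cst. Qed.

Section AtPoint.
Variable p : R * R.
Hypothesis Op : O p.

Lemma nl_0x : lor (Y p) (dx Y p) = 0.
Proof.
by have := dx_lor_cst sY sY (nl_null nl) Op; rewrite (lorC (dx Y p)); lra.
Qed.
Lemma nl_0y : lor (Y p) (dy Y p) = 0.
Proof.
by have := dy_lor_cst sY sY (nl_null nl) Op; rewrite (lorC (dy Y p)); lra.
Qed.
End AtPoint.

Section AtPoint2.
Variable p : R * R.
Hypothesis Op : O p.

Lemma nl_0xx : lor (Y p) (dx (dx Y) p) = -1.
Proof.
by have := dx_lor_cst sY s1 (nl_0x) Op; rewrite (nl_xx nl Op); lra.
Qed.
Lemma nl_0xy : lor (Y p) (dy (dx Y) p) = 0.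
Proof.
have := dy_lor_cst sY s1 (nl_0x) Op.
by rewrite (lorC (dy Y p)) (nl_xy nl Op); lra.
Qed.
Lemma nl_0yy : lor (Y p) (dy (dy Y) p) = -1.
Proof.
by have := dy_lor_cst sY s2 (nl_0y) Op; rewrite (nl_yy nl Op); lra.
Qed.

Lemma nl_xxx : lor (dx (dx Y) p) (dx Y p) = 0.
Proof.
by have := dx_lor_cst s1 s1 (nl_xx nl) Op; rewrite (lorC (dx Y p)); lra.
Qed.
Lemma nl_xyx : lor (dy (dx Y) p) (dx Y p) = 0.
Proof.
by have := dy_lor_cst s1 s1 (nl_xx nl) Op; rewrite (lorC (dx Y p)); lra.
Qed.
Lemma nl_xyy : lor (dy (dx Y) p) (dy Y p) = 0.
Proof.
have := dx_lor_cst s2 s2 (nl_yy nl) Op.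
by rewrite (lorC (dy Y p)) (nl_dyx Op); lra.
Qed.
Lemma nl_yyy : lor (dy (dy Y) p) (dy Y p) = 0.
Proof.
by have := dy_lor_cst s2 s2 (nl_yy nl) Op; rewrite (lorC (dy Y p)); lra.
Qed.
Lemma nl_xxy : lor (dx (dx Y) p) (dy Y p) = 0.
Proof.
have := dx_lor_cst s1 s2 (nl_xy nl) Op.
by rewrite (lorC (dx Y p)) (nl_dyx Op) nl_xyx; lra.
Qed.
Lemma nl_yyx : lor (dy (dy Y) p) (dx Y p) = 0.
Proof.
have := dy_lor_cst s1 s2 (nl_xy nl) Op.
by rewrite (lorC (dx Y p)) nl_xyy; lra.
Qed.

Lemma LY_Y : lor (LY Y p) (Y p) = -2.
Proof. by rewrite LY.unlock lorDl !(lorC _ (Y p)) nl_0xx nl_0yy; lra. Qed.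
Lemma LY_x : lor (LY Y p) (dx Y p) = 0.
Proof. by rewrite LY.unlock lorDl nl_xxx nl_yyx addr0. Qed.
Lemma LY_y : lor (LY Y p) (dy Y p) = 0.
Proof. by rewrite LY.unlock lorDl nl_xxy nl_yyy addr0. Qed.
Lemma PY_Y : lor (PY Y p) (Y p) = 0.
Proof. by rewrite PY.unlock lorDl lorNl !(lorC _ (Y p)) nl_0xx nl_0yy; lra. Qed.
Lemma PY_x : lor (PY Y p) (dx Y p) = 0.
Proof. by rewrite PY.unlock lorDl lorNl nl_xxx nl_yyx subr0. Qed.
Lemma PY_y : lor (PY Y p) (dy Y p) = 0.
Proof. by rewrite PY.unlock lorDl lorNl nl_xxy nl_yyy subr0. Qed.
Lemma QY_Y : lor (QY Y p) (Y p) = 0.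
Proof. by rewrite QY.unlock lorZl !(lorC _ (Y p)) nl_0xy mulr0. Qed.
Lemma QY_x : lor (QY Y p) (dx Y p) = 0.
Proof. by rewrite QY.unlock lorZl nl_xyx mulr0. Qed.
Lemma QY_y : lor (QY Y p) (dy Y p) = 0.
Proof. by rewrite QY.unlock lorZl nl_xyy mulr0. Qed.

(** The 2-jet of Y through L, P, Q. *)
Lemma Yxx_LP : dx (dx Y) p = 2^-1 *: (LY Y p + PY Y p).
Proof. by apply/rowP => i; rewrite LY.unlock PY.unlock !mxE; lra. Qed.
Lemma Yyy_LP : dy (dy Y) p = 2^-1 *: (LY Y p - PY Y p).
Proof. by apply/rowP => i; rewrite LY.unlock PY.unlock !mxE; lra. Qed.
Lemma Yxy_Q : dy (dx Y) p = 2^-1 *: QY Y p.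
Proof. by apply/rowP => i; rewrite QY.unlock !mxE; lra. Qed.

End AtPoint2.

Definition perpV p (w : 'rV[R]_m.+1) : Prop :=
  [/\ lor w (Y p) = 0, lor w (dx Y p) = 0, lor w (dy Y p) = 0 & lor w (LY Y p) = 0].

Lemma perpV_ge0 p w : O p -> perpV p w -> 0 <= lor w w.
Proof. by move=> Op [w0 _ _ _]; exact: (nl_pos nl Op w0). Qed.

(** A normal vector of length 0 is a multiple of Y, and this multiple vanishes
   because the vector is orthogonal to L whereas Y is not. *)
Lemma perpV_eq0 p w : O p -> perpV p w -> lor w w = 0 -> w = 0.
Proof.
move=> Op [w0 _ _ wL] ww; have [c wc] := nl_def nl Op w0 ww.
have: c * -2 = 0 by rewrite -(LY_Y Op) -lorZr -wc lorC.
by move/eqP; rewrite mulf_eq0 oppr_eq0 pnatr_eq0 orbF => /eqP c0; rewrite wc c0 scale0r.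
Qed.

(** The components of P and Q in the normal bundle. *)
Definition Pn p := PY Y p + (pY Y p / 2) *: Y p.
Definition Qn p := QY Y p + (qY Y p / 2) *: Y p.

Lemma smooth_Pn : smooth_on O Pn.
Proof.
apply: smooth_add => //; first exact: smooth_PY.
apply: smooth_zscale => //; apply: smooth_mul => //; first exact: smooth_pY.
exact: smooth_cst.
Qed.

Lemma perp_Pn p : O p -> perpV p (Pn p).
Proof.
move=> Op; split; rewrite /Pn lorDl lorZl.
- by rewrite PY_Y// (nl_null nl Op) mulr0 addr0.
- by rewrite PY_x// (nl_0x Op) mulr0 addr0.
- by rewrite PY_y// (nl_0y Op) mulr0 addr0.
- by rewrite (lorC (Y p)) LY_Y// (lorC (PY Y p)) /pY; lra.
Qed.
Lemma perp_Qn p : O p -> perpV p (Qn p).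
Proof.
move=> Op; split; rewrite /Qn lorDl lorZl.
- by rewrite QY_Y// (nl_null nl Op) mulr0 addr0.
- by rewrite QY_x// (nl_0x Op) mulr0 addr0.
- by rewrite QY_y// (nl_0y Op) mulr0 addr0.
- by rewrite (lorC (Y p)) LY_Y// (lorC (QY Y p)) /qY; lra.
Qed.

(** Orthogonal projection to the normal space, written out. *)
Definition projn p (w : 'rV[R]_m.+1) : 'rV[R]_m.+1 :=
  w - lor w (dx Y p) *: dx Y p - lor w (dy Y p) *: dy Y p
  + (lor w (Y p) / 2) *: LY Y p
  + (lor w (LY Y p) / 2 + lor w (Y p) * lor (LY Y p) (LY Y p) / 4) *: Y p.

Lemma perp_projn p w : O p -> perpV p (projn p w).
Proof.
move=> Op; rewrite /projn; split; rewrite !lorE.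
- rewrite (nl_null nl Op) !(lorC _ (Y p)) (nl_0x Op) (nl_0y Op) (lorC (Y p) (LY Y p)) LY_Y//.
  by field.
- rewrite (nl_xx nl Op) (lorC (dy Y p)) (nl_xy nl Op) LY_x// (nl_0x Op); ring.
- rewrite (nl_yy nl Op) (nl_xy nl Op) LY_y// (nl_0y Op); ring.
- rewrite !(lorC (dx Y p) (LY _ _)) (lorC (dy Y p) (LY _ _)) (lorC (Y p) (LY _ _)).
  rewrite LY_Y// LY_x// LY_y//; by field.
Qed.

Lemma smooth_projn (w : R * R -> 'rV[R]_m.+1) : smooth_on O w ->
  smooth_on O (fun p => projn p (w p)).
Proof.
by move=> sw; have sL := smooth_LY; rewrite /projn; smooth_tac.
Qed.

End NullLift.

(** * The Hopf differential and the frame in real terms *)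
Section ComplexRows.
Variables (R : realType) (m : nat).
Implicit Types a b c d : 'rV[R]_m.

(** The complex row a + i b. *)
Definition cpair a b : 'rV[R[i]]_m := \row_j (a 0 j +i* b 0 j)%C.

Lemma reV_cpair a b : reV (cpair a b) = a.
Proof. by apply/rowP => j; rewrite !mxE. Qed.
Lemma imV_cpair a b : imV (cpair a b) = b.
Proof. by apply/rowP => j; rewrite !mxE. Qed.
Lemma cplx_cpair a : cplx a = cpair a 0.
Proof. by apply/rowP => j; rewrite !mxE. Qed.
Lemma conjV_cpair a b : conjV (cpair a b) = cpair a (- b).
Proof. by apply/rowP => j; rewrite !mxE. Qed.
Lemma cplx_i a b : cplx a + ('i)%C *: cplx b = cpair a b.
Proof.
apply/rowP => j; rewrite !mxE; apply/eqP; rewrite eq_complex /=.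
by rewrite !(mul0r, mul1r, addr0, add0r, mulr0, subr0, oppr0) !eqxx.
Qed.
Lemma cpairD a b c d : cpair a b + cpair c d = cpair (a + c) (b + d).
Proof. by apply/rowP => j; rewrite !mxE. Qed.
Lemma cpairN a b : - cpair a b = cpair (- a) (- b).
Proof. by apply/rowP => j; rewrite !mxE. Qed.
Lemma cpairZ (s : R[i]) a b :
  s *: cpair a b = cpair (complex.Re s *: a - complex.Im s *: b)
                         (complex.Re s *: b + complex.Im s *: a).
Proof.
by apply/rowP => j; rewrite !mxE; case: s => x y /=.
Qed.
Lemma half_cpair a b : (2^-1 : R[i]) *: cpair a b = cpair (2^-1 *: a) (2^-1 *: b).
Proof.
have -> : (2^-1 : R[i]) = ((2^-1 : R)%:C)%C.
  by rewrite -[2 in LHS](rmorph_nat (real_complex R)) -fmorphV.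
by rewrite cpairZ /= !scale0r subr0 addr0.
Qed.

Lemma dzE (f : R * R -> 'rV[R[i]]_m) p :
  dz f p = cpair (2^-1 *: (dx (fun q => reV (f q)) p + dy (fun q => imV (f q)) p))
                 (2^-1 *: (dx (fun q => imV (f q)) p - dy (fun q => reV (f q)) p)).
Proof.
rewrite /dz /duC /dvC !cplx_i cpairZ /= !scale0r !scale1r sub0r add0r cpairN cpairD half_cpair.
by rewrite opprK dx.unlock dy.unlock.
Qed.
Lemma dzbarE (f : R * R -> 'rV[R[i]]_m) p :
  dzbar f p = cpair (2^-1 *: (dx (fun q => reV (f q)) p - dy (fun q => imV (f q)) p))
                 (2^-1 *: (dx (fun q => imV (f q)) p + dy (fun q => reV (f q)) p)).
Proof.
rewrite /dzbar /duC /dvC !cplx_i cpairZ /= !scale0r !scale1r sub0r add0r cpairD half_cpair.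
by rewrite dx.unlock dy.unlock.
Qed.
End ComplexRows.

Section ComplexRowsLorentz.
Variables (R : realType) (m : nat).
Implicit Types a b c d : 'rV[R]_m.+1.

Lemma lorentz_cpair a b c d : lorentz (cpair a b) (cpair c d)
  = ((lor a c - lor b d) +i* (lor a d + lor b c))%C.
Proof.
have sumE n (F G : 'I_n -> R) : (\sum_i (F i +i* G i)%C) = ((\sum_i F i) +i* (\sum_i G i))%C.
  elim: n F G => [|n IH] F G; first by rewrite !big_ord0.
  by rewrite !big_ord_recl IH.
rewrite lor.unlock /lorentz !mxE.
under eq_bigr do rewrite !mxE.
rewrite sumE; apply/eqP; rewrite eq_complex /=.
rewrite !sumrB !big_split/=; apply/andP; split; apply/eqP; ring.
Qed.

Variables (O : set (R * R)) (Y : R * R -> 'rV[R]_m.+1).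
Hypothesis sY : smooth_on O Y.
Hypothesis oO : open O.

Lemma YzE : Yz Y = fun p => cpair (2^-1 *: dx Y p) (- (2^-1 *: dy Y p)).
Proof.
apply/funext => p; rewrite /Yz dzE.
have -> : (fun q => reV (cplx (Y q))) = Y.
  by apply/funext => q; rewrite cplx_cpair reV_cpair.
have -> : (fun q => imV (cplx (Y q))) = fun=> 0.
  by apply/funext => q; rewrite cplx_cpair imV_cpair.
by rewrite (dx_cst p) (dy_cst p) addr0 sub0r scalerN.
Qed.

Lemma dz_Yz p : O p -> dz (Yz Y) p
  = cpair (4^-1 *: (dx (dx Y) p - dy (dy Y) p)) (- (2^-1 *: dy (dx Y) p)).
Proof.
move=> Op; rewrite dzE YzE.
have -> : (fun q => reV (cpair (2^-1 *: dx Y q) (- (2^-1 *: dy Y q)))) = fun q => 2^-1 *: dx Y q.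
  by apply/funext => q; rewrite reV_cpair.
have -> : (fun q => imV (cpair (2^-1 *: dx Y q) (- (2^-1 *: dy Y q)))) = fun q => - (2^-1 *: dy Y q).
  by apply/funext => q; rewrite imV_cpair.
have s1 := smooth_dx sY; have s2 := smooth_dy sY.
have s2' := smooth_scale 2^-1 oO s2.
rewrite (dx_opp Op s2') (dy_opp Op s2').
rewrite !(dx_scale Op)// !(dy_scale Op)// (schwarz oO sY Op).
by congr cpair; apply/rowP => j; rewrite !mxE; field.
Qed.

Lemma re_dzbar_Yz p : O p -> reV (dzbar (Yz Y) p) = 4^-1 *: (dx (dx Y) p + dy (dy Y) p).
Proof.
move=> Op; rewrite dzbarE YzE reV_cpair.
have -> : (fun q => reV (cpair (2^-1 *: dx Y q) (- (2^-1 *: dy Y q)))) = fun q => 2^-1 *: dx Y q.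
  by apply/funext => q; rewrite reV_cpair.
have -> : (fun q => imV (cpair (2^-1 *: dx Y q) (- (2^-1 *: dy Y q)))) = fun q => - (2^-1 *: dy Y q).
  by apply/funext => q; rewrite imV_cpair.
have s1 := smooth_dx sY; have s2 := smooth_dy sY.
have s2' := smooth_scale 2^-1 oO s2.
rewrite (dy_opp Op s2') !(dx_scale Op)// !(dy_scale Op)//.
by apply/rowP => j; rewrite !mxE; field.
Qed.

End ComplexRowsLorentz.

Section FrameAndFlatness.
Variables (R : realType) (m : nat).
Variables (O : set (R * R)) (Y : R * R -> 'rV[R]_m.+1).
Hypothesis nl : null_lift O Y.
Let oO := nl_open nl.
Let sY := nl_smooth nl.

(** kappa is Y_zz up to a multiple of the null vector Y, which is orthogonal
   to Y_zz; hence the length of kappa is that of Y_zz. *)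
Lemma hopf_norm (s : R * R -> R[i]) kappa p : conformal_hopf O Y s kappa -> O p ->
  4 * lorentz (kappa p) (conjV (kappa p))
  = ((4^-1 * (lor (PY Y p) (PY Y p) + lor (QY Y p) (QY Y p)))%:C)%C.
Proof.
move=> hk Op; have [E _] := hk p Op.
have -> : kappa p = dz (Yz Y) p + (s p / 2) *: cplx (Y p).
  by rewrite E addrAC -scalerDl addNr scale0r add0r.
rewrite (dz_Yz sY oO Op) cplx_cpair cpairZ cpairD conjV_cpair lorentz_cpair.
move: (complex.Re _) (complex.Im _) => a b.
have -> : (4 : R[i]) = ((4 : R)%:C)%C by rewrite rmorph_nat.
have -> : dx (dx Y) p - dy (dy Y) p = PY Y p by rewrite PY.unlock.
rewrite (Yxy_Q Y p).
apply/eqP; rewrite eq_complex /= !lorE (nl_null nl Op) !(lorC (Y p)).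
rewrite (PY_Y nl Op) (QY_Y nl Op) (lorC (QY Y p)).
by apply/andP; split; apply/eqP; field.
Qed.

Lemma Vframe_row0 p : row 0 (Vframe Y p) = Y p.
Proof. by rewrite rowK. Qed.
Lemma Vframe_row1 p : row 1 (Vframe Y p) = 2^-1 *: dx Y p.
Proof. by rewrite rowK /= YzE reV_cpair. Qed.
Lemma Vframe_row2 p : row 2 (Vframe Y p) = - (2^-1 *: dy Y p).
Proof. by rewrite rowK /= YzE imV_cpair. Qed.
Lemma Vframe_row3 p : O p -> row 3 (Vframe Y p) = 4^-1 *: LY Y p.
Proof. by move=> Op; rewrite rowK /= (re_dzbar_Yz sY oO Op) LY.unlock. Qed.

Lemma ord4P (P : 'I_4 -> Prop) : P 0 -> P 1 -> P 2 -> P 3 -> forall i, P i.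
Proof.
move=> P0 P1 P2 P3 [[|[|[|[|//]]]] h].
- by move: P0; congr P; apply/val_inj.
- by move: P1; congr P; apply/val_inj.
- by move: P2; congr P; apply/val_inj.
- by move: P3; congr P; apply/val_inj.
Qed.

Lemma in_Vperp_perpV p w : O p -> in_Vperp Y p w <-> perpV Y p w.
Proof.
move=> Op; rewrite /in_Vperp; split=> [H|[h0 h1 h2 h3]].
  have := H 0; have := H 1; have := H 2; have := H 3.
  rewrite Vframe_row0 Vframe_row1 Vframe_row2 Vframe_row3//.
  have -> : (@lorentz R m) = @lor R m by rewrite lor.unlock.
  by rewrite !lorE => h3 h2 h1 h0; split; lra.
apply: ord4P; rewrite ?Vframe_row0 ?Vframe_row1 ?Vframe_row2 ?Vframe_row3//;
  have -> : (@lorentz R m) = @lor R m by rewrite lor.unlock.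
all: by rewrite ?lorE; lra.
Qed.

End FrameAndFlatness.

(** * The Codazzi and Ricci equations *)
Section Flatness.
Variables (R : realType) (m : nat).
Variables (O : set (R * R)) (Y : R * R -> 'rV[R]_m.+1).
Hypothesis nl : null_lift O Y.
Let oO := nl_open nl.
Let sY := nl_smooth nl.
Let s1 := smooth_dx sY.
Let s2 := smooth_dy sY.

Lemma lor_sumr (n : 'rV[R]_m.+1) (I : finType) (f : I -> 'rV[R]_m.+1) :
  lor n (\sum_i f i) = \sum_i lor n (f i).
Proof. by apply: (big_morph (lor n)); [move=> x y; exact: lorDr|exact: lor0r]. Qed.

Lemma lor_mulmxr (n : 'rV[R]_m.+1) k (d : 'rV[R]_k) (F : 'M[R]_(k, m.+1)) :
  lor n (d *m F) = \sum_i d 0 i * lor n (row i F).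
Proof.
by rewrite mulmx_sum_row lor_sumr; apply: eq_bigr => i _; rewrite lorZr.
Qed.

Let G p : 'M[R]_4 :=
  \matrix_(i, j) lorentz (row i (Vframe Y p)) (row j (Vframe Y p)).

Lemma Gram_lor p (c : 'rV[R]_4) j : (c *m G p) 0 j = lor (c *m Vframe Y p) (row j (Vframe Y p)).
Proof.
rewrite lorC lor_mulmxr mxE; apply: eq_bigr => i _.
by rewrite !mxE [in RHS]lorC lor.unlock.
Qed.

Lemma big4 (f : 'I_4 -> 'rV[R]_m.+1) : \sum_i f i = f 0 + f 1 + f 2 + f 3.
Proof.
rewrite !big_ord_recl big_ord0 addr0 !addrA.
by congr (f _ + f _ + f _ + f _); apply/val_inj.
Qed.

(** The frame is a basis of V on which the form is nondegenerate: a combination of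
   its rows orthogonal to all of them has zero coefficients. *)
Lemma Gram_unit p : O p -> G p \in unitmx.
Proof.
move=> Op; rewrite -row_free_unit -kermx_eq0; apply/rowV0P => c /sub_kermxP cG.
have H j : lor (c *m Vframe Y p) (row j (Vframe Y p)) = 0.
  by rewrite -Gram_lor cG mxE.
set w := c *m Vframe Y p in H.
have wE : w = c 0 0 *: Y p + c 0 1 *: (2^-1 *: dx Y p) + c 0 2 *: - (2^-1 *: dy Y p)
   + c 0 3 *: (4^-1 *: LY Y p).
  by rewrite /w mulmx_sum_row big4 Vframe_row0 Vframe_row1 Vframe_row2 (Vframe_row3 nl Op).
have := H 0; have := H 1; have := H 2; have := H 3.
rewrite Vframe_row0 Vframe_row1 Vframe_row2 (Vframe_row3 nl Op) wE !lorE.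
rewrite (nl_null nl Op) !(lorC (dx Y p) (Y p)) !(lorC (dy Y p) (Y p)) !(lorC (dy Y p) (dx Y p)).
rewrite !(nl_0x nl Op) !(nl_0y nl Op) !(nl_xx nl Op) !(nl_yy nl Op) !(nl_xy nl Op).
rewrite !(lorC (Y p) (LY Y p)) !(lorC (dx Y p) (LY Y p)) !(lorC (dy Y p) (LY Y p)).
rewrite !(LY_Y nl Op) !(LY_x nl Op) !(LY_y nl Op) => h3 h2 h1 h0.
have c3 : c 0 3 = 0 by lra.
have c2 : c 0 2 = 0 by lra.
have c1 : c 0 1 = 0 by lra.
have c0 : c 0 0 = 0 by rewrite c3 in h3; lra.
apply/rowP; apply: ord4P; rewrite ?c0 ?c1 ?c2 ?c3 mxE//.
Qed.

Lemma Vperp_projE p (w w' : 'rV[R]_m.+1) (c : 'rV[R]_4) : O p ->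
  perpV Y p w' -> w = w' + c *m Vframe Y p -> Vperp_proj Y p w = w'.
Proof.
move=> Op /(in_Vperp_perpV nl _ Op) pw' wE; rewrite /Vperp_proj.
have -> : \row_j lorentz w (row j (Vframe Y p)) = c *m G p.
  apply/rowP => j; rewrite Gram_lor mxE wE.
  have -> : (@lorentz R m) = @lor R m by rewrite lor.unlock.
  rewrite lorDl; have := pw' j.
  have -> : (@lorentz R m) = @lor R m by rewrite lor.unlock.
  by move=> ->; rewrite add0r.
by rewrite -[c *m _ *m _]mulmxA mulmxV ?Gram_unit// mulmx1 wE addrK.
Qed.

Lemma lor_Vperp_proj p (n w : 'rV[R]_m.+1) : O p -> perpV Y p n ->
  lor n (Vperp_proj Y p w) = lor n w.
Proof.
move=> Op /(in_Vperp_perpV nl _ Op) pn; rewrite /Vperp_proj lorDr lorNr lor_mulmxr.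
rewrite big1 ?subr0// => i _; have := pn i; rewrite lor.unlock => ->; exact: mulr0.
Qed.

Lemma lor_Du (f : R * R -> 'rV[R]_m.+1) p n : O p -> perpV Y p n ->
  lor n (Du Y f p) = lor n (dx f p).
Proof. by move=> Op pn; rewrite dx.unlock; exact: lor_Vperp_proj. Qed.
Lemma lor_Dv (f : R * R -> 'rV[R]_m.+1) p n : O p -> perpV Y p n ->
  lor n (Dv Y f p) = lor n (dy f p).
Proof. by move=> Op pn; rewrite dy.unlock; exact: lor_Vperp_proj. Qed.

Lemma Vperp_proj_V p (w w' : 'rV[R]_m.+1) (a b1 b2 c : R) : O p -> perpV Y p w' ->
  w = w' + a *: Y p + b1 *: dx Y p + b2 *: dy Y p + c *: LY Y p -> Vperp_proj Y p w = w'.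
Proof.
move=> Op pw wE.
apply: (@Vperp_projE p w w' (\row_i nth 0 [:: a; 2 * b1; - (2 * b2); 4 * c] i)) => //.
rewrite mulmx_sum_row big4 Vframe_row0 Vframe_row1 Vframe_row2 (Vframe_row3 nl Op) !mxE /= wE.
by apply/rowP => j; rewrite !mxE; field.
Qed.

Lemma L_dx p : O p -> dx (LY Y) p = dx (PY Y) p + dy (QY Y) p.
Proof.
move=> Op; rewrite LY.unlock PY.unlock QY.unlock.
rewrite (dx_add Op) ?(dx_sub Op)//; try smooth_tac.
rewrite (dy_scale Op); last by smooth_tac.
have -> : dx (dy (dy Y)) p = dy (dy (dx Y)) p.
  rewrite -(schwarz oO s2 Op); apply: (dy_on oO _ Op) => q Oq.
  by rewrite (nl_dyx nl).
by apply/rowP => j; rewrite !mxE; ring.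
Qed.

Lemma L_dy p : O p -> dy (LY Y) p = dx (QY Y) p - dy (PY Y) p.
Proof.
move=> Op; rewrite LY.unlock PY.unlock QY.unlock.
rewrite (dy_add Op) ?(dy_sub Op)//; try smooth_tac.
rewrite (dx_scale Op); last by smooth_tac.
rewrite -(schwarz oO s1 Op).
by apply/rowP => j; rewrite !mxE; ring.
Qed.

Section Sections.
Variables (psi : R * R -> 'rV[R]_m.+1).
Hypothesis spsi : smooth_on O psi.
Hypothesis npsi : forall p, O p -> perpV Y p (psi p).

Let Yxx := dx (dx Y).
Let Yxy := dy (dx Y).
Let Yyy := dy (dy Y).
Let B (f : R * R -> 'rV[R]_m.+1) q := lor (psi q) (f q).

Lemma Du_section p : O p -> Du Y psi p =
  dx psi p - (B (dx (LY Y)) p / 2) *: Y p + B Yxx p *: dx Y p + B Yxy p *: dy Y p.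
Proof.
move=> Op; rewrite /Du -[du psi p]/(du psi p) (_ : du psi p = dx psi p); last by rewrite dx.unlock.
have sL := smooth_LY nl.
have n0 := dx_lor_cst nl spsi sY (fun q Oq => let: And4 h _ _ _ := npsi Oq in h) Op.
have n1 := dx_lor_cst nl spsi s1 (fun q Oq => let: And4 _ h _ _ := npsi Oq in h) Op.
have n2 := dx_lor_cst nl spsi s2 (fun q Oq => let: And4 _ _ h _ := npsi Oq in h) Op.
have n3 := dx_lor_cst nl spsi sL (fun q Oq => let: And4 _ _ _ h := npsi Oq in h) Op.
have [q0 q1 q2 q3] := npsi Op.
apply: (@Vperp_proj_V p _ _ (B (dx (LY Y)) p / 2) (- B Yxx p) (- B Yxy p) 0) => //; last first.
  by apply/rowP => j; rewrite !mxE; ring.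
rewrite (nl_dyx nl Op) in n2.
have e0 : lor (dx psi p) (Y p) = 0 by rewrite q1 in n0; lra.
split; rewrite !lorE ?(nl_null nl Op) ?(nl_xx nl Op) ?(nl_yy nl Op) ?(nl_xy nl Op)
  ?(lorC (dx Y p) (Y p)) ?(lorC (dy Y p) (Y p)) ?(lorC (dy Y p) (dx Y p))
  ?(nl_0x nl Op) ?(nl_0y nl Op) ?(nl_xy nl Op).
- by rewrite e0; ring.
- by rewrite /B /Yxx -[lor (psi p) _]opprK; move: n1; rewrite /Yxx; lra.
- by rewrite /B /Yxy; lra.
- rewrite (lorC (Y p) (LY Y p)) (lorC (dx Y p) (LY Y p)) (lorC (dy Y p) (LY Y p)).
  by rewrite (LY_Y nl Op) (LY_x nl Op) (LY_y nl Op) /B; lra.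
Qed.

Lemma Dv_section p : O p -> Dv Y psi p =
  dy psi p - (B (dy (LY Y)) p / 2) *: Y p + B Yxy p *: dx Y p + B Yyy p *: dy Y p.
Proof.
move=> Op; rewrite /Dv (_ : dv psi p = dy psi p); last by rewrite dy.unlock.
have sL := smooth_LY nl.
have n0 := dy_lor_cst nl spsi sY (fun q Oq => let: And4 h _ _ _ := npsi Oq in h) Op.
have n1 := dy_lor_cst nl spsi s1 (fun q Oq => let: And4 _ h _ _ := npsi Oq in h) Op.
have n2 := dy_lor_cst nl spsi s2 (fun q Oq => let: And4 _ _ h _ := npsi Oq in h) Op.
have n3 := dy_lor_cst nl spsi sL (fun q Oq => let: And4 _ _ _ h := npsi Oq in h) Op.
have [q0 q1 q2 q3] := npsi Op.
apply: (@Vperp_proj_V p _ _ (B (dy (LY Y)) p / 2) (- B Yxy p) (- B Yyy p) 0) => //; last first.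
  by apply/rowP => j; rewrite !mxE; ring.
have e0 : lor (dy psi p) (Y p) = 0 by rewrite q2 in n0; lra.
split; rewrite !lorE ?(nl_null nl Op) ?(nl_xx nl Op) ?(nl_yy nl Op) ?(nl_xy nl Op)
  ?(lorC (dx Y p) (Y p)) ?(lorC (dy Y p) (Y p)) ?(lorC (dy Y p) (dx Y p))
  ?(nl_0x nl Op) ?(nl_0y nl Op) ?(nl_xy nl Op).
- by rewrite e0; ring.
- by rewrite /B /Yxy; lra.
- by rewrite /B /Yyy; lra.
- rewrite (lorC (Y p) (LY Y p)) (lorC (dx Y p) (LY Y p)) (lorC (dy Y p) (LY Y p)).
  by rewrite (LY_Y nl Op) (LY_x nl Op) (LY_y nl Op) /B; lra.
Qed.

(** The Ricci equation: up to a constant factor the curvature of D is the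
   skew-symmetric operator spanned by the normal components of P and Q. *)
Lemma ricci_flat n p : O p -> perpV Y p n ->
  Du Y (Dv Y psi) p = Dv Y (Du Y psi) p ->
  lor (psi p) (QY Y p) * lor n (PY Y p) = lor (psi p) (PY Y p) * lor n (QY Y p).
Proof.
move=> Op pn.
have sL := smooth_LY nl.
have sB f : smooth_on O f -> smooth_on O (B f) by move=> sf; rewrite /B; smooth_tac.
have sxx : smooth_on O Yxx by exact: smooth_dx.
have sxy : smooth_on O Yxy by exact: smooth_dy.
have syy : smooth_on O Yyy by exact: smooth_dy.
have sLx2 : smooth_on O (fun q => B (dx (LY Y)) q / 2).
  by apply: smooth_mul => //; [apply: sB; exact: smooth_dx|exact: smooth_cst].
have sLy2 : smooth_on O (fun q => B (dy (LY Y)) q / 2).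
  by apply: smooth_mul => //; [apply: sB; exact: smooth_dy|exact: smooth_cst].
have sZ (f : R * R -> R) (g : R * R -> 'rV[R]_m.+1) : smooth_on O f -> smooth_on O g ->
  smooth_on O (fun q => f q *: g q) by exact: smooth_zscale.
have e1 : lor n (dx (Dv Y psi) p) = lor n (dx (dy psi) p) + B Yxy p * lor n (Yxx p)
   + B Yyy p * lor n (Yxy p).
  rewrite (dx_on oO Dv_section Op).
  have t0 := smooth_dy spsi.
  have t1 := sZ _ _ sLy2 sY.
  have t2 := sZ _ _ (sB _ sxy) s1.
  have t3 := sZ _ _ (sB _ syy) s2.
  have t4 := smooth_subr oO t0 t1.
  have t5 := smooth_add oO t4 t2.
  rewrite (dx_add Op t5 t3) (dx_add Op t4 t2) (dx_sub Op t0 t1).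
  rewrite (dx_zscale Op sLy2 sY) (dx_zscale Op (sB _ sxy) s1) (dx_zscale Op (sB _ syy) s2).
  by have [n0 n1 n2 n3] := pn; rewrite !lorE n0 n1 n2 (nl_dyx nl Op) /Yxx /Yxy; ring.
have e2 : lor n (dy (Du Y psi) p) = lor n (dy (dx psi) p) + B Yxx p * lor n (Yxy p)
   + B Yxy p * lor n (Yyy p).
  rewrite (dy_on oO Du_section Op).
  have t0 := smooth_dx spsi.
  have t1 := sZ _ _ sLx2 sY.
  have t2 := sZ _ _ (sB _ sxx) s1.
  have t3 := sZ _ _ (sB _ sxy) s2.
  have t4 := smooth_subr oO t0 t1.
  have t5 := smooth_add oO t4 t2.
  rewrite (dy_add Op t5 t3) (dy_add Op t4 t2) (dy_sub Op t0 t1).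
  rewrite (dy_zscale Op sLx2 sY) (dy_zscale Op (sB _ sxx) s1) (dy_zscale Op (sB _ sxy) s2).
  by have [n0 n1 n2 n3] := pn; rewrite !lorE n0 n1 n2 /Yyy /Yxy; ring.
move=> /(congr1 (lor n)) H.
have := etrans (esym (lor_Du (Dv Y psi) Op pn)) (etrans H (lor_Dv (Du Y psi) Op pn)).
rewrite e1 e2 (schwarz oO spsi Op) {H e1 e2}.
have [n0 n1 n2 n3] := pn.
rewrite /B /Yxx /Yxy /Yyy Yxx_LP Yyy_LP Yxy_Q !lorE n3.
by have [q0 q1 q2 q3] := npsi Op; rewrite q3; lra.
Qed.

End Sections.

(** The Ricci equation applied to the normal components of P and Q: vanishing
   curvature is the equality case of the Cauchy-Schwarz inequality, so that P
   and Q are parallel modulo Y. *)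
Lemma flat_PQ p : flat_on O Y -> O p ->
  lor (PY Y p) (QY Y p) ^+ 2 = lor (PY Y p) (PY Y p) * lor (QY Y p) (QY Y p).
Proof.
move=> flat Op.
have H := flat O (Pn Y) oO (fun _ => id) (smooth_Pn nl)
  (fun q Oq => (in_Vperp_perpV nl _ Oq).2 (perp_Pn nl Oq)) p Op.
have := ricci_flat (smooth_Pn nl) (@perp_Pn _ _ _ _ nl) Op (perp_Qn nl Op) H.
rewrite /Pn /Qn !lorE !(lorC (Y p)) (PY_Y nl Op) (QY_Y nl Op) (lorC (QY Y p) (PY Y p)).
by rewrite !mulr0 !addr0 -expr2.
Qed.

End Flatness.

(** * Lifts of maps into the sphere *)
Section SphereLift.
Variables (R : realType) (n : nat).
Implicit Types (X : R * R -> 'rV[R]_n.+1) (O : set (R * R)).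

Lemma dotC k (x y : 'rV[R]_k) : dot x y = dot y x.
Proof. by apply: eq_bigr => i _; exact: mulrC. Qed.
Lemma dotDl k (x y z : 'rV[R]_k) : dot (x + y) z = dot x z + dot y z.
Proof. by rewrite /dot -big_split; apply: eq_bigr => i _; rewrite mxE mulrDl. Qed.
Lemma dotZl k (a : R) (x z : 'rV[R]_k) : dot (a *: x) z = a * dot x z.
Proof. by rewrite /dot mulr_sumr; apply: eq_bigr => i _; rewrite mxE mulrA. Qed.
Lemma dotDr k (x y z : 'rV[R]_k) : dot x (y + z) = dot x y + dot x z.
Proof. by rewrite dotC dotDl !(dotC _ x). Qed.
Lemma dotZr k (a : R) (x z : 'rV[R]_k) : dot x (a *: z) = a * dot x z.
Proof. by rewrite dotC dotZl (dotC z). Qed.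
Lemma dotNl k (x z : 'rV[R]_k) : dot (- x) z = - dot x z.
Proof. by rewrite -scaleN1r dotZl mulN1r. Qed.
Lemma dotNr k (x z : 'rV[R]_k) : dot x (- z) = - dot x z.
Proof. by rewrite -scaleN1r dotZr mulN1r. Qed.
Definition dotE := (dotDl, dotDr, dotZl, dotZr, dotNl, dotNr).
Lemma dot_ge0 k (x : 'rV[R]_k) : 0 <= dot x x.
Proof. by apply: sumr_ge0 => i _; rewrite -expr2 sqr_ge0. Qed.
Lemma dot_eq0 k (x : 'rV[R]_k) : dot x x = 0 -> x = 0.
Proof.
move=> /psumr_eq0P H; apply/rowP => i; rewrite mxE; apply/eqP.
by rewrite -sqrf_eq0 expr2; apply/eqP/H => // j _; rewrite -expr2 sqr_ge0.
Qed.

Lemma ord0_lshift : (ord0 : 'I_n.+2) = lshift n.+1 (ord0 : 'I_1).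
Proof. exact/val_inj. Qed.
Lemma lift0_rshift (i : 'I_n.+1) : lift (ord0 : 'I_n.+2) i = rshift 1 i.
Proof. exact/val_inj. Qed.

Lemma ord_lrP (P : 'I_n.+2 -> Prop) : P ord0 -> (forall i, P (lift ord0 i)) -> forall j, P j.
Proof. by move=> P0 P1 j; have [i ->|->] := unliftP ord0 j. Qed.

Lemma row_mx_0 (a : 'rV[R]_1) (v : 'rV[R]_n.+1) : row_mx a v 0 ord0 = a 0 0.
Proof. by rewrite ord0_lshift (row_mxEl a v). Qed.
Lemma row_mx_S (a : 'rV[R]_1) (v : 'rV[R]_n.+1) i : row_mx a v 0 (lift ord0 i) = v 0 i.
Proof. by rewrite lift0_rshift (row_mxEr a v). Qed.

Lemma lor_row_mx (a b : 'rV[R]_1) (v w : 'rV[R]_n.+1) :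
  lor (row_mx a v : 'rV_n.+2) (row_mx b w) = - (a 0 0 * b 0 0) + dot v w.
Proof.
rewrite lor.unlock /lorentz !row_mx_0; congr (_ + _).
by apply: eq_bigr => i _; rewrite !row_mx_S.
Qed.

Lemma row_mx_split (w : 'rV[R]_n.+2) :
  exists (a : 'rV[R]_1) (v : 'rV[R]_n.+1), w = row_mx a v.
Proof. by exists (@lsubmx R 1 1 n.+1 w), (@rsubmx R 1 1 n.+1 w); rewrite hsubmxK. Qed.

(** The null vector (1, v) representing a point v of the sphere, and the
   derivative (0, v) of such vectors. *)
Definition hat (v : 'rV[R]_n.+1) : 'rV[R]_n.+2 := row_mx (1 : 'rV[R]_1) v.
Definition hat0 (v : 'rV[R]_n.+1) : 'rV[R]_n.+2 := row_mx (0 : 'rV[R]_1) v.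

Lemma hat_0 v : hat v 0 ord0 = 1. Proof. by rewrite row_mx_0 mxE. Qed.
Lemma hat_S v i : hat v 0 (lift ord0 i) = v 0 i. Proof. exact: row_mx_S. Qed.
Lemma hat0_0 v : hat0 v 0 ord0 = 0. Proof. by rewrite row_mx_0 mxE. Qed.
Lemma hat0_S v i : hat0 v 0 (lift ord0 i) = v 0 i. Proof. exact: row_mx_S. Qed.

Lemma lor_hat v w : lor (hat v) (hat w) = -1 + dot v w.
Proof. by rewrite lor_row_mx !mxE /= mulr1. Qed.
Lemma lor_hat0 v w : lor (hat v) (hat0 w) = dot v w.
Proof. by rewrite lor_row_mx !mxE /= mulr0 oppr0 add0r. Qed.
Lemma lor_hat00 v w : lor (hat0 v) (hat0 w) = dot v w.
Proof. by rewrite lor_row_mx !mxE /= mulr0 oppr0 add0r. Qed.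

(** The first coordinate of a vector (a, w) orthogonal to (1, v) is a = v . w, so
   that the Cauchy-Schwarz inequality gives the sign. *)
Lemma null_pos (v : 'rV[R]_n.+1) (r : R) (w : 'rV[R]_n.+2) : dot v v = 1 -> 0 < r ->
  lor w (r *: hat v) = 0 -> 0 <= lor w w.
Proof.
move=> v1 r0; have [a [u ->]] := row_mx_split w; move: (a 0 0) => _.
rewrite lorZr !lor_row_mx !mxE /= mulr1 => /eqP; rewrite mulf_eq0 gt_eqF//= => /eqP h.
have := dot_ge0 (u - a 0 0 *: v); rewrite !dotE v1 (dotC v u).
have -> : dot u v = a 0 0 by lra.
by rewrite mulr1; lra.
Qed.

Lemma null_def (v : 'rV[R]_n.+1) (r : R) (w : 'rV[R]_n.+2) : dot v v = 1 -> 0 < r ->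
  lor w (r *: hat v) = 0 -> lor w w = 0 -> exists c : R, w = c *: (r *: hat v).
Proof.
move=> v1 r0; have [a [u ->]] := row_mx_split w.
rewrite lorZr !lor_row_mx !mxE /= mulr1 => /eqP; rewrite mulf_eq0 gt_eqF//= => /eqP h uu.
exists (a 0 0 / r); rewrite scalerA divfK ?gt_eqF//.
have u_eq : u = a 0 0 *: v.
  apply/eqP; rewrite -subr_eq0; apply/eqP/dot_eq0.
  rewrite !dotE v1 (dotC v u).
  have -> : dot u v = a 0 0 by lra.
  by rewrite mulr1; lra.
rewrite u_eq /hat; apply/rowP; apply: ord_lrP => [|i].
  by rewrite [in RHS]mxE !row_mx_0 mxE /= mulr1.
by rewrite [in RHS]mxE !row_mx_S mxE.
Qed.

Lemma smooth_hat (V : normedModType R) (O : set V) (X : V -> 'rV[R]_n.+1) :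
  open O -> smooth_on O X -> smooth_on O (fun p => hat (X p)).
Proof.
move=> oO /smooth_rowP-/(_ oO) sX; apply/smooth_rowP => //; apply: ord_lrP => [|i].
  by under eq_fun do rewrite hat_0; exact: smooth_cst.
by under eq_fun do rewrite hat_S; exact: sX.
Qed.

Lemma is_derive_hat (V : normedModType R) (X : V -> 'rV[R]_n.+1) p v (d : 'rV[R]_n.+1) :
  is_derive p v X d -> is_derive p v (fun q => hat (X q)) (hat0 d).
Proof.
move=> dX; apply: is_derive_row; apply: ord_lrP => [|i].
  under eq_fun do rewrite hat_0.
  by rewrite hat0_0; exact: is_derive_cst.
under eq_fun do rewrite hat_S.
by rewrite hat0_S; exact: is_derive_coord.
Qed.

Lemma canonical_null_lift O X Y : open O -> (forall p, O p -> on_sphere (X p)) ->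
  canonical_lift O X Y -> null_lift O Y.
Proof.
move=> oO oX [sY cY].
have lE : (@lorentz R n.+1) = @lor R n.+1 by rewrite lor.unlock.
have H p : O p -> [/\ exists r : R, 0 < r /\ Y p = r *: hat (X p),
        lor (dx Y p) (dx Y p) = 1, lor (dy Y p) (dy Y p) = 1
      & lor (dx Y p) (dy Y p) = 0].
  by move=> /cY; rewrite lE dx.unlock dy.unlock.
split => //.
- move=> p Op; have [[r [_ ->]] _ _ _] := H p Op.
  by rewrite lorZl lorZr lor_hat (oX p Op) addNr !mulr0.
- by move=> p /H[].
- by move=> p /H[].
- by move=> p /H[].
- move=> p w Op; have [[r [r0 ->]] _ _ _] := H p Op.
  exact: null_pos (oX p Op) r0.
- move=> p w Op; have [[r [r0 ->]] _ _ _] := H p Op.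
  exact: null_def (oX p Op) r0.
Qed.

Lemma smooth_canon_factor O X : open O -> smooth_on O X -> conformal_on O X ->
  smooth_on O (fun p => (Num.sqrt (dot (dx X p) (dx X p)))^-1).
Proof.
move=> oO sX cX.
have sd : smooth_on O (fun p => dot (dx X p) (dx X p)) by apply: smooth_dot => //; exact: smooth_dx.
have d0 p : O p -> 0 < dot (dx X p) (dx X p) by rewrite dx.unlock => /cX[].
apply: smooth_inv => //; last exact: smooth_sqrt.
by move=> p /d0 h; rewrite gt_eqF// sqrtr_gt0.
Qed.

Lemma canonical_lift_exists O X : open O -> smooth_on O X ->
  (forall p, O p -> on_sphere (X p)) -> conformal_on O X ->
  canonical_lift O X (fun p => (Num.sqrt (dot (dx X p) (dx X p)))^-1 *: hat (X p)).
Proof.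
move=> oO sX oX cX; pose la (p : R * R) := (Num.sqrt (dot (dx X p) (dx X p)))^-1.
rewrite -[X in canonical_lift _ _ X]/(fun p => la p *: hat (X p)).
have sla : smooth_on O la by exact: smooth_canon_factor.
have sh : smooth_on O (fun p => hat (X p)) by exact: smooth_hat.
split; first exact: smooth_zscale.
have lE : (@lorentz R n.+1) = @lor R n.+1 by rewrite lor.unlock.
move=> p Op.
have /and3P[d0 /eqP d12 /eqP d00] : [&& 0 < dot (dx X p) (dx X p),
   dot (dx X p) (dx X p) == dot (dy X p) (dy X p) & dot (dx X p) (dy X p) == 0].
  by rewrite dx.unlock dy.unlock; have [-> /eqP-> /eqP->] := cX p Op.
have la2 : la p * la p * dot (dx X p) (dx X p) = 1.
  have := sqr_sqrtr (ltW d0); rewrite expr2 /la => e.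
  rewrite -[X in _ * X]e -invfM mulVf//.
  by rewrite mulf_neq0// gt_eqF// sqrtr_gt0.
have -> : forall f : R * R -> 'rV[R]_n.+2, du f p = dx f p by move=> f; rewrite dx.unlock.
have -> : forall f : R * R -> 'rV[R]_n.+2, dv f p = dy f p by move=> f; rewrite dy.unlock.
rewrite lE (dx_zscale Op sla sh) (dy_zscale Op sla sh).
rewrite (dx_eq (is_derive_hat (is_dx sX Op))) (dy_eq (is_derive_hat (is_dy sX Op))).
have xx1 : dot (X p) (dx X p) = 0.
  have : dx (fun q => dot (X q) (X q)) p = 0 by rewrite (dx_on oO oX Op) dx_cst.
  rewrite (dx_eq (is_derive_dot (is_dx sX Op) (is_dx sX Op))) (dotC (dx X p)); lra.
have xx2 : dot (X p) (dy X p) = 0.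
  have : dy (fun q => dot (X q) (X q)) p = 0 by rewrite (dy_on oO oX Op) dy_cst.
  rewrite (dy_eq (is_derive_dot (is_dy sX Op) (is_dy sX Op))) (dotC (dy X p)); lra.
have lS : lor (hat (X p)) (hat (X p)) = 0 by rewrite lor_hat (oX p Op) addNr.
split.
- by exists (la p); split => //; rewrite invr_gt0 sqrtr_gt0.
- rewrite !lorE lS (lorC (hat0 _) (hat _)) lor_hat0 lor_hat00 xx1 -la2; ring.
- rewrite !lorE lS (lorC (hat0 _) (hat _)) lor_hat0 lor_hat00 xx2 -d12 -la2; ring.
- rewrite !lorE lS (lorC (hat0 _) (hat _)) !lor_hat0 lor_hat00 xx1 xx2 d00; ring.
Qed.

End SphereLift.

(** * The Willmore integrand in an arbitrary parameter *)
Section Density.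
Variables (R : realType) (m : nat).
Implicit Types (y a b c : 'rV[R]_m.+1).

Section Algebra.
Variables (y1 y2 y11 y12 y22 : 'rV[R]_m.+1).
Let E := lor y1 y1.
Let F := lor y1 y2.
Let G := lor y2 y2.

(** The form induced by lor on the orthogonal of the tangent plane of y1 and y2;
   E, F and G are the coefficients of the first fundamental form. *)
Definition qform a b : R := lor a b
  - (G * (lor a y1 * lor b y1) - F * (lor a y1 * lor b y2 + lor a y2 * lor b y1)
     + E * (lor a y2 * lor b y2)) / (E * G - F ^+ 2).

(** The integrand of the Willmore energy of a null lift of arbitrary scale and in
   an arbitrary parameter, as a function of its 2-jet.  The first term is the
   square of the mean curvature vector, the second is the normal part of the
   second fundamental determinant. *)
Definition dens : R :=
  (qform (G *: y11 - (2 * F) *: y12 + E *: y22) (G *: y11 - (2 * F) *: y12 + E *: y22)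
     / (4 * (E * G - F ^+ 2))
   - (qform y11 y22 - qform y12 y12)) / Num.sqrt (E * G - F ^+ 2).

Lemma qformC a b : qform a b = qform b a.
Proof. by rewrite /qform (lorC a b); congr (_ - _ / _); ring. Qed.
Lemma qformDl a b c : qform (a + b) c = qform a c + qform b c.
Proof. by rewrite /qform !lorDl; ring. Qed.
Lemma qformZl (k : R) a c : qform (k *: a) c = k * qform a c.
Proof. by rewrite /qform !lorZl; ring. Qed.
Lemma qformDr a b c : qform c (a + b) = qform c a + qform c b.
Proof. by rewrite !(qformC c) qformDl. Qed.
Lemma qformZr (k : R) a c : qform c (k *: a) = k * qform c a.
Proof. by rewrite !(qformC c) qformZl. Qed.
Lemma qformNl a c : qform (- a) c = - qform a c.
Proof. by rewrite -scaleN1r qformZl mulN1r. Qed.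
Lemma qformNr a c : qform c (- a) = - qform c a.
Proof. by rewrite -scaleN1r qformZr mulN1r. Qed.

Definition qE := (qformDl, qformDr, qformZl, qformZr, qformNl, qformNr).

Hypothesis nondeg : E * G - F ^+ 2 != 0.

Lemma qform_1 a : qform y1 a = 0.
Proof.
rewrite /qform -/E -/F -/G (lorC y1 a).
by field.
Qed.
Lemma qform_2 a : qform y2 a = 0.
Proof.
rewrite /qform -/E -/F -/G (lorC y2 a) (lorC y2 y1) -/F.
by field.
Qed.
Lemma qform_perp a b : lor a y1 = 0 -> lor a y2 = 0 -> qform a b = lor a b.
Proof. by move=> a1 a2; rewrite /qform a1 a2; field. Qed.
End Algebra.

(** Z is the canonical lift in an isothermal parameter, y an arbitrary positive
   multiple of it in an arbitrary parameter; a and b are the partial derivatives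
   of the change of parameter.  The left-hand side is the integrand of W.  The
   terms with coefficients c, s and t disappear because qform vanishes on the
   tangent plane, and because y is orthogonal to the trace-free second
   derivatives; what remains is an identity between the first fundamental forms. *)
Lemma dens_invariant (y y1 y2 y11 y12 y22 Z1 Z2 Z11 Z12 Z22 : 'rV[R]_m.+1)
  (a1 a2 b1 b2 r r1 r2 c11 c12 c22 t11 t12 t22 s11 s12 s22 : R) :
  lor y y = 0 -> lor y y1 = 0 -> lor y y2 = 0 ->
  lor y y11 = - lor y1 y1 -> lor y y12 = - lor y1 y2 -> lor y y22 = - lor y2 y2 ->
  0 < r -> 0 < a1 * b2 - b1 * a2 ->
  Z1 = r1 *: y + r *: (a1 *: y1 + a2 *: y2) ->
  Z2 = r2 *: y + r *: (b1 *: y1 + b2 *: y2) ->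
  Z11 = r *: ((a1 ^+ 2) *: y11 + (2 * a1 * a2) *: y12 + (a2 ^+ 2) *: y22)
        + t11 *: y1 + s11 *: y2 + c11 *: y ->
  Z12 = r *: ((a1 * b1) *: y11 + (a1 * b2 + a2 * b1) *: y12 + (a2 * b2) *: y22)
        + t12 *: y1 + s12 *: y2 + c12 *: y ->
  Z22 = r *: ((b1 ^+ 2) *: y11 + (2 * b1 * b2) *: y12 + (b2 ^+ 2) *: y22)
        + t22 *: y1 + s22 *: y2 + c22 *: y ->
  lor Z1 Z1 = 1 -> lor Z2 Z2 = 1 -> lor Z1 Z2 = 0 ->
  lor (Z11 - Z22) Z1 = 0 -> lor (Z11 - Z22) Z2 = 0 -> lor Z12 Z1 = 0 -> lor Z12 Z2 = 0 ->
  4^-1 * lor (Z11 - Z22) (Z11 - Z22) + lor Z12 Z12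
  = dens y1 y2 y11 y12 y22 * (a1 * b2 - b1 * a2).
Proof.
move=> y0 y01 y02 y011 y012 y022 r0 j0 E1 E2 E11 E12 E22 H11 H22 H12 U1 U2 W1 W2.
pose E := lor y1 y1; pose F := lor y1 y2; pose G := lor y2 y2.
pose mu := (r ^+ 2)^-1; pose j := a1 * b2 - b1 * a2.
have mu0 : 0 < mu by rewrite invr_gt0 exprn_gt0.
have rmu : r ^+ 2 * mu = 1 by rewrite mulfV// gt_eqF// exprn_gt0.
have jn : j != 0 by rewrite gt_eqF.
have rn : r != 0 by rewrite gt_eqF.
have mun : mu != 0 by rewrite gt_eqF.
have gaa : a1 ^+ 2 * E + 2 * a1 * a2 * F + a2 ^+ 2 * G = mu.
  move: H11; rewrite E1 !lorE y0 !(lorC _ y) y01 y02 (lorC y2 y1) -/E -/F -/G => h.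
  apply: (mulfI (expf_neq0 2 rn)); rewrite rmu; apply: etrans h; ring.
have gbb : b1 ^+ 2 * E + 2 * b1 * b2 * F + b2 ^+ 2 * G = mu.
  move: H22; rewrite E2 !lorE y0 !(lorC _ y) y01 y02 (lorC y2 y1) -/E -/F -/G => h.
  apply: (mulfI (expf_neq0 2 rn)); rewrite rmu; apply: etrans h; ring.
have gab : a1 * b1 * E + (a1 * b2 + a2 * b1) * F + a2 * b2 * G = 0.
  move: H12; rewrite E1 E2 !lorE y0 !(lorC _ y) y01 y02 (lorC y2 y1) -/E -/F -/G => h.
  apply: (mulfI (expf_neq0 2 rn)); rewrite mulr0; apply: etrans h; ring.
have EE : E = mu * (a2 ^+ 2 + b2 ^+ 2) / j ^+ 2.
  apply: (mulIf (expf_neq0 2 jn)); rewrite divfK ?expf_neq0//.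
  transitivity (b2 ^+ 2 * mu - 2 * a2 * b2 * 0 + a2 ^+ 2 * mu); last by ring.
  by rewrite -{1}gaa -gbb -gab /j; ring.
have FF : F = - mu * (a1 * a2 + b1 * b2) / j ^+ 2.
  apply: (mulIf (expf_neq0 2 jn)); rewrite divfK ?expf_neq0//.
  transitivity (- b1 * b2 * mu + (a1 * b2 + a2 * b1) * 0 - a1 * a2 * mu); last by ring.
  by rewrite -{1}gaa -gbb -gab /j; ring.
have GG : G = mu * (a1 ^+ 2 + b1 ^+ 2) / j ^+ 2.
  apply: (mulIf (expf_neq0 2 jn)); rewrite divfK ?expf_neq0//.
  transitivity (b1 ^+ 2 * mu - 2 * a1 * b1 * 0 + a1 ^+ 2 * mu); last by ring.
  by rewrite -{1}gaa -gbb -gab /j; ring.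
have De : E * G - F ^+ 2 = (mu / j) ^+ 2.
  rewrite EE FF GG /j; field; exact: jn.
have Den : E * G - F ^+ 2 != 0 by rewrite De expf_neq0// mulf_neq0// invr_neq0.
have sDe : Num.sqrt (E * G - F ^+ 2) = mu / j.
  by rewrite De sqrtr_sqr gtr0_norm// divr_gt0.
(* A vector orthogonal to y and to Z1, Z2 is orthogonal to y1, y2, the change of
   parameter being invertible. *)
have solve (u : 'rV[R]_m.+1) : lor u y = 0 -> lor u Z1 = 0 -> lor u Z2 = 0 ->
    lor u y1 = 0 /\ lor u y2 = 0.
  rewrite E1 E2 !lorE => -> u1 u2.
  have v1 : a1 * lor u y1 + a2 * lor u y2 = 0.
    by apply: (mulfI rn); rewrite mulr0 -u1; ring.
  have v2 : b1 * lor u y1 + b2 * lor u y2 = 0.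
    by apply: (mulfI rn); rewrite mulr0 -u2; ring.
  split; apply: (mulfI jn); rewrite mulr0.
    transitivity (b2 * 0 - a2 * 0 : R); last by ring.
    by rewrite -{1}v1 -v2 /j; ring.
  transitivity (a1 * 0 - b1 * 0 : R); last by ring.
  by rewrite -{1}v2 -v1 /j; ring.
pose u := ((a1 ^+ 2) *: y11 + (2 * a1 * a2) *: y12 + (a2 ^+ 2) *: y22)
   - ((b1 ^+ 2) *: y11 + (2 * b1 * b2) *: y12 + (b2 ^+ 2) *: y22).
pose w := (a1 * b1) *: y11 + (a1 * b2 + a2 * b1) *: y12 + (a2 * b2) *: y22.
have yu : lor u y = 0.
  rewrite /u !lorE !(lorC _ y) y011 y012 y022 -/E -/F -/G.
  transitivity (mu - mu); last by rewrite subrr.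
  by rewrite -{1}gbb -gaa; ring.
have yw : lor w y = 0.
  rewrite /w !lorE !(lorC _ y) y011 y012 y022 -/E -/F -/G.
  by rewrite -[RHS]oppr0 -gab; ring.
have EU : Z11 - Z22 = r *: u + (t11 - t22) *: y1 + (s11 - s22) *: y2 + (c11 - c22) *: y.
  by rewrite E11 E22 /u; apply/rowP => i; rewrite !mxE; ring.
have EW : Z12 = r *: w + t12 *: y1 + s12 *: y2 + c12 *: y by rewrite E12.
have key (v x : 'rV[R]_m.+1) (k1 k2 k3 : R) : v = r *: x + k1 *: y1 + k2 *: y2 + k3 *: y ->
    lor x y = 0 -> lor v Z1 = 0 -> lor v Z2 = 0 -> lor v v = r ^+ 2 * qform y1 y2 x x.
  move=> Ev xy vZ1 vZ2.
  have vy : lor v y = 0 by rewrite Ev !lorE xy y0 !(lorC _ y) y01 y02; ring.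
  have [v1 v2] := solve v vy vZ1 vZ2.
  rewrite -(@qform_perp y1 y2 Den v v v1 v2).
  have qy z : qform y1 y2 y z = lor y z by exact: (@qform_perp y1 y2 Den y z y01 y02).
  rewrite Ev !qE !(qformC _ _ _ y) !(qformC _ _ _ y1) !(qformC _ _ _ y2) !qy.
  rewrite !(qform_1 Den) !(qform_2 Den) ?y0 ?(lorC y x) ?xy ?y01 ?y02; ring.
rewrite (key _ _ _ _ _ EU yu U1 U2) (key _ _ _ _ _ EW yw W1 W2) /dens -/E -/F -/G sDe.
rewrite De /u /w !qE !(qformC _ _ y22 _) !(qformC _ _ y12 y11).
rewrite EE FF GG -[a1 * b2 - b1 * a2]/j.
move: (qform _ _ _ _) (qform _ _ _ _) (qform _ _ _ _) (qform _ _ _ _) (qform _ _ _ _) (qform _ _ _ _).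
move=> x1 x2 x3 x4 x5 x6; rewrite /mu /j; field; exact/andP.
Qed.
End Density.

Section DensityIsWillmore.
Variables (R : realType) (n : nat).

(** The members of a variation are neither conformally parametrized nor
   canonically lifted; densY is nevertheless their Willmore integrand. *)
Definition densY (y : R * R -> 'rV[R]_n.+2) (p : R * R) : R :=
  dens (dx y p) (dy y p) (dx (dx y) p) (dy (dx y) p) (dy (dy y) p).

Section Chain.
Variables (O O' : set (R * R)) (sg : R * R -> R * R) (y : R * R -> 'rV[R]_n.+2).
Hypothesis oO : open O.
Hypothesis oO' : open O'.
Hypothesis ssg : smooth_on O' sg.
Hypothesis sgO : forall q, O' q -> O (sg q).
Hypothesis sy : smooth_on O y.

Lemma dx_chain q : O' q ->
  dx (fun q => y (sg q)) q = (dx sg q).1 *: dx y (sg q) + (dx sg q).2 *: dy y (sg q).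
Proof.
move=> Oq; apply: dx_eq.
exact: is_derive_chain_row oO sy (sgO Oq) (is_dx ssg Oq).
Qed.
Lemma dy_chain q : O' q ->
  dy (fun q => y (sg q)) q = (dy sg q).1 *: dx y (sg q) + (dy sg q).2 *: dy y (sg q).
Proof.
move=> Oq; apply: dy_eq.
exact: is_derive_chain_row oO sy (sgO Oq) (is_dy ssg Oq).
Qed.
Lemma smooth_chain : smooth_on O' (fun q => y (sg q)).
Proof. exact: smooth_comp_row oO' oO sgO sy ssg. Qed.
End Chain.

(** Y = rho y o sigma with rho smooth; the 2-jet of Y is computed by the chain rule
   and dens_invariant concludes. *)
Lemma willmore_density_densY (O : set (R * R)) X (y : R * R -> 'rV[R]_n.+2) (r : R * R -> R) :
  open O -> smooth_on O y -> (forall p, O p -> on_sphere (X p)) ->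
  (forall p, O p -> 0 < r p /\ y p = r p *: hat (X p)) ->
  willmore_density O X (densY y).
Proof.
move=> oO sy oX yE O' sg Y s kappa oO' ssg sgO cX cl hk q Oq.
have sgO1 p : O' p -> O (sg p) by move=> /sgO[].
have nl : null_lift O' Y.
  apply: (canonical_null_lift oO' _ cl) => p Op; exact: oX (sgO1 _ Op).
have sY := nl_smooth nl.
rewrite (hopf_norm nl hk Oq); congr (_%:C)%C.
have hz t v : (t *: hat v) 0 ord0 = t by rewrite mxE hat_0 mulr1.
have YH p : O' p -> exists t : R, 0 < t /\ Y p = t *: hat (X (sg p)).
  by move=> Op; have [_ /(_ p Op)[]] := cl.
(* The conformal factor between the two lifts. *)
pose rho p := Y p 0 ord0 / y (sg p) 0 ord0.
have sysg := smooth_chain oO oO' ssg sgO1 sy.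
have y0 p : O' p -> 0 < y (sg p) 0 ord0.
  by move=> /sgO1 /yE[r0 ->]; rewrite mxE hat_0 mulr1.
have srho : smooth_on O' rho.
  apply: smooth_mul => //; first exact: (smooth_rowP _ oO').1 sY ord0.
  apply: smooth_inv => //; first by move=> p /y0 h; rewrite gt_eqF.
  exact: (smooth_rowP _ oO').1 sysg ord0.
have rho0 p : O' p -> 0 < rho p.
  move=> Op; rewrite divr_gt0 ?y0//.
  by have [t [t0 ->]] := YH p Op; rewrite hz.
have YE p : O' p -> Y p = rho p *: y (sg p).
  move=> Op; rewrite /rho.
  have [t [t0 ->]] := YH p Op; have [r0 ->] := yE _ (sgO1 _ Op).
  by rewrite !hz scalerA -mulrA mulVf ?gt_eqF// mulr1.
pose a p := dx sg p; pose b p := dy sg p.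
have sa1 : smooth_on O' (fun p => (a p).1) by apply: smooth_fst => //; exact: smooth_dx.
have sa2 : smooth_on O' (fun p => (a p).2) by apply: smooth_snd => //; exact: smooth_dx.
have sb1 : smooth_on O' (fun p => (b p).1) by apply: smooth_fst => //; exact: smooth_dy.
have sb2 : smooth_on O' (fun p => (b p).2) by apply: smooth_snd => //; exact: smooth_dy.
have sy1 := smooth_dx sy; have sy2 := smooth_dy sy.
have sy1s := smooth_chain oO oO' ssg sgO1 sy1.
have sy2s := smooth_chain oO oO' ssg sgO1 sy2.
have Zx p : O' p -> dx Y p =
    dx rho p *: y (sg p) + rho p *: ((a p).1 *: dx y (sg p) + (a p).2 *: dy y (sg p)).
  move=> Op; rewrite (dx_on oO' YE Op) (dx_zscale Op srho sysg).
  by rewrite (dx_chain oO ssg sgO1 sy Op).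
have Zy p : O' p -> dy Y p =
    dy rho p *: y (sg p) + rho p *: ((b p).1 *: dx y (sg p) + (b p).2 *: dy y (sg p)).
  move=> Op; rewrite (dy_on oO' YE Op) (dy_zscale Op srho sysg).
  by rewrite (dy_chain oO ssg sgO1 sy Op).
have sin (f g : R * R -> R) : smooth_on O' f -> smooth_on O' g ->
    smooth_on O' (fun p => f p *: dx y (sg p) + g p *: dy y (sg p)).
  by move=> sf sg'; apply: smooth_add => //; apply: smooth_zscale.
have sch : dx (dy y) (sg q) = dy (dx y) (sg q) by rewrite (schwarz oO sy (sgO1 _ Oq)).
have D1 (f g h : R * R -> R) : smooth_on O' h -> smooth_on O' f -> smooth_on O' g ->
   dx (fun p => h p *: y (sg p) + rho p *: (f p *: dx y (sg p) + g p *: dy y (sg p))) q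
   = dx h q *: y (sg q) + h q *: ((a q).1 *: dx y (sg q) + (a q).2 *: dy y (sg q))
   + (dx rho q *: (f q *: dx y (sg q) + g q *: dy y (sg q))
   + rho q *: ((dx f q *: dx y (sg q)
        + f q *: ((a q).1 *: dx (dx y) (sg q) + (a q).2 *: dy (dx y) (sg q)))
      + (dx g q *: dy y (sg q)
        + g q *: ((a q).1 *: dx (dy y) (sg q) + (a q).2 *: dy (dy y) (sg q))))).
  move=> sh sf sg'.
  have t1 := smooth_zscale oO' sh sysg; have t2 := sin _ _ sf sg'.
  rewrite (dx_add Oq t1 (smooth_zscale oO' srho t2)) (dx_zscale Oq sh sysg).
  rewrite (dx_zscale Oq srho t2).
  rewrite (dx_add Oq (smooth_zscale oO' sf sy1s) (smooth_zscale oO' sg' sy2s)).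
  rewrite (dx_zscale Oq sf sy1s) (dx_zscale Oq sg' sy2s).
  by rewrite !(dx_chain oO ssg sgO1 _ Oq).
have D2 (f g h : R * R -> R) : smooth_on O' h -> smooth_on O' f -> smooth_on O' g ->
   dy (fun p => h p *: y (sg p) + rho p *: (f p *: dx y (sg p) + g p *: dy y (sg p))) q
   = dy h q *: y (sg q) + h q *: ((b q).1 *: dx y (sg q) + (b q).2 *: dy y (sg q))
   + (dy rho q *: (f q *: dx y (sg q) + g q *: dy y (sg q))
   + rho q *: ((dy f q *: dx y (sg q)
        + f q *: ((b q).1 *: dx (dx y) (sg q) + (b q).2 *: dy (dx y) (sg q)))
      + (dy g q *: dy y (sg q)
        + g q *: ((b q).1 *: dx (dy y) (sg q) + (b q).2 *: dy (dy y) (sg q))))).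
  move=> sh sf sg'.
  have t1 := smooth_zscale oO' sh sysg; have t2 := sin _ _ sf sg'.
  rewrite (dy_add Oq t1 (smooth_zscale oO' srho t2)) (dy_zscale Oq sh sysg).
  rewrite (dy_zscale Oq srho t2).
  rewrite (dy_add Oq (smooth_zscale oO' sf sy1s) (smooth_zscale oO' sg' sy2s)).
  rewrite (dy_zscale Oq sf sy1s) (dy_zscale Oq sg' sy2s).
  by rewrite !(dy_chain oO ssg sgO1 _ Oq).
have Zxx := etrans (dx_on oO' Zx Oq) (D1 _ _ _ (smooth_dx srho) sa1 sa2).
have Zxy := etrans (dy_on oO' Zx Oq) (D2 _ _ _ (smooth_dx srho) sa1 sa2).
have Zyy := etrans (dy_on oO' Zy Oq) (D2 _ _ _ (smooth_dy srho) sb1 sb2).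
(* Consequences of y being null, by differentiation. *)
have sO := sgO1 _ Oq.
have n0 p : O p -> lor (y p) (y p) = 0.
  by move=> Op; have [_ ->] := yE p Op; rewrite lorZl lorZr lor_hat oX// addNr !mulr0.
have n1 p : O p -> lor (y p) (dx y p) = 0.
  move=> Op; have : dx (fun q => lor (y q) (y q)) p = 0 by rewrite (dx_on oO n0 Op) dx_cst.
  by rewrite (dx_lor Op sy sy) (lorC (dx y p)); lra.
have n2 p : O p -> lor (y p) (dy y p) = 0.
  move=> Op; have : dy (fun q => lor (y q) (y q)) p = 0 by rewrite (dy_on oO n0 Op) dy_cst.
  by rewrite (dy_lor Op sy sy) (lorC (dy y p)); lra.
have n11 : lor (y (sg q)) (dx (dx y) (sg q)) = - lor (dx y (sg q)) (dx y (sg q)).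
  have : dx (fun q => lor (y q) (dx y q)) (sg q) = 0 by rewrite (dx_on oO n1 sO) dx_cst.
  by rewrite (dx_lor sO sy sy1); lra.
have n12 : lor (y (sg q)) (dy (dx y) (sg q)) = - lor (dx y (sg q)) (dy y (sg q)).
  have : dy (fun q => lor (y q) (dx y q)) (sg q) = 0 by rewrite (dy_on oO n1 sO) dy_cst.
  by rewrite (dy_lor sO sy sy1) (lorC (dy y (sg q)) (dx y _)); lra.
have n22 : lor (y (sg q)) (dy (dy y) (sg q)) = - lor (dy y (sg q)) (dy y (sg q)).
  have : dy (fun q => lor (y q) (dy y q)) (sg q) = 0 by rewrite (dy_on oO n2 sO) dy_cst.
  by rewrite (dy_lor sO sy sy2); lra.
have jE : Defs.jacobian sg q = (a q).1 * (b q).2 - (b q).1 * (a q).2.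
  by rewrite /a /b dx.unlock dy.unlock.
have j0 : 0 < (a q).1 * (b q).2 - (b q).1 * (a q).2 by rewrite -jE; have [] := sgO q Oq.
have PE : PY Y q = dx (dx Y) q - dy (dy Y) q by rewrite PY.unlock.
have QE : lor (QY Y q) (QY Y q) = 4 * lor (dy (dx Y) q) (dy (dx Y) q).
  by rewrite QY.unlock !lorE; ring.
transitivity (4^-1 * lor (dx (dx Y) q - dy (dy Y) q) (dx (dx Y) q - dy (dy Y) q)
   + lor (dy (dx Y) q) (dy (dx Y) q)).
  by rewrite QE PE; field.
rewrite jE /densY.
rewrite sch in Zxx Zxy Zyy.
apply: (@dens_invariant R n.+1 (y (sg q)) (dx y (sg q)) (dy y (sg q)) (dx (dx y) (sg q))
  (dy (dx y) (sg q)) (dy (dy y) (sg q)) (dx Y q) (dy Y q) (dx (dx Y) q)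
  (dy (dx Y) q) (dy (dy Y) q) (a q).1 (a q).2 (b q).1 (b q).2 (rho q) (dx rho q) (dy rho q)
  (dx (dx rho) q) (dy (dx rho) q) (dy (dy rho) q)
  (2 * dx rho q * (a q).1 + rho q * dx (fun p => (a p).1) q)
  (dx rho q * (b q).1 + dy rho q * (a q).1 + rho q * dy (fun p => (a p).1) q)
  (2 * dy rho q * (b q).1 + rho q * dy (fun p => (b p).1) q)
  (2 * dx rho q * (a q).2 + rho q * dx (fun p => (a p).2) q)
  (dx rho q * (b q).2 + dy rho q * (a q).2 + rho q * dy (fun p => (a p).2) q)
  (2 * dy rho q * (b q).2 + rho q * dy (fun p => (b p).2) q)).
- exact: n0.
- exact: n1.
- exact: n2.
- exact: n11.
- exact: n12.
- exact: n22.
- exact: rho0.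
- exact: j0.
- exact: Zx.
- exact: Zy.
- rewrite Zxx; apply/rowP => i; rewrite ![in LHS]mxE ![in RHS]mxE; ring.
- rewrite Zxy; apply/rowP => i; rewrite ![in LHS]mxE ![in RHS]mxE; ring.
- rewrite Zyy; apply/rowP => i; rewrite ![in LHS]mxE ![in RHS]mxE; ring.
- exact: (nl_xx nl Oq).
- exact: (nl_yy nl Oq).
- exact: (nl_xy nl Oq).
- by rewrite -PE; exact: (PY_x nl Oq).
- by rewrite -PE; exact: (PY_y nl Oq).
- exact: (nl_xyx nl Oq).
- exact: (nl_xyy nl Oq).
Qed.

End DensityIsWillmore.

(** * Bump functions *)
Section Bump.
Variable R : realType.

(** The functions x^(-j) exp (-1/x), extended by 0; this family is stable under
   differentiation up to linear combinations. *)
Definition flat (j : nat) (x : R) : R := if 0 < x then x^-1 ^+ j * expR (- x^-1) else 0.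

Lemma flat_le0 j x : x <= 0 -> flat j x = 0.
Proof. by move=> x0; rewrite /flat ltNge x0. Qed.
Lemma flat_gt0 j x : 0 < x -> 0 < flat j x.
Proof. by move=> x0; rewrite /flat x0 mulr_gt0// ?expR_gt0// exprn_gt0// invr_gt0. Qed.

(** From y^(j+1) <= (j+1)! exp y with y = 1/x. *)
Lemma flat_bound j x : 0 < x -> `|flat j x| <= (j.+1)`!%:R * x.
Proof.
move=> x0; rewrite gtr0_norm ?flat_gt0// /flat x0.
have y0 : 0 < x^-1 by rewrite invr_gt0.
move: (x^-1) y0 (invrK x) => y y0 <-.
have := expR_ge1Dxn j (ltW y0) => h.
have f0 : 0 < (j.+1)`!%:R :> R by rewrite ltr0n fact_gt0.
have h2 : y ^+ j.+1 <= (j.+1)`!%:R * expR y.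
  rewrite mulrC -ler_pdivrMr//; apply: le_trans h; lra.
rewrite expRN ler_pdivrMr ?expR_gt0// mulrAC ler_pdivlMr//.
by rewrite -exprSr.
Qed.

Lemma flat_derive0 j : is_derive (0 : R) 1 (flat j) 0.
Proof.
apply/is_derive_cvgP/cvgrPdist_le => e e0.
have f0 : 0 < (j.+2)`!%:R :> R by rewrite ltr0n fact_gt0.
near=> h.
rewrite sub0r normrN (flat_le0 j (lexx 0)) subr0 addr0 [_%:A]mulr1.
have [h0|h0] := leP h 0; first by rewrite flat_le0// scaler0 normr0 ltW.
have -> : h^-1 *: flat j h = flat j.+1 h by rewrite /flat h0 exprS -mulrA.
apply: le_trans (flat_bound _ h0) _; rewrite mulrC -ler_pdivlMr//.
apply: le_trans (ler_norm _) _; near: h; apply: dnbhs0_le; exact: divr_gt0.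
Unshelve. all: by end_near. Qed.

Lemma flat_derive j (x : R) : is_derive x 1 (flat j) (- j%:R * flat j.+1 x + flat j.+2 x).
Proof.
have [x0|x0|->] := ltgtP x 0; last first.
- by rewrite !flat_le0// mulr0 addr0; exact: flat_derive0.
- apply: (@near_eq_is_derive R R R (fun x : R => x^-1 ^+ j * expR (- x^-1)) (flat j) x 1).
    near=> y; have y0 : 0 < y by near: y; exact: lt_nbhsr.
    by rewrite /flat y0.
  have xn : x != 0 by rewrite gt_eqF.
  have dV : is_derive x 1 (fun x : R => x^-1) (- (x^-1 * x^-1)).
    apply: DeriveDef; first exact: (@derivableV R R id x 1 xn (@derivable_id _ _ _ _)).
    have := @deriveV R R id x 1 xn (@derivable_id _ _ _ _).
    by rewrite derive_id => E; rewrite [LHS]E -exprVn expr2 scaleNr [_ *: _]mulr1.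
  have dE : is_derive x 1 (fun x : R => expR (- x^-1)) (expR (- x^-1) * (x^-1 * x^-1)).
    have := @is_derive1_comp R expR (fun x : R => - x^-1) x _ _ (is_derive_expR _) (is_deriveN dV).
    by rewrite opprK; exact.
  have dX := is_deriveX j dV; rewrite exprfctE in dX.
  apply: (is_derive_eq (is_deriveM dX dE)).
  rewrite /flat x0 /=; case: j dX => [|j] _ /=.
    by rewrite /GRing.scale /= !expr0; ring.
  by rewrite /GRing.scale/= !exprS -[j.+1]addn1 natrD; ring.
- rewrite !flat_le0 ?(ltW x0)// mulr0 addr0.
  apply: (@near_eq_is_derive R R R (fun=> 0) (flat j) x 1).
  near=> y; rewrite flat_le0//; apply: ltW; near: y; exact: lt_nbhsl.
Unshelve. all: by end_near. Qed.

Lemma smooth_flat j : smooth_on [set: R] (flat j).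
Proof.
have cf i (x : R) : {for x, continuous (flat i)}.
  by have [/derivable1_diffP h _] := flat_derive i x; exact: differentiable_continuous.
move=> k; elim: k j => [|k IH] j; first by split.
split=> // v.
have Dv (x : R) : is_derive x v (flat j) (v * (- j%:R * flat j.+1 x + flat j.+2 x)).
  by have [d <-] := flat_derive j x; exact: derive_R.
split; first by move=> x _; have [] := Dv x.
apply: (@Ck_ext _ _ _ _ _ (fun x => v * (- j%:R * flat j.+1 x + flat j.+2 x))).
- exact: openT.
- by move=> x _; have [_ ->] := Dv x.
apply: Ck_mul; [exact: openT|exact: smooth_cst|].
apply: Ck_add; [exact: openT| |exact: IH].
by apply: Ck_mul; [exact: openT|exact: smooth_cst|exact: IH].
Qed.

Variables (q0 : R * R) (r : R).

(** Positive exactly on the open square of centre q0 and half side r. *)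
Definition sqbump (q : R * R) : R :=
  (flat 0 (q.1 - q0.1 + r) * flat 0 (q0.1 + r - q.1))
  * (flat 0 (q.2 - q0.2 + r) * flat 0 (q0.2 + r - q.2)).

Lemma smooth_sqbump : smooth_on [set: R * R] sqbump.
Proof.
have oT : open [set: R * R] by exact: openT.
have s1 : smooth_on [set: R * R] (fun q : R * R => q.1) by apply: smooth_fst oT (smooth_id oT).
have s2 : smooth_on [set: R * R] (fun q : R * R => q.2) by apply: smooth_snd oT (smooth_id oT).
have sF (f : R * R -> R) : smooth_on [set: R * R] f -> smooth_on [set: R * R] (fun q => flat 0 (f q)).
  by move=> sf; apply: (smooth_comp1 oT openT _ (@smooth_flat 0) sf).
by apply: smooth_mul => //; apply: smooth_mul => //; apply: sF; smooth_tac.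
Qed.

Lemma flat_ge0 j x : 0 <= flat j x.
Proof. by have [x0|x0] := leP x 0; [rewrite flat_le0|rewrite ltW// flat_gt0]. Qed.

Lemma sqbump_ge0 q : 0 <= sqbump q.
Proof. by rewrite /sqbump !mulr_ge0// flat_ge0. Qed.

Lemma sqbump_gt0 q : `|q.1 - q0.1| < r -> `|q.2 - q0.2| < r -> 0 < sqbump q.
Proof.
by rewrite !ltr_norml => /andP[? ?] /andP[? ?]; rewrite /sqbump !mulr_gt0// flat_gt0//; lra.
Qed.

Lemma sqbump_eq0 q : ~ (`|q.1 - q0.1| < r /\ `|q.2 - q0.2| < r) -> sqbump q = 0.
Proof.
rewrite !ltr_norml => h; rewrite /sqbump.
have [h1|h1] := leP (q.1 - q0.1 + r) 0; first by rewrite (flat_le0 _ h1) !mul0r.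
have [h2|h2] := leP (q0.1 + r - q.1) 0; first by rewrite (flat_le0 _ h2) mulr0 mul0r.
have [h3|h3] := leP (q.2 - q0.2 + r) 0; first by rewrite (flat_le0 _ h3) mul0r mulr0.
have [h4|h4] := leP (q0.2 + r - q.2) 0; first by rewrite (flat_le0 _ h4) !mulr0.
by exfalso; apply: h; split; apply/andP; split; lra.
Qed.

End Bump.

(** * Integration over rectangles *)
Section PlaneIntegral.
Variable R : realType.
Let mR := measurableTypeR R.
Let mu := @lebesgue_measure R.

Lemma open_plane_measurable (W : set (R * R)) : open W -> measurable (W : set (borel_plane R)).
Proof.
move=> oW.
pose box (a b c d : rat) : set (mR * mR) := `]ratr a, ratr b[%classic `*` `]ratr c, ratr d[%classic.
have -> : W = \bigcup_a \bigcup_b \bigcup_c \bigcup_d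
    (if `[< box a b c d `<=` W >] then box a b c d else set0).
  apply/seteqP; split => [[u v] Wuv|p [a _ [b _ [c _ [d _]]]]]; last first.
    by case: ifPn => // /asboolP H /H.
  have /nbhs_squareP[e e0 H] := open_near oW Wuv.
  have lt1 : u - e < u by rewrite ltrBlDr ltrDl.
  have lt2 : u < u + e by rewrite ltrDl.
  have lt3 : v - e < v by rewrite ltrBlDr ltrDl.
  have lt4 : v < v + e by rewrite ltrDl.
  have [a] := rat_in_itvoo lt1; rewrite in_itv/= => /andP[a1 a2].
  have [b] := rat_in_itvoo lt2; rewrite in_itv/= => /andP[b1 b2].
  have [c] := rat_in_itvoo lt3; rewrite in_itv/= => /andP[c1 c2].
  have [d] := rat_in_itvoo lt4; rewrite in_itv/= => /andP[d1 d2].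
  exists a => //; exists b => //; exists c => //; exists d => //.
  have sub : box a b c d `<=` W.
    move=> [x y] [] /=; rewrite !in_itv/= => /andP[x1 x2] /andP[y1 y2].
    by apply: H => /=; rewrite ltr_norml; apply/andP; split; lra.
  by rewrite (asboolT sub); split => /=; rewrite in_itv/=; apply/andP.
do 4! apply: bigcupT_measurable_rat => ?.
case: ifPn => // _; exact: measurableX.
Qed.

Lemma cont_plane_measurable (O B : set (R * R)) (f : R * R -> R) : open O -> B `<=` O ->
  measurable (B : set (borel_plane R)) -> (forall p, O p -> {for p, continuous f}) ->
  measurable_fun (B : set (borel_plane R)) (f : borel_plane R -> R).
Proof.
move=> oO BO mB cf.
apply: (@measurable_funS _ _ _ _ (O : set (borel_plane R))) => //.
  exact: open_plane_measurable.
move=> _; apply: (measurability _ (RGenOInfty.measurableE R)).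
move=> _ [_ [a ->] <-]; apply: open_plane_measurable.
rewrite openE => p [Op fp]; rewrite /interior.
have := cf p Op; have oI : open (`]a, +oo[%classic : set R) by exact: interval_open.
move=> /(_ _ (open_near oI fp)) fi.
by apply: filterI; [exact: open_nbhs_nbhs|exact: fi].
exact: open_plane_measurable.
Qed.

Definition rect (a b c d : R) : set (R * R) := `[a, b]%classic `*` `[c, d]%classic.

Lemma rectP a b c d p : rect a b c d p <-> (a <= p.1 <= b) /\ (c <= p.2 <= d).
Proof. by rewrite /rect /=; split=> [[]|[]]; rewrite !in_itv. Qed.

Lemma rect_measurable a b c d : measurable (rect a b c d : set (borel_plane R)).
Proof. exact: measurableX. Qed.

Lemma rect_compact a b c d : compact (rect a b c d).
Proof. by apply: compact_setX; exact: segment_compact. Qed.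

Lemma plane_measure_rect a b c d : a <= b -> c <= d ->
  plane_measure (rect a b c d : set (borel_plane R)) = ((b - a) * (d - c))%:E.
Proof.
move=> ab cd.
have L (x y : R) : x <= y -> mu `[x, y]%classic = (y - x)%:E.
  move=> xy; rewrite /mu lebesgue_measure_itv /= lte_fin -EFinB.
  by case: ltgtP xy => // -> _; rewrite subrr.
rewrite /plane_measure product_measure1E// EFinM.
by congr (_ * _)%E; exact: L.
Qed.

Lemma rect_integrable (O : set (R * R)) (f : R * R -> R) a b c d : a <= b -> c <= d ->
  open O -> rect a b c d `<=` O -> (forall p, O p -> {for p, continuous f}) ->
  (@plane_measure R).-integrable (rect a b c d : set (borel_plane R)) (EFin \o f).
Proof.
move=> ab cd oO BO cf; apply: measurable_bounded_integrable.
- exact: rect_measurable.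
- by rewrite [X in (X < _)%E](plane_measure_rect ab cd) ltry.
- by apply: cont_plane_measurable BO _ cf => //; exact: rect_measurable.
- have cB : compact (f @` rect a b c d).
    apply: continuous_compact; last exact: rect_compact.
    by apply: continuous_in_subspaceT => p; rewrite inE => /BO /cf.
  have [M [Mr H]] := compact_bounded cB; exists M; split => // x Mx p Bp.
  by apply: (H x Mx); exists p.
Qed.

Definition I2 a b c d (f : R * R -> R) : R :=
  \int[@plane_measure R]_(p in (rect a b c d : set (borel_plane R))) f p.

End PlaneIntegral.

Section RectIntegral.
Variable R : realType.
Let mu := @lebesgue_measure R.
Variables (a b c d : R) (O : set (R * R)).
Hypothesis ab : a < b.
Hypothesis cd : c < d.
Hypothesis oO : open O.
Hypothesis BO : rect a b c d `<=` O.

Let cont (f : R * R -> R) := forall p, O p -> {for p, continuous f}.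

Lemma I2_int f : cont f ->
  (@plane_measure R).-integrable (rect a b c d : set (borel_plane R)) (EFin \o f).
Proof. by move=> cf; apply: rect_integrable BO cf => //; exact: ltW. Qed.

Lemma I2_add f g : cont f -> cont g ->
  I2 a b c d (fun p => f p + g p) = I2 a b c d f + I2 a b c d g.
Proof. by move=> cf cg; apply: RintegralD; [exact: rect_measurable|exact: I2_int|exact: I2_int]. Qed.

Lemma I2_scale k f : cont f -> I2 a b c d (fun p => k * f p) = k * I2 a b c d f.
Proof. by move=> cf; apply: RintegralZl; [exact: rect_measurable|exact: I2_int]. Qed.

Lemma I2_ext f g : (forall p, rect a b c d p -> f p = g p) -> I2 a b c d f = I2 a b c d g.
Proof. by move=> fg; apply: eq_Rintegral => p; rewrite inE => /fg. Qed.

Lemma I2_ge0 f : (forall p, rect a b c d p -> 0 <= f p) -> 0 <= I2 a b c d f.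
Proof. by move=> f0; apply: Rintegral_ge0 => p; exact: f0. Qed.

Lemma I2_le f g : cont f -> cont g -> (forall p, rect a b c d p -> f p <= g p) ->
  I2 a b c d f <= I2 a b c d g.
Proof.
by move=> cf cg fg; apply: le_Rintegral => //; [exact: rect_measurable|exact: I2_int|exact: I2_int].
Qed.

Let fub (g : R * R -> R) : cont g ->
  let h := ((EFin \o g) \_ (rect a b c d)) in
  (@plane_measure R).-integrable [set: borel_plane R] h.
Proof.
move=> cg; apply: (integrable_mkcond _ (@rect_measurable R a b c d)).1.
exact: I2_int.
Qed.

(** Fubini and the fundamental theorem of calculus on horizontal segments. *)
Lemma I2_dx0 f : smooth_on O f -> (forall v, c <= v <= d -> f (a, v) = 0 /\ f (b, v) = 0) ->
  I2 a b c d (dx f) = 0.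
Proof.
move=> sf f0; have cg : cont (dx f) by move=> p; apply: smooth_continuous (smooth_dx sf).
rewrite /I2 /Rintegral integral_mkcond.
have fi := fub cg; simpl in fi.
rewrite -[X in fine X]/(\int[mu \x mu]_z ((EFin \o dx f) \_ (rect a b c d)) z)%E.
rewrite -(@integral21_prod_meas1 _ _ _ _ _ mu mu _ fi) /fubini_G.
rewrite integral0_eq// => v _.
have [vcd|vcd] := boolP (c <= v <= d); last first.
  rewrite integral0_eq// => u _; rewrite patchE ifF//; apply/negbTE; rewrite notin_setE.
  by move=> /rectP[_ /=]; apply/negP.
transitivity (\int[mu]_(u in `[a, b]) (dx f (u, v))%:E)%E.
  rewrite [RHS]integral_mkcond; apply: eq_integral => u _; rewrite !patchE /=.
  congr (if _ then _ else _); apply/idP/idP; rewrite !inE.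
    by move=> /rectP[/= + _]; rewrite in_itv.
  by move=> uab; apply/rectP; split => //=; move: uab; rewrite in_itv.
have Ouv u : a <= u <= b -> O (u, v) by move=> uab; apply: BO; apply/rectP.
have Duv u : a <= u <= b -> is_derive u 1 (fun x => f (x, v)) (dx f (u, v)).
  by move=> uab; apply/is_derive_du; apply: is_dx sf _; exact: Ouv.
have cuv u : a <= u <= b -> {for u, continuous (fun x => f (x, v))}.
  by move=> /Duv[/derivable1_diffP h _]; exact: differentiable_continuous.
rewrite (@continuous_FTC2 _ (fun u => dx f (u, v)) (fun u => f (u, v)) a b)//.
- by have [-> ->] := f0 v vcd; rewrite -EFinB subrr.
- apply: continuous_in_subspaceT => u; rewrite inE/= in_itv/= => uab.
  apply: (@continuous_comp _ _ _ (fun u => (u, v) : R * R) (dx f)).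
    by have := cvg_pair (@cvg_id _ (nbhs u)) (cvg_cst v (F := nbhs u)); apply.
  by apply: cg; exact: Ouv.
- have aab : a <= a <= b by rewrite lexx ltW.
  have bab : a <= b <= b by rewrite lexx ltW.
  split.
  + by move=> u /itvP uab; have [] := Duv u; rewrite ?uab ?(ltW (itvP uab _)).
  + by apply: cvg_at_right_filter; exact: cuv.
  + by apply: cvg_at_left_filter; exact: cuv.
- move=> u /itvP uab; rewrite derive1E; have [|_ ->//] := Duv u.
  by rewrite !uab.
Qed.

Lemma I2_dy0 f : smooth_on O f -> (forall u, a <= u <= b -> f (u, c) = 0 /\ f (u, d) = 0) ->
  I2 a b c d (dy f) = 0.
Proof.
move=> sf f0; have cg : cont (dy f) by move=> p; apply: smooth_continuous (smooth_dy sf).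
rewrite /I2 /Rintegral integral_mkcond.
have fi := fub cg; simpl in fi.
rewrite -[X in fine X]/(\int[mu \x mu]_z ((EFin \o dy f) \_ (rect a b c d)) z)%E.
rewrite -(@integral12_prod_meas1 _ _ _ _ _ mu mu _ fi) /fubini_F.
rewrite integral0_eq// => u _.
have [uab|uab] := boolP (a <= u <= b); last first.
  rewrite integral0_eq// => v _; rewrite patchE ifF//; apply/negbTE; rewrite notin_setE.
  by move=> /rectP[/= + _]; apply/negP.
transitivity (\int[mu]_(v in `[c, d]) (dy f (u, v))%:E)%E.
  rewrite [RHS]integral_mkcond; apply: eq_integral => v _; rewrite !patchE /=.
  congr (if _ then _ else _); apply/idP/idP; rewrite !inE.
    by move=> /rectP[/= _ +]; rewrite in_itv.
  by move=> vcd; apply/rectP; split => //=; move: vcd; rewrite in_itv.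
have Ouv v : c <= v <= d -> O (u, v) by move=> vcd; apply: BO; apply/rectP.
have Duv v : c <= v <= d -> is_derive v 1 (fun x => f (u, x)) (dy f (u, v)).
  by move=> vcd; apply/is_derive_dv; apply: is_dy sf _; exact: Ouv.
have cuv v : c <= v <= d -> {for v, continuous (fun x => f (u, x))}.
  by move=> /Duv[/derivable1_diffP h _]; exact: differentiable_continuous.
rewrite (@continuous_FTC2 _ (fun v => dy f (u, v)) (fun v => f (u, v)) c d)//.
- by have [-> ->] := f0 u uab; rewrite -EFinB subrr.
- apply: continuous_in_subspaceT => v; rewrite inE/= in_itv/= => vcd.
  apply: (@continuous_comp _ _ _ (fun v => (u, v) : R * R) (dy f)).
    by have := cvg_pair (cvg_cst u (F := nbhs v)) (@cvg_id _ (nbhs v)); apply.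
  by apply: cg; exact: Ouv.
- have ccd : c <= c <= d by rewrite lexx ltW.
  have dcd : c <= d <= d by rewrite lexx ltW.
  split.
  + by move=> v /itvP vcd; have [] := Duv v; rewrite ?vcd.
  + by apply: cvg_at_right_filter; exact: cuv.
  + by apply: cvg_at_left_filter; exact: cuv.
- move=> v /itvP vcd; rewrite derive1E; have [|_ ->//] := Duv v.
  by rewrite !vcd.
Qed.

End RectIntegral.

Section RectIntegral2.
Variable R : realType.
Variables (a b c d : R) (O : set (R * R)).
Hypothesis ab : a < b.
Hypothesis cd : c < d.
Hypothesis oO : open O.
Hypothesis BO : rect a b c d `<=` O.

Let cont (f : R * R -> R) := forall p, O p -> {for p, continuous f}.

(** Otherwise f is bounded below by a positive constant on a small rectangle. *)
Lemma I2_eq0 f q : cont f -> (forall p, rect a b c d p -> 0 <= f p) -> I2 a b c d f = 0 ->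
  a < q.1 < b -> c < q.2 < d -> f q = 0.
Proof.
move=> cf f0 If /andP[q1 q2] /andP[q3 q4].
have Bq : rect a b c d q by apply/rectP; rewrite !ltW.
have [fq0|fq|//] := ltgtP (f q) 0; first by have := f0 q Bq; rewrite leNgt fq0.
have f2 : 0 < f q / 2 by rewrite divr_gt0.
have /nbhs_squareP[e e0 H] : \forall p \near q, f q / 2 <= f p.
  have : \forall p \near q, `|f q - f p| <= f q / 2.
    by have := cf q (BO Bq); move/cvgrPdist_le; apply.
  apply: filterS => p; rewrite ler_norml => /andP[_]; lra.
pose r := Num.min (e / 2) (Num.min (Num.min (q.1 - a) (b - q.1)) (Num.min (q.2 - c) (d - q.2))).
have r0 : 0 < r by rewrite !lt_min divr_gt0// !subr_gt0 q1 q2 q3 q4.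
have re : r < e.
  by apply: (@le_lt_trans _ _ (e / 2)); [rewrite ge_min lexx|rewrite ltr_pdivrMr// mulr_natr mulr2n ltrDl].
have /and4P[r1 r2 r3 r4] : [&& r <= q.1 - a, r <= b - q.1, r <= q.2 - c & r <= d - q.2].
  by rewrite !ge_min !lexx ?orbT.
pose S := rect (q.1 - r) (q.1 + r) (q.2 - r) (q.2 + r).
have SB : S `<=` rect a b c d.
  by move=> p /rectP[/andP[? ?] /andP[? ?]]; apply/rectP; split; apply/andP; split; lra.
have ab' : q.1 - r < q.1 + r by lra.
have cd' : q.2 - r < q.2 + r by lra.
have SO : S `<=` O by move=> p /SB /BO.
have iB := I2_int ab cd oO BO cf.
have iS := I2_int ab' cd' oO SO cf.
have h1 : (\int[@plane_measure R]_(p in (S : set (borel_plane R))) (f p)%:E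
   <= \int[@plane_measure R]_(p in (rect a b c d : set (borel_plane R))) (f p)%:E)%E.
  apply: ge0_subset_integral; [exact: rect_measurable|exact: rect_measurable| | |exact: SB].
    by have /integrableP[] := iB.
  by move=> p Bp; rewrite lee_fin; exact: f0.
have h2 : (\int[@plane_measure R]_(p in (S : set (borel_plane R))) (f q / 2)%:E
    <= \int[@plane_measure R]_(p in (S : set (borel_plane R))) (f p)%:E)%E.
  apply: ge0_le_integral.
  - exact: rect_measurable.
  - by move=> p _; rewrite lee_fin ltW.
  - exact: measurable_cst.
  - by have /integrableP[] := iS.
  - move=> p /rectP[/andP[? ?] /andP[? ?]]; rewrite lee_fin; apply: H;
    by rewrite ltr_norml; apply/andP; split; lra.
have h3 : (\int[@plane_measure R]_(p in (rect a b c d : set (borel_plane R))) (f p)%:E = 0)%E.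
  have fin := integrable_fin_num (@rect_measurable R a b c d) iB.
  by rewrite -(fineK fin) -[fine _]/(I2 a b c d f) If.
have := le_trans h2 h1; rewrite h3 integral_cst; last exact: rect_measurable.
rewrite [X in (_ * X)%E](plane_measure_rect (ltW ab') (ltW cd')) -EFinM lee_fin leNgt.
by rewrite mulr_gt0// mulr_gt0//; lra.
Qed.

Lemma is_derive_fst_line (V W : normedModType R) (f : R * V -> W) (t : R) (v : V) (df : W) :
  is_derive ((t, v) : R * V) ((1, 0) : R * V) f df <-> is_derive t 1 (fun t => f (t, v)) df.
Proof.
rewrite !is_derive_cvgP.
have E h : h *: ((1, 0) : R * V) + (t, v) = (h *: 1 + t, v).
  by congr pair; rewrite /= ?scaler0 ?add0r.
by under eq_fun do rewrite E.
Qed.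

Definition et : R * (R * R) := (1, 0).

(** Differentiation under the integral sign; the derivative is bounded on a compact
   neighbourhood of {0} x rect. *)
Lemma I2_derive (eps : R) (D : R * (R * R) -> R) : 0 < eps ->
  smooth_on [set q : R * (R * R) | `|q.1| < eps /\ O q.2] D ->
  is_derive (0 : R) 1 (fun t => I2 a b c d (fun q => D (t, q)))
    (I2 a b c d (fun q => 'D_et D (0, q))).
Proof.
move=> e0 sD; apply/is_derive_cvgP.
pose u := - (eps / 2); pose v := eps / 2.
have uv (t : R) : t \in `]u, v[%R -> `|t| < eps.
  by rewrite in_itv/= /u /v => /andP[? ?]; rewrite ltr_norml; apply/andP; split; lra.
have Dder (t : R) q : `|t| < eps -> O q ->
    is_derive t 1 (fun t : R => D (t, q)) ('D_et D (t, q)).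
  by move=> te Oq; apply/is_derive_fst_line; apply: derivableP; apply: smooth_derivable sD _.
have csec (g : R * (R * R) -> R) t : smooth_on [set q : R * (R * R) | `|q.1| < eps /\ O q.2] g ->
    `|t| < eps -> cont (fun q => g (t, q)).
  move=> sg te q Oq; apply: (@continuous_comp _ _ _ (fun q => (t, q) : R * (R * R)) g).
    by have := cvg_pair (cvg_cst t (F := nbhs q)) (@cvg_id _ (nbhs q)); apply.
  by apply: smooth_continuous sg _.
have sD1 := smooth_derive et sD.
have [M HM] : exists M : R, forall (t : R) q, t \in `[u, v]%R -> rect a b c d q ->
    `|'D_et D (t, q)| <= M.
  pose K := (`[u, v]%classic `*` rect a b c d) : set (R * (R * R)).
  have cK : compact K by apply: compact_setX; [exact: segment_compact|exact: rect_compact].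
  have cDK : compact ((fun p => 'D_et D p) @` K).
    apply: continuous_compact => //.
    apply: continuous_in_subspaceT => -[t q]; rewrite inE => -[/= tuv Bq].
    apply: smooth_continuous sD1 _; split => /=; last exact: BO.
    move: tuv; rewrite in_itv/= /u /v => /andP[? ?].
    by rewrite ltr_norml; apply/andP; split; lra.
  have [M [Mr H]] := compact_bounded cDK; exists (M + 1) => t q tuv Bq.
  by apply: (H (M + 1)); [rewrite ltrDl|exists (t, q)].
have Icst : (@plane_measure R).-integrable (rect a b c d : set (borel_plane R))
   (EFin \o (fun=> `|M|)).
  by apply: (I2_int ab cd oO BO) => p _; exact: cst_continuous.
have I0 : `]u, v[%classic 0 by rewrite /= in_itv/= /u /v; apply/andP; split; lra.
have Iint (t : R) : `]u, v[%classic t ->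
    (@plane_measure R).-integrable (rect a b c d : set (borel_plane R)) (EFin \o (fun q => D (t, q))).
  by move=> /uv te; apply: (I2_int ab cd oO BO); exact: csec.
have Ider (t : R) q : `]u, v[%classic t -> rect a b c d q -> derivable (fun t : R => D (t, q)) t 1.
  by move=> /uv te /BO Oq; have [] := Dder t q te Oq.
have p1E (t : R) q : `]u, v[%classic t -> rect a b c d q ->
    partial1of2 (fun t q => D (t, q)) t q = 'D_et D (t, q).
  by move=> /uv te /BO Oq; rewrite partial1of2E; have [] := Dder t q te Oq.
have Mub (t : R) q : `]u, v[%classic t -> rect a b c d q ->
    `|partial1of2 (fun t q => D (t, q)) t q| <= `|M|.
  move=> tuv Bq; rewrite p1E//; apply: le_trans (ler_norm M); apply: HM => //.
  exact: subset_itv_oo_cc tuv.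
have := @cvg_differentiation_under_integral R _ (borel_plane R) (@plane_measure R)
  (fun t q => D (t, q)) _ (@rect_measurable R a b c d) 0 u v I0 Iint Ider (fun=> `|M|)
  (fun=> normr_ge0 M) Icst Mub.
have E : \int[@plane_measure R]_(q in (rect a b c d : set (borel_plane R)))
    partial1of2 (fun (t : R) (q : R * R) => D (t, q)) 0 q
    = I2 a b c d (fun q => 'D_et D (0, q)).
  by apply: eq_Rintegral => q; rewrite inE => Bq; rewrite p1E.
rewrite E => H; have E2 (h : R) : h *: 1 + 0 = h + 0 :> R by rewrite [_%:A]mulr1.
by under eq_fun do rewrite E2.
Qed.

End RectIntegral2.

(** * The first variation of the Willmore integrand *)
Section DensityDerivative.
Variables (R : realType) (m : nat).
Implicit Types f g : R -> R.

Lemma isd_mul f g (t df dg : R) : is_derive t 1 f df -> is_derive t 1 g dg ->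
  is_derive t 1 (fun t => f t * g t) (df * g t + f t * dg).
Proof.
move=> Hf Hg; apply: (is_derive_eq (is_deriveM Hf Hg)).
by rewrite addrC; congr (_ + _); exact: mulrC.
Qed.
Lemma isd_add f g (t df dg : R) : is_derive t 1 f df -> is_derive t 1 g dg ->
  is_derive t 1 (fun t => f t + g t) (df + dg).
Proof. by move=> Hf Hg; exact: is_deriveD. Qed.
Lemma isd_sub f g (t df dg : R) : is_derive t 1 f df -> is_derive t 1 g dg ->
  is_derive t 1 (fun t => f t - g t) (df - dg).
Proof. by move=> Hf Hg; exact: is_deriveB. Qed.
Lemma isd_inv f (t df : R) : f t != 0 -> is_derive t 1 f df ->
  is_derive t 1 (fun t => (f t)^-1) (- (df / f t ^+ 2)).
Proof.
move=> f0 [d <-]; apply: DeriveDef; first exact: derivableV.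
by rewrite deriveV// scaleNr; congr (- _); rewrite /GRing.scale/= mulrC.
Qed.
Lemma isd_sqrt f (t df : R) : 0 < f t -> is_derive t 1 f df ->
  is_derive t 1 (fun t => Num.sqrt (f t)) (df / (2 * Num.sqrt (f t))).
Proof.
move=> f0 Hf; have := @is_derive1_comp R _ f t _ _ (is_derive1_sqrt f0) Hf.
by rewrite mulrC.
Qed.
Lemma isd_scale (f : R -> R) (a : R -> 'rV[R]_m.+1) (t df : R) (da : 'rV[R]_m.+1) :
  is_derive t 1 f df -> is_derive t 1 a da ->
  is_derive t 1 (fun t => f t *: a t) (df *: a t + f t *: da).
Proof. exact: is_derive_zscale. Qed.

Variables (y1 y2 y11 y12 y22 : R -> 'rV[R]_m.+1).
Variables (v1 v2 v11 v12 v22 : 'rV[R]_m.+1).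
Hypothesis D1 : is_derive (0 : R) 1 y1 v1.
Hypothesis D2 : is_derive (0 : R) 1 y2 v2.
Hypothesis D11 : is_derive (0 : R) 1 y11 v11.
Hypothesis D12 : is_derive (0 : R) 1 y12 v12.
Hypothesis D22 : is_derive (0 : R) 1 y22 v22.
Hypothesis E0 : lor (y1 0) (y1 0) = 1.
Hypothesis F0 : lor (y1 0) (y2 0) = 0.
Hypothesis G0 : lor (y2 0) (y2 0) = 1.
Hypothesis trace0 : lor v1 (y1 0) + lor v2 (y2 0) = 0.

Let E t := lor (y1 t) (y1 t).
Let F t := lor (y1 t) (y2 t).
Let G t := lor (y2 t) (y2 t).
Let De t := E t * G t - F t ^+ 2.
Let dE := is_derive_lor D1 D1.
Let dF := is_derive_lor D1 D2.
Let dG := is_derive_lor D2 D2.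

Let De0 : De 0 = 1.
Proof. by rewrite /De /E /F /G E0 F0 G0; ring. Qed.

Let dDe : is_derive (0 : R) 1 De 0.
Proof.
have H := isd_sub (isd_mul dE dG) (isd_mul dF dF).
apply: (is_derive_eq H); rewrite E0 F0 G0 (lorC (y1 0) v1) (lorC (y2 0) v2).
by transitivity (2 * (lor v1 (y1 0) + lor v2 (y2 0))); [ring|rewrite trace0 mulr0].
Qed.

Let qd (a b : R -> 'rV[R]_m.+1) t := qform (y1 t) (y2 t) (a t) (b t).

Lemma isd_qform (a b : R -> 'rV[R]_m.+1) (da db : 'rV[R]_m.+1) :
  is_derive (0 : R) 1 a da -> is_derive (0 : R) 1 b db ->
  lor (a 0) (y1 0) = 0 -> lor (a 0) (y2 0) = 0 ->
  lor (b 0) (y1 0) = 0 -> lor (b 0) (y2 0) = 0 ->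
  is_derive (0 : R) 1 (qd a b) (lor da (b 0) + lor (a 0) db).
Proof.
move=> Da Db a1 a2 b1 b2.
have Dn : De 0 != 0 by rewrite De0 oner_eq0.
have H := isd_sub (is_derive_lor Da Db)
 (isd_mul (isd_add (isd_sub
     (isd_mul dG (isd_mul (is_derive_lor Da D1) (is_derive_lor Db D1)))
     (isd_mul dF (isd_add (isd_mul (is_derive_lor Da D1) (is_derive_lor Db D2))
                        (isd_mul (is_derive_lor Da D2) (is_derive_lor Db D1)))))
     (isd_mul dE (isd_mul (is_derive_lor Da D2) (is_derive_lor Db D2))))
   (isd_inv Dn dDe)).
by apply: (is_derive_eq H); rewrite a1 a2 b1 b2; ring.
Qed.

Hypothesis T11 : lor (y11 0) (y1 0) = 0 /\ lor (y11 0) (y2 0) = 0.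
Hypothesis T12 : lor (y12 0) (y1 0) = 0 /\ lor (y12 0) (y2 0) = 0.
Hypothesis T22 : lor (y22 0) (y1 0) = 0 /\ lor (y22 0) (y2 0) = 0.

Let L := y11 0 + y22 0.
Let P := y11 0 - y22 0.

(** At t = 0 the basis y1, y2 is orthonormal and all second derivatives are
   orthogonal to it, which makes most terms of the derivative vanish; trace0
   says that the area element is stationary. *)
Lemma isd_dens :
  is_derive (0 : R) 1 (fun t => dens (y1 t) (y2 t) (y11 t) (y12 t) (y22 t))
   (2^-1 * (lor (v11 + v22) L
      - 2 * lor v1 (y1 0) * lor P L
      - 4 * (lor v1 (y2 0) + lor v2 (y1 0)) / 2 * lor (y12 0) L)
    - (lor v11 (y22 0) + lor (y11 0) v22 - 2 * lor v12 (y12 0))).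
Proof.
have Dn : De 0 != 0 by rewrite De0 oner_eq0.
have Dp : 0 < De 0 by rewrite De0 ltr01.
have [t1 t2] := T11; have [t3 t4] := T12; have [t5 t6] := T22.
pose S t := G t *: y11 t - (2 * F t) *: y12 t + E t *: y22 t.
pose e := lor v1 (y1 0); pose f := lor v1 (y2 0) + lor v2 (y1 0).
pose sv := - (2 * e) *: y11 0 + v11 - (2 * f) *: y12 0 + (2 * e) *: y22 0 + v22.
have dS : is_derive (0 : R) 1 S sv.
  have H := is_deriveD (is_deriveB (isd_scale dG D11)
   (isd_scale (isd_mul (is_derive_cst (2 : R) (0 : R) 1) dF) D12)) (isd_scale dE D22).
  apply: (is_derive_eq H); rewrite E0 F0 G0 (lorC (y1 0) v1) (lorC (y2 0) v2) (lorC (y1 0) v2).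
  have g : lor v2 (y2 0) = - e by apply: (addrI e); rewrite subrr; exact: trace0.
  rewrite g -/e /sv /f /cst; apply/rowP => i; rewrite !mxE; ring.
have S0 : S 0 = L by rewrite /S /E /F /G E0 F0 G0 mulr0 scale0r subr0 !scale1r.
have S1 : lor (S 0) (y1 0) = 0 by rewrite S0 lorDl t1 t5 addr0.
have S2 : lor (S 0) (y2 0) = 0 by rewrite S0 lorDl t2 t6 addr0.
have qS := isd_qform dS dS S1 S2 S1 S2.
have q1 := isd_qform D11 D22 t1 t2 t5 t6.
have q2 := isd_qform D12 D12 t3 t4 t3 t4.
have d4 := isd_mul (is_derive_cst (4 : R) (0 : R) 1) dDe.
have d4n : cst (4 : R) (0 : R) * De 0 != 0 by rewrite De0 mulr1 /cst/= pnatr_eq0.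
have sn : Num.sqrt (De 0) != 0 by rewrite De0 sqrtr1 oner_eq0.
have H := isd_mul (isd_sub (isd_mul qS (@isd_inv (fun t => cst (4 : R) t * De t) 0 _ d4n d4)) (isd_sub q1 q2))
    (@isd_inv (fun t => Num.sqrt (De t)) 0 _ sn (@isd_sqrt De 0 _ Dp dDe)).
apply: (is_derive_eq H) => {H}.
have k4 : cst (4 : R) (0 : R) = 4 by [].
rewrite De0 sqrtr1 k4 S0 /sv /L /P !lorE -/e.
rewrite !(lorC _ (y11 0)) !(lorC _ (y22 0)) !(lorC _ (y12 0)) (lorC (y22 0) (y11 0)) -/f.
by field.
Qed.
End DensityDerivative.

Section FirstVariation.
Variables (R : realType) (n : nat).
Variables (O : set (R * R)) (Y nu A B : R * R -> 'rV[R]_n.+2).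
Hypothesis nl : null_lift O Y.
Hypothesis snu : smooth_on O nu.
Hypothesis sA : smooth_on O A.
Hypothesis sB : smooth_on O B.
Hypothesis pnu : forall p, O p -> perpV Y p (nu p).
Let oO := nl_open nl.
Let sY := nl_smooth nl.

(** A cubic family suffices for the lifts of the variations used below. *)
Definition famt (f g h k : R * R -> 'rV[R]_n.+2) (t : R) (q : R * R) : 'rV[R]_n.+2 :=
  f q + t *: g q + t ^+ 2 *: h q + t ^+ 3 *: k q.

Lemma dx_famt f g h k t q : smooth_on O f -> smooth_on O g -> smooth_on O h -> smooth_on O k ->
  O q -> dx (famt f g h k t) q = famt (dx f) (dx g) (dx h) (dx k) t q.
Proof.
move=> sf sg sh sk Oq.
have c (a : R) (g' : R * R -> 'rV[R]_n.+2) : smooth_on O g' -> smooth_on O (fun q => a *: g' q).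
  by move=> ?; exact: smooth_scale.
have t1 := smooth_add oO sf (c t _ sg); have t2 := smooth_add oO t1 (c (t ^+ 2) _ sh).
rewrite /famt (dx_add Oq t2 (c _ _ sk)) (dx_add Oq t1 (c _ _ sh)) (dx_add Oq sf (c _ _ sg)).
by rewrite !(dx_scale Oq).
Qed.
Lemma dy_famt f g h k t q : smooth_on O f -> smooth_on O g -> smooth_on O h -> smooth_on O k ->
  O q -> dy (famt f g h k t) q = famt (dy f) (dy g) (dy h) (dy k) t q.
Proof.
move=> sf sg sh sk Oq.
have c (a : R) (g' : R * R -> 'rV[R]_n.+2) : smooth_on O g' -> smooth_on O (fun q => a *: g' q).
  by move=> ?; exact: smooth_scale.
have t1 := smooth_add oO sf (c t _ sg); have t2 := smooth_add oO t1 (c (t ^+ 2) _ sh).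
rewrite /famt (dy_add Oq t2 (c _ _ sk)) (dy_add Oq t1 (c _ _ sh)) (dy_add Oq sf (c _ _ sg)).
by rewrite !(dy_scale Oq).
Qed.

Lemma smooth_famt f g h k t : smooth_on O f -> smooth_on O g -> smooth_on O h -> smooth_on O k ->
  smooth_on O (famt f g h k t).
Proof. by move=> sf sg sh sk; rewrite /famt; smooth_tac. Qed.

Lemma is_derive_famt f g h k q : is_derive (0 : R) 1 (fun t => famt f g h k t q) (g q).
Proof.
have d1 := @is_derive_id R R (0 : R) (1 : R).
have d2 := isd_mul d1 d1; have d3 := isd_mul d1 d2.
have c v := @is_derive_cst R R 'rV[R]_n.+2 v (0 : R) (1 : R).
have H := is_deriveD (is_deriveD (is_deriveD (c (f q)) (is_derive_zscale d1 (c (g q))))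
  (is_derive_zscale d2 (c (h q)))) (is_derive_zscale d3 (c (k q))).
apply: (is_derive_eq H).
by apply/rowP => j; rewrite /cst /= !mxE; ring.
Qed.

Lemma famt0 f g h k q : famt f g h k 0 q = f q.
Proof. by apply/rowP => j; rewrite /famt !mxE; ring. Qed.

Lemma smooth_joint f g h k (U : set (R * (R * R))) : open U -> (forall z, U z -> O z.2) ->
  smooth_on O f -> smooth_on O g -> smooth_on O h -> smooth_on O k ->
  smooth_on U (fun z : R * (R * R) => famt f g h k z.1 z.2).
Proof.
move=> oU UO sf sg sh sk.
have s1 : smooth_on U (fun z : R * (R * R) => z.1).
  by apply: (@smooth_linear_post _ _ _ _ fst) => //; [move=> ?; exact: cvg_fst|exact: smooth_id].
have c2 : continuous (snd : R * (R * R) -> R * R) by move=> ?; exact: cvg_snd.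
have s2 w : smooth_on O w -> smooth_on U (fun z : R * (R * R) => w z.2 : 'rV[R]_n.+2).
  by move=> sw; apply: smooth_sub (@smooth_linear_pre _ _ _ _ snd _ _ c2 oO sw) => z /UO.
have e1 := s2 _ sf; have e2 := s2 _ sg; have e3 := s2 _ sh; have e4 := s2 _ sk.
by rewrite /famt; smooth_tac.
Qed.

Let yt := famt Y nu A B.

(** densY with the derivatives in q computed, hence visibly smooth in (t, q). *)
Definition jetdens (t : R) (q : R * R) : R :=
  dens (famt (dx Y) (dx nu) (dx A) (dx B) t q) (famt (dy Y) (dy nu) (dy A) (dy B) t q)
    (famt (dx (dx Y)) (dx (dx nu)) (dx (dx A)) (dx (dx B)) t q)
    (famt (dy (dx Y)) (dy (dx nu)) (dy (dx A)) (dy (dx B)) t q)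
    (famt (dy (dy Y)) (dy (dy nu)) (dy (dy A)) (dy (dy B)) t q).

Lemma densY_jet t q : O q -> densY (famt Y nu A B t) q = jetdens t q.
Proof.
move=> Oq; rewrite /densY /jetdens.
have e1 q' : O q' -> dx (famt Y nu A B t) q' = famt (dx Y) (dx nu) (dx A) (dx B) t q'.
  by apply: dx_famt.
have e2 q' : O q' -> dy (famt Y nu A B t) q' = famt (dy Y) (dy nu) (dy A) (dy B) t q'.
  by apply: dy_famt.
rewrite (dx_on oO e1 Oq) (dy_on oO e1 Oq) (dy_on oO e2 Oq) (e1 q Oq) (e2 q Oq).
by rewrite (dx_famt _ _ _ _ _ Oq)//; try (by smooth_tac);
  rewrite !(dy_famt _ _ _ _ _ Oq)//; smooth_tac.
Qed.

(** The determinant of the first fundamental form; it vanishes where the member of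
   the family fails to be immersed. *)
Definition gramt (t : R) (q : R * R) : R :=
  lor (famt (dx Y) (dx nu) (dx A) (dx B) t q) (famt (dx Y) (dx nu) (dx A) (dx B) t q)
  * lor (famt (dy Y) (dy nu) (dy A) (dy B) t q) (famt (dy Y) (dy nu) (dy A) (dy B) t q)
  - lor (famt (dx Y) (dx nu) (dx A) (dx B) t q) (famt (dy Y) (dy nu) (dy A) (dy B) t q) ^+ 2.

Lemma smooth_gramt (U : set (R * (R * R))) : open U -> (forall z, U z -> O z.2) ->
  smooth_on U (fun z => gramt z.1 z.2).
Proof.
move=> oU UO.
have sdx (w : R * R -> 'rV[R]_n.+2) : smooth_on O w -> smooth_on O (dx w) by exact: smooth_dx.
have sdy (w : R * R -> 'rV[R]_n.+2) : smooth_on O w -> smooth_on O (dy w) by exact: smooth_dy.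
have j1 := smooth_joint oU UO (sdx _ sY) (sdx _ snu) (sdx _ sA) (sdx _ sB).
have j2 := smooth_joint oU UO (sdy _ sY) (sdy _ snu) (sdy _ sA) (sdy _ sB).
have l1 := smooth_lor oU j1 j1; have l2 := smooth_lor oU j2 j2; have l3 := smooth_lor oU j1 j2.
by apply: smooth_subr => //; [exact: smooth_mul|exact: smooth_exp].
Qed.

Lemma gramt0 q : O q -> gramt 0 q = 1.
Proof. by move=> Oq; rewrite /gramt !famt0 (nl_xx nl Oq) (nl_yy nl Oq) (nl_xy nl Oq); ring. Qed.

Lemma smooth_jetdens (U : set (R * (R * R))) : open U -> (forall z, U z -> O z.2) ->
  (forall z, U z -> 0 < gramt z.1 z.2) ->
  smooth_on U (fun z => jetdens z.1 z.2).
Proof.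
move=> oU UO g0.
have sdx (w : R * R -> 'rV[R]_n.+2) : smooth_on O w -> smooth_on O (dx w) by exact: smooth_dx.
have sdy (w : R * R -> 'rV[R]_n.+2) : smooth_on O w -> smooth_on O (dy w) by exact: smooth_dy.
have j1 := smooth_joint oU UO (sdx _ sY) (sdx _ snu) (sdx _ sA) (sdx _ sB).
have j2 := smooth_joint oU UO (sdy _ sY) (sdy _ snu) (sdy _ sA) (sdy _ sB).
have j11 := smooth_joint oU UO (sdx _ (sdx _ sY)) (sdx _ (sdx _ snu)) (sdx _ (sdx _ sA)) (sdx _ (sdx _ sB)).
have j12 := smooth_joint oU UO (sdy _ (sdx _ sY)) (sdy _ (sdx _ snu)) (sdy _ (sdx _ sA)) (sdy _ (sdx _ sB)).
have j22 := smooth_joint oU UO (sdy _ (sdy _ sY)) (sdy _ (sdy _ snu)) (sdy _ (sdy _ sA)) (sdy _ (sdy _ sB)).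
have sg := smooth_gramt oU UO.
have sgi : smooth_on U (fun z => (gramt z.1 z.2)^-1).
  by apply: smooth_inv => // z /g0 h; rewrite gt_eqF.
have sgi4 : smooth_on U (fun z => (4 * gramt z.1 z.2)^-1).
  apply: smooth_inv => //; last by apply: smooth_mul => //; exact: smooth_cst.
  by move=> z /g0 h; rewrite gt_eqF// mulr_gt0.
have sgs : smooth_on U (fun z => (Num.sqrt (gramt z.1 z.2))^-1).
  apply: smooth_inv => //; last exact: smooth_sqrt.
  by move=> z /g0 h; rewrite gt_eqF// sqrtr_gt0.
have sq (a b : R * (R * R) -> 'rV[R]_n.+2) : smooth_on U a -> smooth_on U b ->
    smooth_on U (fun z => qform (famt (dx Y) (dx nu) (dx A) (dx B) z.1 z.2)
       (famt (dy Y) (dy nu) (dy A) (dy B) z.1 z.2) (a z) (b z)).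
  move=> sa sb; rewrite /qform; apply: smooth_subr => //; first exact: smooth_lor.
  apply: smooth_mul => //.
  move: j1 j2; set f1 := (fun z : R * (R * R) => famt (dx Y) _ _ _ _ _).
  set f2 := (fun z : R * (R * R) => famt (dy Y) _ _ _ _ _) => j1 j2.
  have l11 := smooth_lor oU j1 j1; have l12 := smooth_lor oU j1 j2; have l22 := smooth_lor oU j2 j2.
  have a1 := smooth_lor oU sa j1; have a2 := smooth_lor oU sa j2.
  have b1 := smooth_lor oU sb j1; have b2 := smooth_lor oU sb j2.
  apply: smooth_add => //; last by apply: smooth_mul => //; exact: smooth_mul.
  apply: smooth_subr => //; first by apply: smooth_mul => //; exact: smooth_mul.
  by apply: smooth_mul => //; apply: smooth_add => //; exact: smooth_mul.
have sS : smooth_on U (fun z =>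
    lor (famt (dy Y) (dy nu) (dy A) (dy B) z.1 z.2) (famt (dy Y) (dy nu) (dy A) (dy B) z.1 z.2)
      *: famt (dx (dx Y)) (dx (dx nu)) (dx (dx A)) (dx (dx B)) z.1 z.2
    - (2 * lor (famt (dx Y) (dx nu) (dx A) (dx B) z.1 z.2) (famt (dy Y) (dy nu) (dy A) (dy B) z.1 z.2))
      *: famt (dy (dx Y)) (dy (dx nu)) (dy (dx A)) (dy (dx B)) z.1 z.2
    + lor (famt (dx Y) (dx nu) (dx A) (dx B) z.1 z.2) (famt (dx Y) (dx nu) (dx A) (dx B) z.1 z.2)
      *: famt (dy (dy Y)) (dy (dy nu)) (dy (dy A)) (dy (dy B)) z.1 z.2).
  apply: smooth_add => //; last by apply: smooth_zscale => //; exact: smooth_lor.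
  apply: smooth_subr => //; first by apply: smooth_zscale => //; exact: smooth_lor.
  apply: smooth_zscale => //; apply: smooth_mul => //; first exact: smooth_cst.
  exact: smooth_lor.
rewrite /jetdens /dens; apply: (smooth_mul oU) sgs.
apply: (smooth_subr oU); last by apply: smooth_subr => //; exact: sq.
by apply: (smooth_mul oU) sgi4; exact: sq.
Qed.

(** nu being normal, its derivative along the surface is minus the second
   fundamental form in the direction nu. *)
Lemma nu_lor p : O p ->
  [/\ lor (dx nu p) (dx Y p) = - lor (nu p) (dx (dx Y) p),
      lor (dy nu p) (dy Y p) = - lor (nu p) (dy (dy Y) p),
      lor (dx nu p) (dy Y p) = - lor (nu p) (dy (dx Y) p)
    & lor (dy nu p) (dx Y p) = - lor (nu p) (dy (dx Y) p)].
Proof.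
move=> Op; have s1 := smooth_dx sY; have s2 := smooth_dy sY.
have h1 q (Oq : O q) : lor (nu q) (dx Y q) = 0 by have [] := pnu Oq.
have h2 q (Oq : O q) : lor (nu q) (dy Y q) = 0 by have [] := pnu Oq.
have := dx_lor_cst nl snu s1 h1 Op; have := dy_lor_cst nl snu s1 h1 Op.
have := dx_lor_cst nl snu s2 h2 Op; have := dy_lor_cst nl snu s2 h2 Op.
by rewrite (nl_dyx nl Op) => ? ? ? ?; split; lra.
Qed.

(** The value at 0 of the derivative of the integrand along Y + t nu + O(t^2),
   before integration by parts. *)
Definition dvar p : R :=
  2^-1 * (lor (dx (dx nu) p + dy (dy nu) p) (LY Y p)
          + lor (nu p) (pY Y p *: PY Y p + qY Y p *: QY Y p))
  - (lor (dx (dx nu) p) (dy (dy Y) p) + lor (dx (dx Y) p) (dy (dy nu) p)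
     - 2 * lor (dy (dx nu) p) (dy (dx Y) p)).

Lemma jetdens_derive q : O q -> is_derive (0 : R) 1 (fun t => jetdens t q) (dvar q).
Proof.
move=> Oq; have [n1 n2 n3 n4] := nu_lor Oq.
have H := isd_dens (is_derive_famt (dx Y) (dx nu) (dx A) (dx B) q)
  (is_derive_famt (dy Y) (dy nu) (dy A) (dy B) q)
  (is_derive_famt (dx (dx Y)) (dx (dx nu)) (dx (dx A)) (dx (dx B)) q)
  (is_derive_famt (dy (dx Y)) (dy (dx nu)) (dy (dx A)) (dy (dx B)) q)
  (is_derive_famt (dy (dy Y)) (dy (dy nu)) (dy (dy A)) (dy (dy B)) q).
rewrite !famt0 in H.
have {}H := H (nl_xx nl Oq) (nl_xy nl Oq) (nl_yy nl Oq).
have tr : lor (dx nu q) (dx Y q) + lor (dy nu q) (dy Y q) = 0.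
  have [_ _ _ hL] := pnu Oq.
  by rewrite n1 n2; move: hL; rewrite LY.unlock lorDr; lra.
have {}H := H tr (conj (nl_xxx nl Oq) (nl_xxy nl Oq)) (conj (nl_xyx nl Oq) (nl_xyy nl Oq))
   (conj (nl_yyx nl Oq) (nl_yyy nl Oq)).
apply: (is_derive_eq H).
have -> : dx (dx Y) q + dy (dy Y) q = LY Y q by rewrite LY.unlock.
have -> : dx (dx Y) q - dy (dy Y) q = PY Y q by rewrite PY.unlock.
have [_ _ _ hL] := pnu Oq.
rewrite /dvar /pY /qY n1 n3 n4 !Yxx_LP !Yxy_Q !lorE !(lorC (PY Y q) (LY Y q)) !(lorC (QY Y q) (LY Y q)) hL.
by field.
Qed.

End FirstVariation.

(** * Integration by parts in the first variation *)
Section EulerLagrange.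
Variables (R : realType) (m : nat).
Variables (O : set (R * R)) (Y : R * R -> 'rV[R]_m.+1).
Hypothesis nl : null_lift O Y.
Let oO := nl_open nl.
Let sY := nl_smooth nl.

(** The Euler-Lagrange expression, modulo V. *)
Definition ELv p := dx (dx (LY Y)) p + dy (dy (LY Y)) p + pY Y p *: PY Y p + qY Y p *: QY Y p.

Lemma smooth_ELv : smooth_on O ELv.
Proof.
have sL := smooth_LY nl; have sP := smooth_PY nl; have sQ := smooth_QY nl.
have sp := smooth_pY nl; have sq := smooth_qY nl.
by rewrite /ELv; smooth_tac.
Qed.

Variables (a b c d : R).
Hypothesis ab : a < b.
Hypothesis cd : c < d.
Hypothesis BO : rect a b c d `<=` O.
Variable nu : R * R -> 'rV[R]_m.+1.
Hypothesis snu : smooth_on O nu.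
Hypothesis nu0 : forall p, O p -> p.1 = a \/ p.1 = b \/ p.2 = c \/ p.2 = d ->
  \near p, nu p = 0.

(** Two integrations by parts.  The fields g1, g2 move the Laplacian from nu to L,
   and h1, h2 show that the determinant-like terms form a divergence. *)
Lemma I2_dvar : I2 a b c d (fun p =>
  2^-1 * (lor (dx (dx nu) p + dy (dy nu) p) (LY Y p)
          + lor (nu p) (pY Y p *: PY Y p + qY Y p *: QY Y p))
  - (lor (dx (dx nu) p) (dy (dy Y) p) + lor (dx (dx Y) p) (dy (dy nu) p)
     - 2 * lor (dy (dx nu) p) (dy (dx Y) p)))
  = 2^-1 * I2 a b c d (fun p => lor (nu p) (ELv p)).
Proof.
have sL := smooth_LY nl; have sP := smooth_PY nl; have sQ := smooth_QY nl.
have sp := smooth_pY nl; have sq := smooth_qY nl; have sE := smooth_ELv.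
have n1 := smooth_dx snu; have n2 := smooth_dy snu.
have y1 := smooth_dx sY; have y2 := smooth_dy sY.
have L1 := smooth_dx sL; have L2 := smooth_dy sL.
have y11 := smooth_dx y1; have y12 := smooth_dy y1; have y22 := smooth_dy y2.
have sl (f g : R * R -> 'rV[R]_m.+1) : smooth_on O f -> smooth_on O g -> smooth_on O (fun p => lor (f p) (g p)).
  exact: smooth_lor.
pose g1 p := lor (dx nu p) (LY Y p) - lor (nu p) (dx (LY Y) p).
pose g2 p := lor (dy nu p) (LY Y p) - lor (nu p) (dy (LY Y) p).
pose h1 p := lor (dy nu p) (dy (dx Y) p) - lor (dx nu p) (dy (dy Y) p).
pose h2 p := lor (dx nu p) (dy (dx Y) p) - lor (dy nu p) (dx (dx Y) p).
have sg1 : smooth_on O g1 := smooth_subr oO (sl _ _ n1 sL) (sl _ _ snu L1).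
have sg2 : smooth_on O g2 := smooth_subr oO (sl _ _ n2 sL) (sl _ _ snu L2).
have sh1 : smooth_on O h1 := smooth_subr oO (sl _ _ n2 y12) (sl _ _ n1 y22).
have sh2 : smooth_on O h2 := smooth_subr oO (sl _ _ n1 y12) (sl _ _ n2 y11).
pose f1 p := 2^-1 * g1 p + h1 p; pose f2 p := 2^-1 * g2 p + h2 p.
have sc (k : R) (f : R * R -> R) : smooth_on O f -> smooth_on O (fun p => k * f p).
  by move=> sf; apply: smooth_mul => //; exact: smooth_cst.
have sf1 : smooth_on O f1 := smooth_add oO (sc _ _ sg1) sh1.
have sf2 : smooth_on O f2 := smooth_add oO (sc _ _ sg2) sh2.
have bd p : O p -> p.1 = a \/ p.1 = b \/ p.2 = c \/ p.2 = d ->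
   [/\ nu p = 0, dx nu p = 0 & dy nu p = 0].
  move=> Op pb; have nn := nu0 Op pb; split; first exact: nbhs_singleton nn.
    by rewrite (dx_near nn) dx_cst.
  by rewrite (dy_near nn) dy_cst.
have b1 v : c <= v <= d -> f1 (a, v) = 0 /\ f1 (b, v) = 0.
  move=> vcd; have aab : a <= a <= b by rewrite lexx ltW.
  have bab : a <= b <= b by rewrite lexx ltW.
  have Oa : O (a, v) by apply: BO; apply/rectP.
  have Ob : O (b, v) by apply: BO; apply/rectP.
  have [z1 z2 z3] := bd _ Oa (or_introl erefl).
  have [z4 z5 z6] := bd _ Ob (or_intror (or_introl erefl)).
  by rewrite /f1 /g1 /h1 z1 z2 z3 z4 z5 z6 !lor0l; split; ring.
have b2 u : a <= u <= b -> f2 (u, c) = 0 /\ f2 (u, d) = 0.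
  move=> uab; have ccd : c <= c <= d by rewrite lexx ltW.
  have dcd : c <= d <= d by rewrite lexx ltW.
  have Oa : O (u, c) by apply: BO; apply/rectP.
  have Ob : O (u, d) by apply: BO; apply/rectP.
  have [z1 z2 z3] := bd _ Oa (or_intror (or_intror (or_introl erefl))).
  have [z4 z5 z6] := bd _ Ob (or_intror (or_intror (or_intror erefl))).
  by rewrite /f2 /g2 /h2 z1 z2 z3 z4 z5 z6 !lor0l; split; ring.
have co (f : R * R -> R) : smooth_on O f -> forall p, O p -> {for p, continuous f}.
  by move=> sf p; exact: smooth_continuous.
have sEn := sl _ _ snu sE.
have sx := smooth_dx sf1; have sy := smooth_dy sf2.
transitivity (I2 a b c d (fun p => 2^-1 * lor (nu p) (ELv p) + (dx f1 p + dy f2 p))).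
  apply: I2_ext => p /BO Op.
  rewrite (dx_add Op (sc _ _ sg1) sh1) (dy_add Op (sc _ _ sg2) sh2).
  have kx (k : R) (f : R * R -> R) : smooth_on O f -> dx (fun p => k * f p) p = k * dx f p.
    by move=> sf; rewrite (dx_mul Op (@smooth_cst R _ _ O (k : R)) sf) dx_cst mul0r add0r.
  have ky (k : R) (f : R * R -> R) : smooth_on O f -> dy (fun p => k * f p) p = k * dy f p.
    by move=> sf; rewrite (dy_mul Op (@smooth_cst R _ _ O (k : R)) sf) dy_cst mul0r add0r.
  rewrite (kx _ _ sg1) (ky _ _ sg2).
  rewrite (dx_sub Op (sl _ _ n1 sL) (sl _ _ snu L1)) (dy_sub Op (sl _ _ n2 sL) (sl _ _ snu L2)).
  rewrite (dx_sub Op (sl _ _ n2 y12) (sl _ _ n1 y22)) (dy_sub Op (sl _ _ n1 y12) (sl _ _ n2 y11)).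
  rewrite (dx_lor Op n1 sL) (dx_lor Op snu L1) (dx_lor Op n2 y12) (dx_lor Op n1 y22).
  rewrite (dy_lor Op n2 sL) (dy_lor Op snu L2) (dy_lor Op n1 y12) (dy_lor Op n2 y11).
  have e1 : dx (dy nu) p = dy (dx nu) p by rewrite (schwarz oO snu Op).
  have e2 : dx (dy (dx Y)) p = dy (dx (dx Y)) p by rewrite (schwarz oO y1 Op).
  have e3 : dx (dy (dy Y)) p = dy (dy (dx Y)) p.
    rewrite -(schwarz oO y2 Op); apply: (dy_on oO _ Op) => q Oq.
    by rewrite (nl_dyx nl).
  rewrite e1 e2 e3 /ELv !lorE (lorC (dx (dx Y) p)).
  by field.
have c1 := co _ (sc 2^-1 _ sEn); have c2 := co _ (smooth_add oO sx sy).
rewrite (I2_add ab cd oO BO c1 c2) (I2_add ab cd oO BO (co _ sx) (co _ sy)).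
rewrite (I2_dx0 ab cd oO BO sf1 b1) (I2_dy0 ab cd oO BO sf2 b2) !addr0.
by rewrite (I2_scale ab cd oO BO _ (co _ sEn)).
Qed.

End EulerLagrange.

(** * Variations supported in a chart *)
Local Notation coord := Defs.coord.

Section Charts.
Variables (R : realType) (M : topologicalType) (RS : riemann_surface R M).

Lemma chart_imgP (c : chart R M) q : chart_img c q ->
  chart_dom c (param c q) /\ coord c (param c q) = q.
Proof. by move=> [m mc <-]; rewrite coordK ?inE. Qed.

Lemma chart_img_coord (c : chart R M) m : chart_dom c m -> chart_img c (coord c m).
Proof. by move=> mc; exists m. Qed.

Lemma open_chart_preimage (c : chart R M) (W : set M) : open W ->
  open (chart_img c `&` (param c @^-1` W)).
Proof.
move=> oW; rewrite openE => q [cq Wq]; rewrite /interior.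
have := param_continuous (c := c) cq => /(_ W (open_nbhs_nbhs (conj oW Wq))) h.
have g := open_nbhs_nbhs (conj (@open_chart_img _ _ c) cq).
exact: (filterI g h).
Qed.

Definition overlap (c c' : chart R M) : set (R * R) :=
  chart_img c `&` (param c @^-1` chart_dom c').
Definition trans (c c' : chart R M) : R * R -> R * R := coord c' \o param c.

Lemma overlapE c c' : coord c @` (chart_dom c `&` chart_dom c') = overlap c c'.
Proof.
apply/seteqP; split => [q [m [mc mc'] <-]|q [cq c'q]].
  by split; [exact: chart_img_coord|rewrite /= coordK ?inE].
by have [dq E] := chart_imgP cq; exists (param c q).
Qed.

Lemma open_overlap c c' : open (overlap c c').
Proof. by apply: open_chart_preimage; exact: open_chart_dom. Qed.

Lemma smooth_trans c c' : atlas RS c -> atlas RS c' -> smooth_on (overlap c c') (trans c c').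
Proof. by move=> ac ac'; have [] := atlas_holomorphic ac ac'; rewrite overlapE. Qed.

Lemma trans_CR c c' q : atlas RS c -> atlas RS c' -> overlap c c' q ->
  dy (trans c c') q = (- (dx (trans c c') q).2, (dx (trans c c') q).1).
Proof.
move=> ac ac' oq; have [_] := atlas_holomorphic ac ac'; rewrite overlapE => /(_ q oq).
by rewrite dx.unlock dy.unlock.
Qed.

Lemma trans_img c c' q : overlap c c' q -> chart_img c' (trans c c' q).
Proof. by move=> [_ h]; exact: chart_img_coord. Qed.

Lemma param_trans c c' q : overlap c c' q -> param c' (trans c c' q) = param c q.
Proof. by move=> [_ h]; rewrite /trans /= coordK ?inE. Qed.

End Charts.

Section Rank.
Variables (R : realType) (n : nat).

Lemma row_free_col (u v : 'rV[R]_n.+1) :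
  (forall al be : R, al *: u + be *: v = 0 -> al = 0 /\ be = 0) -> row_free (col_mx u v).
Proof.
move=> H; rewrite -kermx_eq0; apply/rowV0P => w /sub_kermxP.
rewrite -(hsubmxK w) mul_row_col.
have e (k : 'M[R]_1) (z : 'rV[R]_n.+1) : k *m z = k 0 0 *: z.
  by rewrite {1}[k]mx11_scalar mul_scalar_mx.
rewrite !e => /H[a b].
have -> : lsubmx w = 0 by apply/matrixP => i j; rewrite !ord1 a mxE.
have -> : rsubmx w = 0 by apply/matrixP => i j; rewrite !ord1 b mxE.
exact: row_mx0.
Qed.

Lemma conformal_indep (u v : 'rV[R]_n.+1) : 0 < dot u u -> dot u u = dot v v -> dot u v = 0 ->
  forall al be : R, al *: u + be *: v = 0 -> al = 0 /\ be = 0.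
Proof.
move=> u0 uv uv0 al be E.
have e1 : dot (al *: u + be *: v) u = al * dot u u by rewrite !dotE (dotC v u) uv0; ring.
have e2 : dot (al *: u + be *: v) v = be * dot u u by rewrite !dotE uv0 -uv; ring.
have z w : dot (0 : 'rV[R]_n.+1) w = 0 by rewrite -(scale0r 0) dotZl mul0r.
move: e1 e2; rewrite E !z => /esym/eqP; rewrite mulf_eq0 (gt_eqF u0) orbF => /eqP-> /esym/eqP.
by rewrite mulf_eq0 (gt_eqF u0) orbF => /eqP->.
Qed.

(** If al G_x + be G_y = 0, the same combination of y_x and y_y is a multiple of the
   null vector y, to which both are orthogonal; this contradicts the
   nondegeneracy of the first fundamental form of y. *)
Lemma lift_indep (O : set (R * R)) (y : R * R -> 'rV[R]_n.+2) (rho : R * R -> R)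
    (G : R * R -> 'rV[R]_n.+1) q :
  open O -> smooth_on O rho -> smooth_on O G -> (forall p, O p -> on_sphere (G p)) ->
  (forall p, O p -> y p = rho p *: hat (G p)) -> O q ->
  lor (dx y q) (dx y q) * lor (dy y q) (dy y q) - lor (dx y q) (dy y q) ^+ 2 != 0 ->
  forall al be : R, al *: dx G q + be *: dy G q = 0 -> al = 0 /\ be = 0.
Proof.
move=> oO sr sG oG yE Oq De al be E.
have sh := smooth_hat oO sG.
have y1 : dx y q = dx rho q *: hat (G q) + rho q *: hat0 (dx G q).
  rewrite (dx_on oO yE Oq) (dx_zscale Oq sr sh).
  by rewrite (dx_eq (is_derive_hat (is_dx sG Oq))).
have y2 : dy y q = dy rho q *: hat (G q) + rho q *: hat0 (dy G q).
  rewrite (dy_on oO yE Oq) (dy_zscale Oq sr sh).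
  by rewrite (dy_eq (is_derive_hat (is_dy sG Oq))).
have g1 : dot (G q) (dx G q) = 0.
  have : dx (fun q => dot (G q) (G q)) q = 0 by rewrite (dx_on oO oG Oq) dx_cst.
  rewrite (dx_eq (is_derive_dot (is_dx sG Oq) (is_dx sG Oq))) (dotC (dx G q)); lra.
have g2 : dot (G q) (dy G q) = 0.
  have : dy (fun q => dot (G q) (G q)) q = 0 by rewrite (dy_on oO oG Oq) dy_cst.
  rewrite (dy_eq (is_derive_dot (is_dy sG Oq) (is_dy sG Oq))) (dotC (dy G q)); lra.
have hh : lor (hat (G q)) (hat (G q)) = 0 by rewrite lor_hat (oG q Oq) addNr.
have h1 : lor (hat (G q)) (dx y q) = 0 by rewrite y1 !lorE hh lor_hat0 g1; ring.
have h2 : lor (hat (G q)) (dy y q) = 0 by rewrite y2 !lorE hh lor_hat0 g2; ring.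
have h0D (v w : 'rV[R]_n.+1) : hat0 (al *: v + be *: w) = al *: hat0 v + be *: hat0 w.
  have mxD k (x z : 'rV[R]_k) j : (al *: x + be *: z) 0 j = al * x 0 j + be * z 0 j.
    by rewrite !mxE.
  apply/rowP; apply: ord_lrP => [|i]; first by rewrite mxD !hat0_0; ring.
  by rewrite mxD !hat0_S mxD.
have z0 : hat0 (0 : 'rV[R]_n.+1) = 0.
  by apply/rowP; apply: ord_lrP => [|i]; rewrite ?(hat0_0, hat0_S) !mxE.
have comb : al *: dx y q + be *: dy y q = (al * dx rho q + be * dy rho q) *: hat (G q).
  have hz : al *: hat0 (dx G q) + be *: hat0 (dy G q) = 0 by rewrite -h0D E z0.
  rewrite y1 y2; transitivity ((al * dx rho q + be * dy rho q) *: hat (G q)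
      + rho q *: (al *: hat0 (dx G q) + be *: hat0 (dy G q))).
    by apply/rowP => i; rewrite !mxE; ring.
  by rewrite hz scaler0 addr0.
have k1 : al * lor (dx y q) (dx y q) + be * lor (dx y q) (dy y q) = 0.
  by rewrite (lorC _ (dy y q)) -!lorZl -lorDl comb lorZl h1 mulr0.
have k2 : al * lor (dx y q) (dy y q) + be * lor (dy y q) (dy y q) = 0.
  by rewrite -!lorZl -lorDl comb lorZl h2 mulr0.
move: De k1 k2; move: (lor _ _) (lor _ _) (lor _ _) => a b c De k1 k2.
split; apply: (mulfI De); rewrite mulr0.
  transitivity (b * (al * c + be * a) - a * (al * a + be * b)); last by rewrite k1 k2; ring.
  by ring.
transitivity (c * (al * a + be * b) - a * (al * c + be * a)); last by rewrite k1 k2; ring.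
by ring.
Qed.

End Rank.

Section SphereVariation.
Variables (R : realType) (n : nat).

(** The last n+1 coordinates of a vector of the Lorentzian space. *)
Definition spat (w : 'rV[R]_n.+2) : 'rV[R]_n.+1 := \row_j w 0 (lift ord0 j).

(** Moving a point v of the sphere in the tangent direction e; this is a rational
    parametrisation of a great circle when e is a unit vector. *)
Definition move (v e : 'rV[R]_n.+1) (t : R) : 'rV[R]_n.+1 :=
  (1 + t ^+ 2 * (dot e e / 4))^-1 *: ((1 - t ^+ 2 * (dot e e / 4)) *: v + t *: e).

Lemma move_den_gt0 (e : 'rV[R]_n.+1) t : 0 < 1 + t ^+ 2 * (dot e e / 4).
Proof.
have : 0 <= t ^+ 2 * (dot e e / 4) by rewrite mulr_ge0 ?sqr_ge0// divr_ge0// dot_ge0.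
lra.
Qed.

Lemma move_sphere v e t : dot v v = 1 -> dot v e = 0 -> dot (move v e t) (move v e t) = 1.
Proof.
move=> v1 ve; have := move_den_gt0 e t; rewrite /move !dotE v1 (dotC e v) ve.
move: (dot e e) => k d0.
have dn : 1 + t ^+ 2 * (k / 4) != 0 by rewrite gt_eqF.
by field; rewrite (_ : 4 + t ^+ 2 * k = 4 * (1 + t ^+ 2 * (k / 4))) ?mulf_neq0 ?pnatr_eq0//; field.
Qed.

Lemma move_e0 v t : move v 0 t = v.
Proof.
have d0 : dot (0 : 'rV[R]_n.+1) 0 = 0 by rewrite -(scale0r 0) dotZl mul0r.
by rewrite /move d0 mul0r mulr0 addr0 subr0 invr1 scaler0 addr0 !scale1r.
Qed.

Lemma move_t0 v e : move v e 0 = v.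
Proof. by rewrite /move expr0n /= mul0r addr0 subr0 invr1 scale0r addr0 !scale1r. Qed.

Lemma smooth_move (V : normedModType R) (U : set V) (v e : V -> 'rV[R]_n.+1) (t : V -> R) :
  open U -> smooth_on U v -> smooth_on U e -> smooth_on U t ->
  smooth_on U (fun z => move (v z) (e z) (t z)).
Proof.
move=> oU sv se st.
have sd : smooth_on U (fun z => t z ^+ 2 * (dot (e z) (e z) / 4)).
  apply: smooth_mul => //; first exact: smooth_exp.
  by apply: smooth_mul => //; [exact: smooth_dot|exact: smooth_cst].
apply: smooth_zscale => //.
  apply: smooth_inv => //; first by move=> z _; rewrite gt_eqF// move_den_gt0.
  by apply: smooth_add => //; exact: smooth_cst.
apply: smooth_add => //; last exact: smooth_zscale.
by apply: smooth_zscale => //; apply: smooth_subr => //; exact: smooth_cst.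
Qed.

Variables (O : set (R * R)) (X : R * R -> 'rV[R]_n.+1) (Y nu : R * R -> 'rV[R]_n.+2).
Hypothesis oO : open O.
Hypothesis sY : smooth_on O Y.
Hypothesis sX : smooth_on O X.
Hypothesis snu : smooth_on O nu.
Hypothesis oX : forall p, O p -> on_sphere (X p).
Hypothesis YX : forall p, O p -> exists r : R, 0 < r /\ Y p = r *: hat (X p).
Hypothesis nuY : forall p, O p -> lor (nu p) (Y p) = 0.

(** With Y = lam (1, X), a normal field nu is written as shear Y + lam (0, etac):
   moving X in the direction etac realizes the variation nu of Y. *)
Definition lam (p : R * R) := Y p 0 ord0.
Definition shear p := nu p 0 ord0 / lam p.
Definition etac p : 'rV[R]_n.+1 := (lam p)^-1 *: (spat (nu p) - nu p 0 ord0 *: X p).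
(** The coefficients of t^2 and t^3 in the rescaled lift are Av and Bv. *)
Definition Cv p : 'rV[R]_n.+2 := (dot (etac p) (etac p) / 4) *: ((2 * lam p) *: hat 0 - Y p).
Definition Av p : 'rV[R]_n.+2 := shear p *: nu p - (shear p ^+ 2) *: Y p + Cv p.
Definition Bv p : 'rV[R]_n.+2 := shear p *: Cv p.

Lemma lam_gt0 p : O p -> 0 < lam p.
Proof. by move=> /YX[r [r0 E]]; rewrite /lam E mxE hat_0 mulr1. Qed.

Lemma Y_lam p : O p -> Y p = lam p *: hat (X p).
Proof. by move=> /YX[r [r0 E]]; rewrite /lam E mxE hat_0 mulr1. Qed.

Lemma hat0_etac p : O p -> lam p *: hat0 (etac p) = nu p - shear p *: Y p.
Proof.
move=> Op; have ln : lam p != 0 by rewrite gt_eqF// lam_gt0.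
have mxD (x z : 'rV[R]_n.+2) (k : R) j : (x - k *: z) 0 j = x 0 j - k * z 0 j by rewrite !mxE.
have mxZ k' (z : 'rV[R]_k') (k : R) j : (k *: z) 0 j = k * z 0 j by rewrite !mxE.
apply/rowP; apply: ord_lrP => [|i]; rewrite mxD mxZ.
  by rewrite hat0_0 mulr0 /shear -/(lam p) divfK// subrr.
rewrite hat0_S (Y_lam Op) /etac mxZ mulrA mulfV// mul1r [(lam p *: hat (X p)) 0 _]mxZ hat_S.
by rewrite mulrA /shear divfK// !mxE.
Qed.

Lemma dot_X_etac p : O p -> dot (X p) (etac p) = 0.
Proof.
move=> Op; have lp := lam_gt0 Op.
have : lor (Y p) (lam p *: hat0 (etac p)) = 0.
  rewrite hat0_etac// lorDr lorNr lorZr (lorC (Y p) (nu p)) nuY//.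
  by rewrite (Y_lam Op) !lorE lor_hat (oX Op) addNr !mulr0 oppr0 addr0.
rewrite {1}(Y_lam Op) !lorE lor_hat0 => /eqP; rewrite !mulf_eq0 (gt_eqF lp)/=.
by move/eqP.
Qed.

Lemma smooth_lam : smooth_on O lam.
Proof. exact: (smooth_rowP _ oO).1 sY ord0. Qed.
Lemma smooth_shear : smooth_on O shear.
Proof.
apply: smooth_mul => //; first exact: (smooth_rowP _ oO).1 snu ord0.
by apply: smooth_inv => //; [move=> p /lam_gt0 h; rewrite gt_eqF|exact: smooth_lam].
Qed.
Lemma smooth_etac : smooth_on O etac.
Proof.
apply: smooth_zscale => //.
  by apply: smooth_inv => //; [move=> p /lam_gt0 h; rewrite gt_eqF|exact: smooth_lam].
apply: smooth_subr => //.
  apply/smooth_rowP => // j; under eq_fun do rewrite mxE.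
  exact: (smooth_rowP _ oO).1 snu (lift ord0 j).
by apply: smooth_zscale => //; exact: (smooth_rowP _ oO).1 snu ord0.
Qed.
Lemma smooth_Cv : smooth_on O Cv.
Proof.
have se := smooth_etac; have sl := smooth_lam.
apply: smooth_zscale => //; first by apply: smooth_mul => //; [exact: smooth_dot|exact: smooth_cst].
apply: smooth_subr => //; apply: smooth_zscale => //; last exact: smooth_cst.
by apply: smooth_mul => //; exact: smooth_cst.
Qed.
Lemma smooth_Av : smooth_on O Av.
Proof.
have ss := smooth_shear; have sC := smooth_Cv.
apply: smooth_add => //; apply: smooth_subr => //; apply: smooth_zscale => //.
exact: smooth_exp.
Qed.
Lemma smooth_Bv : smooth_on O Bv.
Proof. by apply: smooth_zscale => //; [exact: smooth_shear|exact: smooth_Cv]. Qed.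

Definition scal t p := (1 + t * shear p) * (lam p * (1 + t ^+ 2 * (dot (etac p) (etac p) / 4))).

Lemma smooth_scal t : smooth_on O (scal t).
Proof.
have se := smooth_etac; have sl := smooth_lam; have ss := smooth_shear.
have c (k : R) : smooth_on O (fun=> k) by exact: smooth_cst.
rewrite /scal; apply: smooth_mul => //.
  by apply: smooth_add => //; exact: smooth_mul.
apply: smooth_mul => //; apply: smooth_add => //; apply: smooth_mul => //.
by apply: smooth_mul => //; exact: smooth_dot.
Qed.

(** The null cone being invariant under scaling, the lift of the moved surface may
   be rescaled so that it becomes a polynomial in t with linear part nu. *)
Lemma famt_move t p : O p ->
  famt Y nu Av Bv t p = scal t p *: hat (move (X p) (etac p) t).
Proof.
move=> Op; have dn := move_den_gt0 (etac p) t.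
have mxZ k' (z : 'rV[R]_k') (k : R) j : (k *: z) 0 j = k * z 0 j by rewrite !mxE.
have mxD k' (x z : 'rV[R]_k') j : (x + z) 0 j = x 0 j + z 0 j by rewrite !mxE.
have mxN k' (z : 'rV[R]_k') j : (- z) 0 j = - z 0 j by rewrite !mxE.
have E1 : nu p = shear p *: Y p + lam p *: hat0 (etac p).
  by rewrite (hat0_etac Op) addrC subrK.
rewrite /famt /Av /Bv /Cv /scal.
move: (etac p) E1 dn => e E1 dn; set s := dot e e / 4 in dn *.
have m0 i : (0 : 'rV[R]_n.+1) 0 i = 0 by rewrite mxE.
rewrite E1 (Y_lam Op).
apply/rowP; apply: ord_lrP => [|i].
  by rewrite !(mxD, mxZ, mxN) !hat_0 hat0_0; ring.
rewrite !(mxD, mxZ, mxN) !hat_S hat0_S m0 /move -/s !(mxZ, mxD).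
by field; rewrite gt_eqF.
Qed.

End SphereVariation.

Section Tube.
Variable R : realType.

(** The tube lemma for a compact B. *)
Lemma tube (B : set (R * R)) (W : set (R * (R * R))) : compact B ->
  open W -> (forall q, B q -> W (0, q)) ->
  exists2 eps : R, 0 < eps & forall t q, `|t| < eps -> B q -> W (t, q).
Proof.
move=> /compact_near_coveringP cB oW WB.
have := cB R (nbhs (0 : R)) (fun t q => W (t, q)) _.
have H q : B q -> \forall x' \near q & i \near (0 : R), W (i, x').
  move=> Bq; have := open_nbhs_nbhs (conj oW (WB q Bq)).
  move=> [[U V] [/= U0 Vq] UV]; exists (V, U) => // -[x i] [/= Vx Ui].
  exact: (UV (i, x)).
move=> /(_ _ H) /nbhs_ballP[e e0 He]; exists e => // t q te Bq.
by apply: He => //; rewrite /ball/= sub0r normrN.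
Qed.

Definition sq (q0 : R * R) (r : R) : set (R * R) :=
  [set q | `|q.1 - q0.1| < r /\ `|q.2 - q0.2| < r].

Lemma open_sq q0 r : open (sq q0 r).
Proof.
rewrite openE => q [h1 h2]; apply/nbhs_squareP.
exists (Num.min (r - `|q.1 - q0.1|) (r - `|q.2 - q0.2|)).
  by rewrite lt_min !subr_gt0 h1.
move=> p; rewrite !lt_min => /andP[p1 _] /andP[_ p2]; split.
  by rewrite -(subrK q.1 p.1) -addrA (le_lt_trans (ler_normD _ _))//; lra.
by rewrite -(subrK q.2 p.2) -addrA (le_lt_trans (ler_normD _ _))//; lra.
Qed.

Definition csq (q0 : R * R) (r : R) : set (R * R) :=
  rect (q0.1 - r) (q0.1 + r) (q0.2 - r) (q0.2 + r).

Lemma csqP q0 r q : csq q0 r q <-> `|q.1 - q0.1| <= r /\ `|q.2 - q0.2| <= r.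
Proof.
rewrite /csq rectP !ler_norml; split=> -[/andP[a b] /andP[c d]];
  by split; apply/andP; split; lra.
Qed.

Lemma csq_sub_sq q0 r s : r < s -> csq q0 r `<=` sq q0 s.
Proof. by move=> rs q /csqP[h1 h2]; split; apply: le_lt_trans rs. Qed.

Lemma sq_sub_csq q0 r : sq q0 r `<=` csq q0 r.
Proof. by move=> q [h1 h2]; apply/csqP; split; apply: ltW. Qed.

End Tube.

Lemma du_dx (R : realType) (W : normedModType R) (f : R * R -> W) p : du f p = dx f p.
Proof. by rewrite dx.unlock. Qed.
Lemma dv_dy (R : realType) (W : normedModType R) (f : R * R -> W) p : dv f p = dy f p.
Proof. by rewrite dy.unlock. Qed.

Lemma open_slab (R : realType) (eps : R) (V : set (R * R)) : open V ->
  open [set z : R * (R * R) | `|z.1| < eps /\ V z.2].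
Proof.
move=> oV; have o1 : open ((fun z : R * (R * R) => `|z.1|) @^-1` [set y | y < eps]).
  apply: open_comp (@open_lt _ eps) => z _.
  by apply: continuous_comp; [exact: cvg_fst|exact: norm_continuous].
have o2 : open ((snd : R * (R * R) -> R * R) @^-1` V).
  by apply: open_comp oV => z _; exact: cvg_snd.
exact: openI o1 o2.
Qed.

(** * The Willmore equation *)
Section WillmoreEquation.
Variables (R : realType) (n : nat) (M : topologicalType) (RS : riemann_surface R M).
Variable x : M -> 'rV[R]_n.+1.
Hypothesis hx : conformal_immersion RS x.
Variable c0 : chart R M.
Hypothesis ac0 : atlas RS c0.
Let O := chart_img c0.
Let X := x \o param c0.
Variable Y : R * R -> 'rV[R]_n.+2.
Hypothesis cl : canonical_lift O X Y.

Let oO : open O. Proof. exact: open_chart_img. Qed.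
Let sphere_x p : dot (x p) (x p) = 1. Proof. by have [h _] := hx; exact: h. Qed.
Let oX p : O p -> on_sphere (X p). Proof. by move=> _; exact: sphere_x. Qed.
Let nl : null_lift O Y. Proof. exact: canonical_null_lift oO oX cl. Qed.
Let sY := nl_smooth nl.
Let sX : smooth_on O X. Proof. by have [_ /(_ c0 ac0)[]] := hx. Qed.
Let YX p : O p -> exists r : R, 0 < r /\ Y p = r *: hat (X p).
Proof. by move=> Op; have [_ /(_ p Op)[]] := cl. Qed.

Lemma lor_projn p w v : O p -> perpV Y p v -> lor v (projn Y p w) = lor v w.
Proof. by move=> Op [v0 v1 v2 v3]; rewrite /projn !lorE v0 v1 v2 v3; ring. Qed.

Variables (q0 : R * R) (r : R).
Hypothesis r0 : 0 < r.
Hypothesis sub3 : csq q0 (3 * r) `<=` O.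

(* The bump lives on the square of half side r, the support K of the variation has
   half side 2 r, and uniform estimates hold on the square of half side 3 r. *)
Let Ep q := projn Y q (ELv Y q).
Let nu q := sqbump q0 r q *: Ep q.
Let Bc := csq q0 (2 * r).
Let BO : Bc `<=` O.
Proof.
move=> q /csqP[h1 h2]; apply: sub3; apply/csqP.
by split; [apply: le_trans h1 _|apply: le_trans h2 _]; have := r0; lra.
Qed.
Let K : set M := param c0 @` Bc.

Let smooth_bumpO : smooth_on O (sqbump q0 r).
Proof. by apply: smooth_sub (smooth_sqbump q0 r) => q. Qed.
Let sE : smooth_on O Ep. Proof. exact: (smooth_projn nl (smooth_ELv nl)). Qed.
Let snu : smooth_on O nu. Proof. exact: smooth_zscale. Qed.
Let pE q : O q -> perpV Y q (Ep q). Proof. by move=> Oq; exact: (perp_projn nl _ Oq). Qed.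
Let pnu q : O q -> perpV Y q (nu q).
Proof. by move=> /pE[h1 h2 h3 h4]; split; rewrite lorZl ?h1 ?h2 ?h3 ?h4 mulr0. Qed.
Let nuY q : O q -> lor (nu q) (Y q) = 0. Proof. by move=> /pnu[]. Qed.

Let nu_out q : ~ sq q0 r q -> nu q = 0.
Proof. by move=> h; rewrite /nu sqbump_eq0// scale0r. Qed.

Let eta_ := etac X Y nu.
Let sh := shear Y nu.

Let eta_out q : ~ sq q0 r q -> eta_ q = 0.
Proof.
move=> h; rewrite /eta_ /etac nu_out// mxE scale0r subr0.
have -> : spat (0 : 'rV[R]_n.+2) = 0 by apply/rowP => j; rewrite !mxE.
exact: scaler0.
Qed.
Let sh_out q : ~ sq q0 r q -> sh q = 0.
Proof. by move=> h; rewrite /sh /shear nu_out// mxE mul0r. Qed.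

(** Extended by 0 outside the chart; smooth since it vanishes off the compact K. *)
Let eta (p : M) : 'rV[R]_n.+1 := if `[< chart_dom c0 p >] then eta_ (coord c0 p) else 0.

Let eta_in p : chart_dom c0 p -> eta p = eta_ (coord c0 p).
Proof. by move=> h; rewrite /eta asboolT. Qed.

Let eta_notK p : ~ K p -> eta p = 0.
Proof.
move=> nK; rewrite /eta; case: asboolP => // pc; apply: eta_out => -[h1 h2]; apply: nK.
exists (coord c0 p); last by rewrite coordK ?inE.
by apply/csqP; split; [move: h1|move: h2] => /ltW h; apply: le_trans h _; have := r0; lra.
Qed.

Let dot_x_eta p : dot (x p) (eta p) = 0.
Proof.
rewrite /eta; case: asboolP => pc; last by rewrite -(scale0r 0) dotZr mul0r.
have := dot_X_etac oX YX nuY (chart_img_coord pc).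
by rewrite /X /= coordK ?inE.
Qed.

Let cK : compact K.
Proof.
apply: continuous_compact; last exact: rect_compact.
apply: continuous_in_subspaceT => q; rewrite inE => /BO Oq.
exact: param_continuous.
Qed.

Let closedK : closed K.
Proof. by apply: compact_closed cK; exact: surface_hausdorff RS. Qed.

Let smooth_eta c : atlas RS c -> smooth_on (chart_img c) (eta \o param c).
Proof.
move=> ac; apply: smooth_local => q cq.
have [pc0|npc0] := pselect (chart_dom c0 (param c q)).
  exists (overlap c c0); split; [exact: open_overlap|by split|].
  apply: (@smooth_ext _ _ _ _ (fun q => eta_ (trans c c0 q))).
  - exact: open_overlap.
  - by move=> q' [_ h]; rewrite /= eta_in.
  apply: (@smooth_comp_row _ _ _ _ O) => //.
  - exact: open_overlap.
  - by move=> q1 h1; exact: (trans_img h1).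
  - exact: (smooth_etac oO sY sX snu YX).
  - exact: (smooth_trans ac ac0).
exists (chart_img c `&` (param c @^-1` (~` K))); split.
- by apply: open_chart_preimage; exact: closed_openC.
- by split => // -[q' /BO /chart_imgP[h _] E]; apply: npc0; rewrite -E.
apply: (@smooth_ext _ _ _ _ (fun=> 0)).
- by apply: open_chart_preimage; exact: closed_openC.
- by move=> q' [_ h]; rewrite /= eta_notK.
exact: smooth_cst.
Qed.

Let F (t : R) (p : M) : 'rV[R]_n.+1 := move (x p) (eta p) t.

Let F_chart t q : O q -> F t (param c0 q) = move (X q) (eta_ q) t.
Proof. by move=> /chart_imgP[h E]; rewrite /F eta_in// E. Qed.

Let At := Av X Y nu.
Let Bt := Bv X Y nu.
Let sA : smooth_on O At. Proof. exact: (smooth_Av oO sY sX snu YX). Qed.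
Let sB : smooth_on O Bt. Proof. exact: (smooth_Bv oO sY sX snu YX). Qed.
Let yt := famt Y nu At Bt.
Let gr := gramt Y nu At Bt.

Let y_move t q : O q -> yt t q = scal X Y nu t q *: hat (F t (param c0 q)).
Proof. by move=> Oq; rewrite F_chart//; exact: (famt_move nu YX t Oq). Qed.

Let oU3 : open [set z : R * (R * R) | O z.2].
Proof. by apply: (open_comp (f := snd)) => // z _; exact: cvg_snd. Qed.

(** The conditions are open in (t, q) and hold for t = 0 on a compact square. *)
Let small : exists2 eps : R, 0 < eps & forall t q, `|t| < eps -> csq q0 (3 * r) q ->
  0 < gr t q /\ 0 < 1 + t * sh q.
Proof.
pose U := [set z : R * (R * R) | O z.2].
have sg : smooth_on U (fun z => gr z.1 z.2).
  by apply: (smooth_gramt nl snu sA sB oU3) => z.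
have ss : smooth_on U (fun z : R * (R * R) => 1 + z.1 * sh z.2).
  apply: smooth_add => //; first exact: smooth_cst.
  apply: smooth_mul => //.
    by apply: (@smooth_linear_post _ _ _ _ fst) => //; [move=> ?; exact: cvg_fst|exact: smooth_id].
  have c2 : continuous (snd : R * (R * R) -> R * R) by move=> ?; exact: cvg_snd.
  exact: (@smooth_linear_pre _ _ _ _ snd _ _ c2 oO (smooth_shear oO sY snu YX)).
pose W := [set z : R * (R * R) | U z /\ (0 < gr z.1 z.2 /\ 0 < 1 + z.1 * sh z.2)].
have oW : open W.
  rewrite openE => z [Uz [z1 z2]]; rewrite /interior.
  have g1 := open_nbhs_nbhs (conj (@open_pos R) z1).
  have g2 := open_nbhs_nbhs (conj (@open_pos R) z2).
  have e1 : nbhs z [set z' : R * (R * R) | 0 < gr z'.1 z'.2] := smooth_continuous sg Uz g1.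
  have e2 : nbhs z [set z' : R * (R * R) | 0 < 1 + z'.1 * sh z'.2] := smooth_continuous ss Uz g2.
  have e3 := open_nbhs_nbhs (conj oU3 Uz).
  exact: (filterI e3 (filterI e1 e2)).
have WB q : csq q0 (3 * r) q -> W (0, q).
  move=> /sub3 Oq; split => //; split; first by rewrite /= /gr (gramt0 _ _ _ nl Oq).
  by rewrite /= mul0r addr0.
have cB : compact (csq q0 (3 * r)) by exact: rect_compact.
have [eps e0 H] := tube cB oW WB.
by exists eps => // t q te Bq; have [] := H t q te Bq.
Qed.

Let csq_notin (c : chart R M) (q : R * R) : chart_img c q -> ~ K (param c q) ->
  \near q, eta (param c q) = 0.
Proof.
move=> cq nK.
have oW : open (chart_img c `&` (param c @^-1` (~` K))).
  by apply: open_chart_preimage; exact: closed_openC.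
by apply: filterS (open_nbhs_nbhs (conj oW (conj cq nK))) => q' [_ h]; exact: eta_notK.
Qed.

Let smooth_x c : atlas RS c -> smooth_on (chart_img c) (x \o param c).
Proof. by move=> ac; have [_ /(_ c ac)[]] := hx. Qed.

Let smooth_F c t : atlas RS c -> smooth_on (chart_img c) (F t \o param c).
Proof.
move=> ac; have oc : open (chart_img c) by exact: open_chart_img.
apply: smooth_move => //; [exact: smooth_x|exact: smooth_eta|exact: smooth_cst].
Qed.

Let F_sphere t p : dot (F t p) (F t p) = 1.
Proof. exact: move_sphere (sphere_x p) (dot_x_eta p). Qed.

Let indep_x c q : atlas RS c -> chart_img c q ->
  forall al be : R, al *: dx (x \o param c) q + be *: dy (x \o param c) q = 0 ->
  al = 0 /\ be = 0.
Proof.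
move=> ac cq; have [_ /(_ c ac)[_ /(_ q cq)]] := hx; rewrite !du_dx !dv_dy.
by move=> [h1 h2 h3]; exact: (conformal_indep h1 h2 h3).
Qed.

Let immersed eps t c : atlas RS c ->
  (forall q, csq q0 (3 * r) q -> 0 < gr t q /\ 0 < 1 + t * sh q) -> `|t| < eps ->
  immersion_on (chart_img c) (F t \o param c).
Proof.
move=> ac He te q cq; rewrite du_dx dv_dy; apply: row_free_col.
have [Kq|nK] := pselect (K (param c q)); last first.
  have E : \near q, (F t \o param c) q = (x \o param c) q.
    by apply: filterS (csq_notin cq nK) => q' e; rewrite /F /= e move_e0.
  by rewrite (dx_near E) (dy_near E); exact: indep_x.
have [q1 Bq1 E1] := Kq; have Oq1 := BO Bq1; have [d1 c1] := chart_imgP Oq1.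
have oq : overlap c c0 q by split => //=; rewrite -E1.
pose G := F t \o param c0.
have oo := @open_overlap R M c c0.
have tq1 : trans c c0 q = q1 by rewrite /trans /= -E1.
have sG : smooth_on O G by exact: smooth_F.
have st := smooth_trans ac ac0.
have sto : forall q, overlap c c0 q -> O (trans c c0 q) by move=> q' h; exact: (trans_img h).
have E : forall q', overlap c c0 q' -> (F t \o param c) q' = G (trans c c0 q').
  by move=> q' h; rewrite /G /= (param_trans h).
have E' : forall q', overlap c c0 q' -> (x \o param c) q' = X (trans c c0 q').
  by move=> q' h; rewrite /X /= (param_trans h).
rewrite (dx_on oo E oq) (dy_on oo E oq).
have chx (g : R * R -> 'rV[R]_n.+1) : smooth_on O g -> dx (fun q => g (trans c c0 q)) q =
    (dx (trans c c0) q).1 *: dx g q1 + (dx (trans c c0) q).2 *: dy g q1.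
  move=> sg; apply: dx_eq; rewrite -tq1.
  exact: (is_derive_chain_row oO sg (sto _ oq) (is_dx st oq)).
have chy (g : R * R -> 'rV[R]_n.+1) : smooth_on O g -> dy (fun q => g (trans c c0 q)) q =
    (dy (trans c c0) q).1 *: dx g q1 + (dy (trans c c0) q).2 *: dy g q1.
  move=> sg; apply: dy_eq; rewrite -tq1.
  exact: (is_derive_chain_row oO sg (sto _ oq) (is_dy st oq)).
have CR := trans_CR ac ac0 oq.
rewrite (chx _ sG) (chy _ sG) CR /=.
have := indep_x ac cq (al := 1) (be := 0).
rewrite (dx_on oo E' oq) (chx _ sX) scale1r scale0r addr0.
move: (dx (trans c c0) q).1 (dx (trans c c0) q).2 => a b ab0.
have Gq : forall al be : R, al *: dx G q1 + be *: dy G q1 = 0 -> al = 0 /\ be = 0.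
  apply: (@lift_indep _ _ O (yt t) (scal X Y nu t) G q1) => //.
  - exact: (smooth_scal oO sY sX snu YX).
  - by move=> p _; exact: F_sphere.
  - by move=> p Op; exact: y_move.
  have B3 : csq q0 (3 * r) q1.
    move/csqP: Bq1 => [h1 h2]; apply/csqP.
    by split; [apply: le_trans h1 _|apply: le_trans h2 _]; have := r0; lra.
  have [g _] := He q1 B3.
  rewrite (dx_famt nl t sY snu sA sB Oq1) (dy_famt nl t sY snu sA sB Oq1).
  by rewrite gt_eqF.
have abn : a ^+ 2 + b ^+ 2 != 0.
  apply/eqP => /eqP; rewrite paddr_eq0 ?sqr_ge0// !sqrf_eq0 => /andP[/eqP a0 /eqP b0].
  have [|h _] := ab0; first by rewrite a0 b0 !scale0r addr0.
  by move/eqP: h; rewrite oner_eq0.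
move=> al be Z.
have [|h1 h2] := Gq (al * a - be * b) (al * b + be * a).
  by rewrite -[RHS]Z; apply/rowP => i; rewrite !mxE; ring.
split; apply: (mulIf abn); rewrite mul0r.
  transitivity (a * (al * a - be * b) + b * (al * b + be * a)); first by ring.
  by rewrite h1 h2; ring.
transitivity (a * (al * b + be * a) - b * (al * a - be * b)); first by ring.
by rewrite h1 h2; ring.
Qed.

(** The fundamental lemma of the calculus of variations with nu = sqbump E, where
   E is the normal part of the Euler-Lagrange field: the first variation is half
   the integral of sqbump |E|^2, and this integrand is continuous and
   nonnegative. *)
Theorem willmore_equation_at : willmore RS x -> projn Y q0 (ELv Y q0) = 0.
Proof.
move=> hW; have [eps e0 He] := small.
pose B1 (_ : 'I_1) : set (R * R) := Bc; pose ch (_ : 'I_1) := c0.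
pose d (t : R) (_ : 'I_1) (q : R * R) := densY (yt t) q.
have V : Defs.variation RS x K eps F.
  split.
  - by apply/funext => p; exact: move_t0.
  - by move=> t p _; exact: F_sphere.
  - by move=> t p _ nK; rewrite /F eta_notK// move_e0.
  - move=> c ac; have oc : open (chart_img c) by exact: open_chart_img.
    have oU : open [set q : R * (R * R) | `|q.1| < eps /\ chart_img c q.2].
      exact: open_slab.
    have c2 : continuous (snd : R * (R * R) -> R * R) by move=> ?; exact: cvg_snd.
    apply: smooth_move => //.
    + by apply: smooth_sub (@smooth_linear_pre _ _ _ _ snd _ _ c2 oc (smooth_x ac)) => z [].
    + by apply: smooth_sub (@smooth_linear_pre _ _ _ _ snd _ _ c2 oc (smooth_eta ac)) => z [].
    + by apply: (@smooth_linear_post _ _ _ _ fst) => //; [move=> ?; exact: cvg_fst|exact: smooth_id].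
  - by move=> t c te ac; apply: (immersed ac _ te) => q; exact: He.
have P : coordinate_partition RS K ch B1.
  split.
  - by [].
  - by move=> i; split; [exact: rect_measurable|exact: BO].
  - by move=> i j; rewrite !ord1.
  - by apply/seteqP; split => [p [i _ [q Bq <-]]|p [q Bq <-]]; [exists q|exists ord0 => //; exists q].
have D : forall t i, `|t| < eps ->
    willmore_density (chart_img (ch i)) (F t \o param (ch i)) (d t i).
  move=> t i te; apply: (@willmore_density_densY _ _ _ _ _ (scal X Y nu t)) => //.
  - exact: (smooth_famt nl t sY snu sA sB).
  - by move=> p _; exact: F_sphere.
  - move=> q Oq; split; last exact: y_move.
    have l0 := lam_gt0 YX Oq; apply: mulr_gt0; last by rewrite mulr_gt0// move_den_gt0.
    have [Bq|nB] := pselect (csq q0 (3 * r) q); first by have [] := He t q te Bq.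
    rewrite -/sh sh_out ?mulr0 ?addr0// => -[h1 h2]; apply: nB; apply/csqP.
    by split; [move: h1|move: h2] => /ltW h; apply: le_trans h _; have := r0; lra.
have H := hW K eps F 1%N ch B1 d cK e0 V P D.
pose J (z : R * (R * R)) := jetdens Y nu At Bt z.1 z.2.
pose a1 := q0.1 - 2 * r; pose b1 := q0.1 + 2 * r.
pose a2 := q0.2 - 2 * r; pose b2 := q0.2 + 2 * r.
have ab1 : a1 < b1 by have := r0; rewrite /a1 /b1; lra.
have ab2 : a2 < b2 by have := r0; rewrite /a2 /b2; lra.
have sqO : sq q0 (3 * r) `<=` O by move=> q /sq_sub_csq/sub3.
have Bsq : Bc `<=` sq q0 (3 * r) by apply: csq_sub_sq; have := r0; lra.
have oJ : open [set z : R * (R * R) | `|z.1| < eps /\ sq q0 (3 * r) z.2].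
  by apply: open_slab; exact: open_sq.
have sJ : smooth_on [set z : R * (R * R) | `|z.1| < eps /\ sq q0 (3 * r) z.2] J.
  apply: (smooth_jetdens nl snu sA sB oJ); first by move=> z [_ /sqO].
  by move=> z [zt /sq_sub_csq zq]; have [] := He z.1 z.2 zt zq.
have H2 := I2_derive ab1 ab2 (@open_sq _ _ _) Bsq e0 sJ.
have E1 : (fun t : R => \sum_(i < 1) \int[@plane_measure R]_(q in (B1 i : set (borel_plane R))) d t i q)
   = (fun t => I2 a1 b1 a2 b2 (fun q => J (t, q))).
  apply/funext => t; rewrite big_ord1; apply: eq_Rintegral => q; rewrite inE => Bq.
  by rewrite /d /J /yt (densY_jet nl snu sA sB _ (BO Bq)).
have E2 : I2 a1 b1 a2 b2 (fun q => 'D_(et R) J (0, q)) = I2 a1 b1 a2 b2 (dvar Y nu).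
  apply: I2_ext => q Bq.
  have := jetdens_derive At Bt nl snu pnu (BO Bq) => h.
  by have [_ ->] := (is_derive_fst_line J (0 : R) q _).2 h.
have E3 : I2 a1 b1 a2 b2 (dvar Y nu) = 0.
  by rewrite -E2; case: H2 => _ <-; rewrite -E1; case: H.
have bdry p : O p -> p.1 = a1 \/ p.1 = b1 \/ p.2 = a2 \/ p.2 = b2 -> \near p, nu p = 0.
  move=> _ pb; apply/nbhs_squareP; exists r => // q qp1 qp2; apply: nu_out => -[h1 h2].
  move: qp1 qp2 h1 h2; rewrite !ltr_norml => /andP[? ?] /andP[? ?] /andP[? ?] /andP[? ?].
  by have := r0; case: pb => [|[|[|]]]; rewrite /a1 /b1 /a2 /b2; lra.
have E4 : I2 a1 b1 a2 b2 (fun p => lor (nu p) (ELv Y p)) = 0.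
  have := I2_dvar nl ab1 ab2 BO snu bdry; rewrite -[LHS]/(I2 a1 b1 a2 b2 (dvar Y nu)) E3.
  by move=> /esym/eqP; rewrite mulf_eq0 invr_eq0 pnatr_eq0 => /eqP.
have fE q : O q -> lor (nu q) (ELv Y q) = sqbump q0 r q * lor (Ep q) (Ep q).
  by move=> Oq; rewrite -(lor_projn _ Oq (pnu Oq)) lorZl.
have q0B : csq q0 (2 * r) q0.
  by apply/csqP; rewrite !subrr normr0; have := r0; split; lra.
have Oq0 := BO q0B.
have f0 : lor (nu q0) (ELv Y q0) = 0.
  apply: (@I2_eq0 _ a1 b1 a2 b2 O ab1 ab2 oO BO (fun p => lor (nu p) (ELv Y p))) => //.
  - move=> p Op; apply: smooth_continuous Op; apply: smooth_lor => //.
    exact: (smooth_ELv nl).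
  - move=> p /BO Op; rewrite fE// mulr_ge0 ?sqbump_ge0//.
    exact: (perpV_ge0 nl Op (pE Op)).
  - by have := r0; rewrite /a1 /b1; lra.
  - by have := r0; rewrite /a2 /b2; lra.
move/eqP: f0; rewrite fE// mulf_eq0 gt_eqF/=; last first.
  by apply: sqbump_gt0; rewrite subrr normr0.
by move/eqP; exact: (perpV_eq0 nl Oq0 (pE Oq0)).
Qed.

End WillmoreEquation.

(** * A Carleman estimate for the Cauchy-Riemann operator *)
Section Dbar.
Variable R : realType.
Implicit Types (a b f : R * R -> R) (q p : R * R).

(** Twice the real and imaginary parts of the anti-holomorphic derivative
   of a + ib. *)
Definition dbr a b p : R := dx a p - dy b p.
Definition dbi a b p : R := dx b p + dy a p.
Definition dbar2 a b p : R := dbr a b p ^+ 2 + dbi a b p ^+ 2.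
Definition abs2 a b p : R := a p ^+ 2 + b p ^+ 2.

(** The integral over the square of centre q and half side r. *)
Definition I2c q (r : R) f : R := I2 (q.1 - r) (q.1 + r) (q.2 - r) (q.2 + r) f.

Lemma smooth_fstB (O : set (R * R)) (c : R) : open O -> smooth_on O (fun p : R * R => p.1 - c).
Proof. by move=> oO; apply: smooth_subr => //; [exact: smooth_fst (smooth_id oO)|exact: smooth_cst]. Qed.
Lemma smooth_sndB (O : set (R * R)) (c : R) : open O -> smooth_on O (fun p : R * R => p.2 - c).
Proof. by move=> oO; apply: smooth_subr => //; [exact: smooth_snd (smooth_id oO)|exact: smooth_cst]. Qed.
Lemma dx_fstB (c : R) p : dx (fun p : R * R => p.1 - c) p = 1.
Proof.
apply: dx_eq; case: p => u v; apply/is_derive_du.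
exact: (is_derive_eq (is_deriveB (is_derive_id _ _) (is_derive_cst _ _ _)) (subr0 _)).
Qed.
Lemma dy_fstB (c : R) p : dy (fun p : R * R => p.1 - c) p = 0.
Proof. by apply: dy_eq; case: p => u v; apply/is_derive_dv; exact: (is_derive_cst (u - c : R) v (1 : R)). Qed.
Lemma dx_sndB (c : R) p : dx (fun p : R * R => p.2 - c) p = 0.
Proof. by apply: dx_eq; case: p => u v; apply/is_derive_du; exact: (is_derive_cst (v - c : R) u (1 : R)). Qed.
Lemma dy_sndB (c : R) p : dy (fun p : R * R => p.2 - c) p = 1.
Proof.
apply: dy_eq; case: p => u v; apply/is_derive_dv.
exact: (is_derive_eq (is_deriveB (is_derive_id _ _) (is_derive_cst _ _ _)) (subr0 _)).
Qed.

Section Box.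
Variables (O : set (R * R)) (q : R * R) (r : R).
Hypotheses (oO : open O) (r0 : 0 < r) (BO : csq q r `<=` O).

Let l1 : q.1 - r < q.1 + r. Proof. by have := r0; lra. Qed.
Let l2 : q.2 - r < q.2 + r. Proof. by have := r0; lra. Qed.

Let sc f : smooth_on O f -> forall p, O p -> {for p, continuous f}.
Proof. by move=> sf p; exact: smooth_continuous. Qed.

Lemma I2c_add f g : smooth_on O f -> smooth_on O g ->
  I2c q r (fun p => f p + g p) = I2c q r f + I2c q r g.
Proof. by move=> sf sg; exact: (I2_add l1 l2 oO BO (sc sf) (sc sg)). Qed.
Lemma I2c_scale k f : smooth_on O f -> I2c q r (fun p => k * f p) = k * I2c q r f.
Proof. by move=> sf; exact: (I2_scale l1 l2 oO BO _ (sc sf)). Qed.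
Lemma I2c_le f g : smooth_on O f -> smooth_on O g -> (forall p, csq q r p -> f p <= g p) ->
  I2c q r f <= I2c q r g.
Proof. by move=> sf sg; exact: (I2_le l1 l2 oO BO (sc sf) (sc sg)). Qed.
Lemma I2c_sum (I : Type) (s : seq I) (f : I -> R * R -> R) : (forall i, smooth_on O (f i)) ->
  I2c q r (fun p => \sum_(i <- s) f i p) = \sum_(i <- s) I2c q r (f i).
Proof.
move=> sf; elim: s => [|i s IH].
  rewrite big_nil; transitivity (0 * I2c q r (fun=> 0)); last exact: mul0r.
  rewrite -I2c_scale; last exact: smooth_cst.
  by rewrite /I2c; apply: I2_ext => p _; rewrite big_nil mul0r.
rewrite big_cons -IH -I2c_add//; last exact: smooth_sum.
by rewrite /I2c; apply: I2_ext => p _; rewrite big_cons.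
Qed.

(** The boundary terms vanish, so that only the pointwise inequality
   a^2 + b^2 <= 4 r^2 |dbar|^2 + divergence has to be checked: it comes from
   (a + 2 U a_u)^2 >= 0 with U = u - q.1 bounded by r, and from the fact that
   |dbar|^2 differs from the sum of the squares of all first derivatives by a
   Jacobian, which is a divergence. *)
Lemma dbar_estimate a b : smooth_on O a -> smooth_on O b ->
  (forall p, csq q r p -> ~ sq q r p -> a p = 0 /\ b p = 0) ->
  I2c q r (abs2 a b) <= 4 * r ^+ 2 * I2c q r (dbar2 a b).
Proof.
move=> sa sb bd.
have sU := @smooth_fstB O q.1 oO.
pose U (p : R * R) : R := p.1 - q.1.
pose F p := 2 * (U p * (a p * a p + b p * b p)) + 8 * r ^+ 2 * (dy b p * a p).
pose G p := - (8 * r ^+ 2) * (dx b p * a p).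
have sxa := smooth_dx sa; have sya := smooth_dy sa.
have sxb := smooth_dx sb; have syb := smooth_dy sb.
have saa := smooth_mul oO sa sa; have sbb := smooth_mul oO sb sb.
have s1 := smooth_mul oO sU (smooth_add oO saa sbb).
have s2 := smooth_mul oO syb sa; have s3 := smooth_mul oO sxb sa.
have sF : smooth_on O F by exact: (smooth_add oO (smooth_scale 2 oO s1) (smooth_scale (8 * r ^+ 2) oO s2)).
have sG : smooth_on O G by exact: (smooth_scale (- (8 * r ^+ 2)) oO s3).
have EF p : O p -> dx F p = 2 * ((a p * a p + b p * b p) + U p * (2 * (a p * dx a p + b p * dx b p)))
    + 8 * r ^+ 2 * (dx (dy b) p * a p + dy b p * dx a p).
  move=> Op; rewrite /F (dx_add Op (smooth_scale 2 oO s1) (smooth_scale (8 * r ^+ 2) oO s2)).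
  rewrite (dx_scale Op 2 s1) (dx_scale Op (8 * r ^+ 2) s2) (dx_mul Op syb sa).
  rewrite (dx_mul Op sU (smooth_add oO saa sbb)) dx_fstB (dx_add Op saa sbb) (dx_mul Op sa sa) (dx_mul Op sb sb).
  by rewrite /GRing.scale /= /U; ring.
have EG p : O p -> dy G p = - (8 * r ^+ 2) * (dx (dy b) p * a p + dx b p * dy a p).
  move=> Op; rewrite /G (dy_scale Op (- (8 * r ^+ 2)) s3) (dy_mul Op sxb sa).
  by rewrite (schwarz_R oO sb Op).
have sN : smooth_on O (dbar2 a b).
  apply: smooth_add => //; apply: smooth_exp => //; first exact: smooth_subr.
  exact: smooth_add.
have sA : smooth_on O (abs2 a b) by apply: smooth_add => //; apply: smooth_exp.
have s4N : smooth_on O (fun p => 4 * r ^+ 2 * dbar2 a b p) by exact: (smooth_scale (4 * r ^+ 2) oO sN).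
have dF : I2c q r (dx F) = 0.
  apply: (I2_dx0 l1 l2 oO BO sF) => v /andP[v1 v2]; rewrite /F /=.
  have [] := bd (q.1 - r, v).
  - by apply/csqP; split; rewrite ler_norml /=; apply/andP; split; have := r0; lra.
  - by move=> [/=]; rewrite ltr_norml => /andP[]; lra.
  have [] := bd (q.1 + r, v).
  - by apply/csqP; split; rewrite ler_norml /=; apply/andP; split; have := r0; lra.
  - by move=> [/=]; rewrite ltr_norml => /andP[]; lra.
  by move=> -> -> -> ->; split; ring.
have dG : I2c q r (dy G) = 0.
  apply: (I2_dy0 l1 l2 oO BO sG) => v /andP[v1 v2]; rewrite /G /=.
  have [] := bd (v, q.2 - r).
  - by apply/csqP; split; rewrite ler_norml /=; apply/andP; split; have := r0; lra.
  - by move=> [_ /=]; rewrite ltr_norml => /andP[]; lra.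
  have [] := bd (v, q.2 + r).
  - by apply/csqP; split; rewrite ler_norml /=; apply/andP; split; have := r0; lra.
  - by move=> [_ /=]; rewrite ltr_norml => /andP[]; lra.
  by move=> -> _ -> _; split; ring.
have -> : 4 * r ^+ 2 * I2c q r (dbar2 a b) =
    I2c q r (fun p => (4 * r ^+ 2 * dbar2 a b p + dx F p) + dy G p).
  rewrite (I2c_add (smooth_add oO s4N (smooth_dx sF)) (smooth_dy sG)).
  by rewrite (I2c_add s4N (smooth_dx sF)) dF dG !addr0 I2c_scale.
apply: I2c_le => //.
  exact: (smooth_add oO (smooth_add oO s4N (smooth_dx sF)) (smooth_dy sG)).
move=> p Bp; have Op := BO Bp; rewrite (EF p Op) (EG p Op) /dbar2 /abs2 /dbr /dbi.
have Ur : U p ^+ 2 <= r ^+ 2.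
  move/csqP: Bp => [h _]; rewrite -(real_normK (num_real (U p))).
  by rewrite lerXn2r ?nnegrE// ltW.
move: (U p) (dx (dy b) p) (a p) (b p) (dx a p) (dy a p) (dx b p) (dy b p) Ur.
move=> u bxy x y xa ya xb yb ur; rewrite -subr_ge0.
have -> : 4 * r ^+ 2 * ((xa - yb) ^+ 2 + (xb + ya) ^+ 2) +
   (2 * (x * x + y * y + u * (2 * (x * xa + y * xb))) +
    8 * r ^+ 2 * (bxy * x + yb * xa)) +
   - (8 * r ^+ 2) * (bxy * x + xb * ya) - (x ^+ 2 + y ^+ 2) =
   (x + 2 * (u * xa)) ^+ 2 + (y + 2 * (u * xb)) ^+ 2 + 4 * ((r ^+ 2 - u ^+ 2) * (xa ^+ 2 + xb ^+ 2))
   + 4 * (r ^+ 2 * (yb ^+ 2 + ya ^+ 2)).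
  by ring.
have ur' : 0 <= r ^+ 2 - u ^+ 2 by rewrite subr_ge0.
have pos (c d e : R) : 0 <= c -> 0 <= 4 * (c * (d ^+ 2 + e ^+ 2)).
  by move=> c0; rewrite !mulr_ge0// addr_ge0 ?sqr_ge0.
apply: addr_ge0; last exact: pos (sqr_ge0 _).
apply: addr_ge0; last exact: pos ur'.
by apply: addr_ge0; exact: sqr_ge0.
Qed.
End Box.
End Dbar.

Section Step.
Variable R : realType.
Implicit Types (p q : R * R) (rho t : R).

(** A smooth step from 0 at t <= 0 to 1 at t >= 1. *)
Definition step (t : R) : R := flat 0 t / (flat 0 t + flat 0 (1 - t)).

Lemma step_den_gt0 t : 0 < flat 0 t + flat 0 (1 - t).
Proof.
have [t0|t0] := leP t 0; last by rewrite ltr_wpDr ?flat_ge0// flat_gt0.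
by rewrite ltr_wpDl ?flat_ge0// flat_gt0//; lra.
Qed.

Lemma step0 t : t <= 0 -> step t = 0.
Proof. by move=> t0; rewrite /step flat_le0// mul0r. Qed.
Lemma step1 t : 1 <= t -> step t = 1.
Proof.
move=> t1; rewrite /step (@flat_le0 _ 0 (1 - t)); last by lra.
by rewrite addr0 divff// gt_eqF// flat_gt0//; lra.
Qed.

Lemma smooth_step (O : set (R * R)) (f : R * R -> R) : open O -> smooth_on O f ->
  smooth_on O (fun p => step (f p)).
Proof.
move=> oO sf; have s1 : smooth_on O (fun p => 1 - f p).
  by apply: smooth_subr => //; exact: smooth_cst.
have oT : open [set: R] by exact: openT.
have g1 : smooth_on O (fun p => flat 0 (f p)) := smooth_comp1 oO oT (fun _ _ => I) (@smooth_flat R 0) sf.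
have g2 : smooth_on O (fun p => flat 0 (1 - f p)) := smooth_comp1 oO oT (fun _ _ => I) (@smooth_flat R 0) s1.
apply: smooth_mul => //; apply: smooth_inv => //; last exact: smooth_add.
by move=> p _; rewrite gt_eqF// step_den_gt0.
Qed.

(** A cut-off, equal to 1 on the square of half side rho and to 0 off the
   square of half side 2 rho. *)
Definition plateau q rho p : R :=
  (step (2 + (p.1 - q.1) / rho) * step (2 - (p.1 - q.1) / rho))
  * (step (2 + (p.2 - q.2) / rho) * step (2 - (p.2 - q.2) / rho)).

Lemma smooth_plateau q rho (O : set (R * R)) : open O -> smooth_on O (plateau q rho).
Proof.
move=> oO.
have sc (f : R * R -> R) : smooth_on O f -> smooth_on O (fun p => f p / rho).
  by move=> sf; apply: smooth_mul => //; exact: smooth_cst.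
have s1 := sc _ (@smooth_fstB _ O q.1 oO); have s2 := sc _ (@smooth_sndB _ O q.2 oO).
have c2 : smooth_on O (fun=> 2 : R) by exact: smooth_cst.
have a1 := smooth_step oO (smooth_add oO c2 s1); have a2 := smooth_step oO (smooth_subr oO c2 s1).
have a3 := smooth_step oO (smooth_add oO c2 s2); have a4 := smooth_step oO (smooth_subr oO c2 s2).
exact: (smooth_mul oO (smooth_mul oO a1 a2) (smooth_mul oO a3 a4)).
Qed.

Variables (q : R * R) (rho : R).
Hypothesis rho0 : 0 < rho.

Lemma plateau1 p : sq q rho p -> plateau q rho p = 1.
Proof.
have H s : `|s| < rho -> step (2 + s / rho) * step (2 - s / rho) = 1.
  rewrite ltr_norml => /andP[h1 h2].
  have k1 : -1 <= s / rho by rewrite ler_pdivlMr// mulN1r ltW.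
  have k2 : s / rho <= 1 by rewrite ler_pdivrMr// mul1r ltW.
  by rewrite !step1 ?mulr1//; lra.
by move=> [h1 h2]; rewrite /plateau !H// mulr1.
Qed.

Lemma plateau0 p : ~ sq q (2 * rho) p -> plateau q rho p = 0.
Proof.
have H s : 2 * rho <= `|s| -> step (2 + s / rho) * step (2 - s / rho) = 0.
  rewrite ler_normr => /orP[h|h].
    have k : 2 <= s / rho by rewrite ler_pdivlMr.
    by rewrite (@step0 (2 - _)) ?mulr0//; lra.
  have k : s / rho <= -2 by rewrite ler_pdivrMr//; lra.
  by rewrite step0 ?mul0r//; lra.
move=> h; rewrite /plateau.
have [h1|h1] := ltP `|p.1 - q.1| (2 * rho); last by rewrite (H _ h1) mul0r.
have [h2|h2] := ltP `|p.2 - q.2| (2 * rho); last by rewrite (H _ h2) mulr0.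
by case: h.
Qed.

Lemma plateau_flat p : sq q rho p -> dx (plateau q rho) p = 0 /\ dy (plateau q rho) p = 0.
Proof.
move=> h; have o := @open_sq R q rho.
by rewrite (dx_on o plateau1 h) (dy_on o plateau1 h) dx_cst dy_cst.
Qed.

Lemma flat0_le1 (x : R) : flat 0 x <= 1.
Proof.
rewrite /flat; case: ifP => // x0; rewrite expr0 mul1r expR_le1 oppr_le0.
by rewrite invr_ge0 ltW.
Qed.

Lemma sqbump_le1 (r : R) p : sqbump q r p <= 1.
Proof. by rewrite /sqbump !mulr_ile1 ?mulr_ge0 ?flat_ge0 ?flat0_le1. Qed.

End Step.

Section Cutoff.
Variable R : realType.
Variables (N : nat) (a b : 'I_N -> R * R -> R).
Variables (O : set (R * R)) (q : R * R) (rho C : R).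
Hypotheses (oO : open O) (rho0 : 0 < rho) (BO : csq q (2 * rho) `<=` O).
Hypotheses (sa : forall k, smooth_on O (a k)) (sb : forall k, smooth_on O (b k)).

(** |W|^2 and |dbar W|^2 for W the vector of all a_k + i b_k. *)
Definition sum_abs2 p : R := \sum_(k < N) abs2 (a k) (b k) p.
Definition sum_dbar2 p : R := \sum_(k < N) dbar2 (a k) (b k) p.

Lemma abs2_ge0 (f g : R * R -> R) p : 0 <= abs2 f g p.
Proof. by rewrite addr_ge0 ?sqr_ge0. Qed.
Lemma sum_abs2_ge0 p : 0 <= sum_abs2 p.
Proof. by apply: sumr_ge0 => k _; exact: abs2_ge0. Qed.

Lemma smooth_abs2 (f g : R * R -> R) : smooth_on O f -> smooth_on O g -> smooth_on O (abs2 f g).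
Proof. by move=> sf sg; apply: smooth_add => //; exact: smooth_exp. Qed.
Lemma smooth_dbar2 (f g : R * R -> R) : smooth_on O f -> smooth_on O g -> smooth_on O (dbar2 f g).
Proof.
move=> sf sg; have s1 := smooth_dx sf; have s2 := smooth_dy sf.
have s3 := smooth_dx sg; have s4 := smooth_dy sg.
apply: smooth_add => //; apply: smooth_exp => //; first exact: smooth_subr.
exact: smooth_add.
Qed.
Lemma smooth_sum_abs2 : smooth_on O sum_abs2.
Proof. by apply: smooth_sum => // k; exact: smooth_abs2. Qed.

Let chi := plateau q rho.
Let schi : smooth_on O chi. Proof. exact: smooth_plateau. Qed.
Let r0 : 0 < 2 * rho. Proof. by rewrite mulr_gt0. Qed.

Definition plateau_grad2 p : R := dx (plateau q rho) p ^+ 2 + dy (plateau q rho) p ^+ 2.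

Lemma smooth_plateau_grad2 : smooth_on O plateau_grad2.
Proof. by apply: smooth_add => //; apply: smooth_exp => //; [exact: smooth_dx|exact: smooth_dy]. Qed.

Let one (f g : R * R -> R) : smooth_on O f -> smooth_on O g ->
  I2c q (2 * rho) (fun p => chi p ^+ 2 * abs2 f g p) <= 32 * rho ^+ 2 *
  (I2c q (2 * rho) (fun p => chi p ^+ 2 * dbar2 f g p)
   + I2c q (2 * rho) (fun p => plateau_grad2 p * abs2 f g p)).
Proof.
move=> sf sg.
have scf := smooth_mul oO schi sf; have scg := smooth_mul oO schi sg.
have e := dbar_estimate oO r0 BO scf scg.
have s1 : smooth_on O (fun p => chi p ^+ 2 * dbar2 f g p).
  by apply: smooth_mul => //; [exact: smooth_exp|exact: smooth_dbar2].
have s2 : smooth_on O (fun p => plateau_grad2 p * abs2 f g p).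
  by apply: smooth_mul => //; [exact: smooth_plateau_grad2|exact: smooth_abs2].
rewrite -(I2c_add oO r0 BO s1 s2).
have -> : I2c q (2 * rho) (fun p => chi p ^+ 2 * abs2 f g p) =
    I2c q (2 * rho) (abs2 (fun p => chi p * f p) (fun p => chi p * g p)).
  by rewrite /I2c; apply: I2_ext => p _; rewrite /abs2; ring.
apply: le_trans (e _) _.
  by move=> p _ np; rewrite /chi plateau0// !mul0r.
have -> : 4 * (2 * rho) ^+ 2 = 16 * rho ^+ 2 :> R by ring.
have -> : 32 * rho ^+ 2 = 16 * rho ^+ 2 * 2 :> R by ring.
have s3 := smooth_add oO s1 s2.
have c0 : 0 <= 16 * rho ^+ 2 by apply: mulr_ge0; rewrite ?sqr_ge0.
rewrite -[leRHS]mulrA; apply: ler_wpM2l => //.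
rewrite -[leRHS](I2c_scale oO r0 BO 2 s3).
apply: (I2c_le oO r0 BO); [exact: smooth_dbar2|exact: (smooth_scale 2 oO s3)|].
move=> p /BO Op; rewrite /dbar2 /dbr /dbi /plateau_grad2 /abs2 -/chi.
rewrite (dx_mul Op schi sf) (dy_mul Op schi sf) (dx_mul Op schi sg) (dy_mul Op schi sg).
move: (dx chi p) (dy chi p) (chi p) (f p) (g p) (dx f p) (dy f p) (dx g p) (dy g p).
move=> cx cy c x y fx fy gx gy; rewrite -subr_ge0.
suff -> : 2 * (c ^+ 2 * ((fx - gy) ^+ 2 + (gx + fy) ^+ 2) + (cx ^+ 2 + cy ^+ 2) * (x ^+ 2 + y ^+ 2))
   - ((cx * x + c * fx - (cy * y + c * gy)) ^+ 2 + (cx * y + c * gx + (cy * x + c * fy)) ^+ 2)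
   = (c * (fx - gy) - (cx * x - cy * y)) ^+ 2 + (c * (gx + fy) - (cx * y + cy * x)) ^+ 2.
  by rewrite addr_ge0 ?sqr_ge0.
by ring.
Qed.

(** If |dbar W|^2 <= C |W|^2 and the square is small, then the interior term can
   be absorbed: W is controlled by its values where the cut-off varies. *)
Lemma cutoff_estimate : (forall p, csq q (2 * rho) p -> sum_dbar2 p <= C * sum_abs2 p) ->
  64 * rho ^+ 2 * C <= 1 ->
  I2c q (2 * rho) (fun p => plateau q rho p ^+ 2 * sum_abs2 p)
  <= 64 * rho ^+ 2 * I2c q (2 * rho) (fun p => plateau_grad2 p * sum_abs2 p).
Proof.
move=> TS Cr.
have sc2 : smooth_on O (fun p => chi p ^+ 2) by exact: smooth_exp.
have s1 k : smooth_on O (fun p => chi p ^+ 2 * abs2 (a k) (b k) p).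
  by apply: smooth_mul => //; exact: smooth_abs2.
have s2 k : smooth_on O (fun p => chi p ^+ 2 * dbar2 (a k) (b k) p).
  by apply: smooth_mul => //; exact: smooth_dbar2.
have s3 k : smooth_on O (fun p => plateau_grad2 p * abs2 (a k) (b k) p).
  by apply: smooth_mul => //; [exact: smooth_plateau_grad2|exact: smooth_abs2].
have E (w : R * R -> R) (g : 'I_N -> R * R -> R) :
    (forall k, smooth_on O (fun p => w p * g k p)) ->
    I2c q (2 * rho) (fun p => w p * \sum_(k < N) g k p)
    = \sum_(k < N) I2c q (2 * rho) (fun p => w p * g k p).
  move=> sg; rewrite -(I2c_sum oO r0 BO)//.
  by rewrite /I2c; apply: I2_ext => p _; rewrite mulr_sumr.
set A := leLHS; set B := I2c _ _ _.
have EA : A = \sum_(k < N) I2c q (2 * rho) (fun p => chi p ^+ 2 * abs2 (a k) (b k) p).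
  exact: (E (fun p => chi p ^+ 2)).
have EB : B = \sum_(k < N) I2c q (2 * rho) (fun p => plateau_grad2 p * abs2 (a k) (b k) p).
  exact: (E plateau_grad2).
pose D := I2c q (2 * rho) (fun p => chi p ^+ 2 * sum_dbar2 p).
have ED : D = \sum_(k < N) I2c q (2 * rho) (fun p => chi p ^+ 2 * dbar2 (a k) (b k) p).
  exact: (E (fun p => chi p ^+ 2)).
have h1 : A <= 32 * rho ^+ 2 * (D + B).
  rewrite EA ED EB -big_split mulr_sumr; apply: ler_sum => k _; exact: one.
have sS := smooth_sum_abs2.
have sT : smooth_on O sum_dbar2 by apply: smooth_sum => // k; exact: smooth_dbar2.
have h2 : D <= C * A.
  rewrite /A -(I2c_scale oO r0 BO C); last exact: smooth_mul.
  apply: (I2c_le oO r0 BO); [exact: smooth_mul|exact: (smooth_scale C oO (smooth_mul oO sc2 sS))|].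
  by move=> p Bp; rewrite mulrCA ler_wpM2l ?sqr_ge0//; exact: TS.
have A0 : 0 <= A.
  rewrite /A /I2c; apply: I2_ge0 => p _.
  by rewrite mulr_ge0 ?sqr_ge0 ?sum_abs2_ge0.
have h3 : 32 * rho ^+ 2 * (D + B) <= 32 * rho ^+ 2 * (C * A + B).
  by apply: ler_wpM2l; [apply: mulr_ge0; rewrite ?sqr_ge0|rewrite lerD2r].
have h4 : (64 * rho ^+ 2 * C) * A <= A by rewrite ler_piMl.
have := le_trans h1 h3; rewrite mulrDr => h5; move: h4 h5.
have -> : 64 * rho ^+ 2 * C * A = 2 * (32 * rho ^+ 2 * (C * A)) by ring.
have -> : 64 * rho ^+ 2 * B = 2 * (32 * rho ^+ 2 * B) by ring.
by lra.
Qed.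

End Cutoff.

Section Pole.
Variable R : realType.
Implicit Types (a b : R * R -> R) (p : R * R).
Variables (O : set (R * R)) (q : R * R) (delta : R).
Hypotheses (oO : open O) (d0 : 0 < delta).

Definition dist2 p : R := (p.1 - q.1) ^+ 2 + (p.2 - q.2) ^+ 2.

(** The quotient of a + ib by z - q, with value 0 at q. *)
Definition divr a b p : R := ((p.1 - q.1) * a p + (p.2 - q.2) * b p) / dist2 p.
Definition divi a b p : R := ((p.1 - q.1) * b p - (p.2 - q.2) * a p) / dist2 p.

Lemma dist2_eq0 p : dist2 p = 0 -> p = q.
Proof.
move=> /eqP; rewrite paddr_eq0 ?sqr_ge0// !sqrf_eq0 !subr_eq0.
by case: p q => [? ?] [? ?] /= /andP[/eqP -> /eqP ->].
Qed.

Lemma abs2_div a b p : abs2 (divr a b) (divi a b) p = abs2 a b p / dist2 p.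
Proof.
rewrite /abs2 /divr /divi; have [->|h] := eqVneq (dist2 p) 0.
  by rewrite invr0 !mulr0 expr0n addr0.
move: h; rewrite /dist2; move: (p.1 - q.1) (p.2 - q.2) (a p) (b p) => u v x y h.
by field.
Qed.

(** Smooth on O and zero near q: this class is stable under division by z - q. *)
Definition tame a b := [/\ smooth_on O a, smooth_on O b &
  forall p, sq q delta p -> a p = 0 /\ b p = 0].

Let sU : smooth_on O (fun p : R * R => p.1 - q.1). Proof. exact: smooth_fstB. Qed.
Let sV : smooth_on O (fun p : R * R => p.2 - q.2). Proof. exact: smooth_sndB. Qed.
Let sD : smooth_on O dist2.
Proof. exact: (smooth_add oO (smooth_exp 2 oO sU) (smooth_exp 2 oO sV)). Qed.

Let O' := [set p | O p /\ dist2 p != 0].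
Let oO' : open O'.
Proof.
have oN : open [set x : R | x != 0] by exact: open_neq.
rewrite openE => p [Op hp]; rewrite /interior.
have e1 : nbhs p [set p' | dist2 p' != 0] := smooth_continuous sD Op (open_nbhs_nbhs (conj oN hp)).
exact: (filterI (open_nbhs_nbhs (conj oO Op)) e1).
Qed.

Let div0 a b p : a p = 0 -> b p = 0 -> divr a b p = 0 /\ divi a b p = 0.
Proof. by move=> a0 b0; rewrite /divr /divi a0 b0 !mulr0 addr0 subr0 mul0r. Qed.

Let smooth_quot (f : R * R -> R) : smooth_on O f -> (forall p, sq q delta p -> f p = 0) ->
  smooth_on O (fun p => f p / dist2 p).
Proof.
move=> sf f0; apply: smooth_local => p Op; have [pq|pq] := eqVneq (dist2 p) 0.
  exists (sq q delta); split; first exact: open_sq.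
    by rewrite (dist2_eq0 pq); split; rewrite subrr normr0.
  apply: (@smooth_ext _ _ _ _ (fun=> 0 : R)); [exact: open_sq| |exact: smooth_cst].
  by move=> p' /f0 ->; rewrite mul0r.
exists O'; split; [exact: oO'|by split|].
have sub : O' `<=` O by move=> ? [].
have n0 p' : O' p' -> dist2 p' != 0 by case.
exact: (smooth_mul oO' (smooth_sub sub sf) (smooth_inv oO' n0 (smooth_sub sub sD))).
Qed.

(** W vanishes near q, so that no singularity arises there. *)
Lemma tame_div a b : tame a b -> tame (divr a b) (divi a b).
Proof.
move=> [sa sb ab0]; split; last by move=> p /ab0[]; exact: div0.
- apply: smooth_quot; first exact: (smooth_add oO (smooth_mul oO sU sa) (smooth_mul oO sV sb)).
  by move=> p /ab0[-> ->]; rewrite !mulr0 addr0.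
- apply: smooth_quot; first exact: (smooth_subr oO (smooth_mul oO sU sb) (smooth_mul oO sV sa)).
  by move=> p /ab0[-> ->]; rewrite !mulr0 subr0.
Qed.

Let tame_dbar2 a b p : tame a b -> sq q delta p -> dbar2 a b p = 0.
Proof.
move=> [sa sb ab0] hp; have oS := @open_sq R q delta; rewrite /dbar2 /dbr /dbi.
have a0 p' : sq q delta p' -> a p' = 0 by move=> /ab0[].
have b0 p' : sq q delta p' -> b p' = 0 by move=> /ab0[].
rewrite (dx_on oS a0 hp) (dy_on oS a0 hp) (dx_on oS b0 hp) (dy_on oS b0 hp) !dx_cst !dy_cst.
by rewrite addr0 subr0 expr0n addr0.
Qed.

(** Division by the holomorphic function z - q commutes with the
   anti-holomorphic derivative. *)
Lemma dbar2_div a b p : tame a b -> O p ->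
  dbar2 (divr a b) (divi a b) p = dbar2 a b p / dist2 p.
Proof.
move=> t Op; have t' := tame_div t; have [h|h] := pselect (sq q delta p).
  by rewrite (tame_dbar2 t h) (tame_dbar2 t' h) mul0r.
have pn : dist2 p != 0.
  apply/eqP => /dist2_eq0 E; apply: h; rewrite E.
  by split; rewrite subrr normr0.
have [sa sb _] := t; have [sA sB _] := t'.
have O'p : O' p by split.
have E1 p' : O' p' -> a p' = (p'.1 - q.1) * divr a b p' - (p'.2 - q.2) * divi a b p'.
  by move=> [_]; rewrite /divr /divi /dist2 => n0; field.
have E2 p' : O' p' -> b p' = (p'.1 - q.1) * divi a b p' + (p'.2 - q.2) * divr a b p'.
  by move=> [_]; rewrite /divr /divi /dist2 => n0; field.
move: pn; rewrite /dbar2 /dbr /dbi.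
rewrite (dx_on oO' E1 O'p) (dy_on oO' E1 O'p) (dx_on oO' E2 O'p) (dy_on oO' E2 O'p).
have s1 := smooth_mul oO sU sA; have s2 := smooth_mul oO sV sB.
have s3 := smooth_mul oO sU sB; have s4 := smooth_mul oO sV sA.
rewrite (dx_sub Op s1 s2) (dy_sub Op s1 s2) (dx_add Op s3 s4) (dy_add Op s3 s4).
rewrite (dx_mul Op sU sA) (dx_mul Op sV sB) (dx_mul Op sU sB) (dx_mul Op sV sA).
rewrite (dy_mul Op sU sA) (dy_mul Op sV sB) (dy_mul Op sU sB) (dy_mul Op sV sA).
rewrite dx_fstB dy_fstB dx_sndB dy_sndB /dist2.
move: (p.1 - q.1) (p.2 - q.2) (divr a b p) (divi a b p) => u v x y.
move: (dx (divr a b) p) (dy (divr a b) p) (dx (divi a b) p) (dy (divi a b) p).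
by move=> x1 x2 y1 y2 n0; field.
Qed.

Fixpoint divn (m : nat) a b : (R * R -> R) * (R * R -> R) :=
  if m is m'.+1 then
    let c := divn m' a b in (divr c.1 c.2, divi c.1 c.2)
  else (a, b).

Lemma divnP m a b : tame a b ->
  [/\ tame (divn m a b).1 (divn m a b).2,
      forall p, abs2 (divn m a b).1 (divn m a b).2 p = abs2 a b p / dist2 p ^+ m
    & forall p, O p -> dbar2 (divn m a b).1 (divn m a b).2 p = dbar2 a b p / dist2 p ^+ m].
Proof.
move=> t; elim: m => [|m [t1 H1 H2]].
  by split => // p; rewrite expr0 divr1.
split => [|p|p Op] /=; first exact: tame_div.
- by rewrite abs2_div H1 exprSr invfM mulrA.
- by rewrite dbar2_div// H2// exprSr invfM mulrA.
Qed.

End Pole.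

Section Carleman.
Variable R : realType.
Variables (N : nat) (a b : 'I_N -> R * R -> R).
Variables (O : set (R * R)) (q : R * R) (rho C delta : R).
Hypotheses (oO : open O) (rho0 : 0 < rho) (BO : csq q (2 * rho) `<=` O) (d0 : 0 < delta).
Hypothesis (Cr : 64 * rho ^+ 2 * C <= 1).
Hypothesis tab : forall k, tame O q delta (a k) (b k).
Hypothesis TS : forall p, csq q (2 * rho) p -> sum_dbar2 a b p <= C * sum_abs2 a b p.

Let S := sum_abs2 a b.
Let sa k : smooth_on O (a k). Proof. by have [] := tab k. Qed.
Let sb k : smooth_on O (b k). Proof. by have [] := tab k. Qed.
Let sS : smooth_on O S. Proof. exact: smooth_sum_abs2. Qed.
Let r0 : 0 < 2 * rho. Proof. by rewrite mulr_gt0. Qed.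

Let ball2 p : ~ sq q rho p -> rho ^+ 2 <= dist2 q p.
Proof.
have H (s : R) : rho <= `|s| -> rho ^+ 2 <= s ^+ 2.
  by move=> h; rewrite -(real_normK (num_real s)) lerXn2r ?nnegrE// ltW.
move=> h; rewrite /dist2; have [h1|/H h1] := ltP `|p.1 - q.1| rho; last first.
  by apply: le_trans h1 _; rewrite lerDl sqr_ge0.
have [h2|/H h2] := ltP `|p.2 - q.2| rho; first by case: h.
by apply: le_trans h2 _; rewrite lerDr sqr_ge0.
Qed.

Let ball1 p : sq q (rho / 2) p -> 2 * dist2 q p <= rho ^+ 2.
Proof.
have H (s : R) : `|s| < rho / 2 -> 4 * s ^+ 2 <= rho ^+ 2.
  move=> h; have -> : rho ^+ 2 = 4 * (rho / 2) ^+ 2 by field.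
  rewrite ler_wpM2l// -(real_normK (num_real s)) lerXn2r ?nnegrE//; last exact: ltW.
  by rewrite divr_ge0// ltW.
by move=> [/H h1 /H h2]; rewrite /dist2; lra.
Qed.

(** Dividing W by (z - q)^m, which is possible since W vanishes near q, keeps
   the differential inequality.  As m grows the weight |z - q|^(-2m) makes the
   interior contribution dominate that of the cut-off unless W vanishes. *)
Lemma carleman p : sq q (rho / 2) p -> S p = 0.
Proof.
move=> hp.
pose zeta := sqbump q (rho / 2).
have z0 p' : 0 <= zeta p' := sqbump_ge0 _ _ p'.
have sz : smooth_on O zeta by apply: smooth_sub (smooth_sqbump q (rho / 2)) => p'.
have szS : smooth_on O (fun p => zeta p * S p) by exact: smooth_mul.
have sg := @smooth_plateau_grad2 R O q rho oO.
have sgS : smooth_on O (fun p => plateau_grad2 q rho p * S p) by exact: smooth_mul.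
pose K := 64 * rho ^+ 2 * I2c q (2 * rho) (fun p => plateau_grad2 q rho p * S p).
(* |z - q|^2 <= rho^2 / 2 on the support of zeta and |z - q|^2 >= rho^2 where the
   cut-off varies, hence the factor 2^m. *)
have main m : 2 ^+ m * I2c q (2 * rho) (fun p => zeta p * S p) <= K.
  pose am k := (divn q m (a k) (b k)).1; pose bm k := (divn q m (a k) (b k)).2.
  have P k := divnP oO d0 m (tab k).
  have sam k : smooth_on O (am k) by have [[]] := P k.
  have sbm k : smooth_on O (bm k) by have [[]] := P k.
  have ES p' : sum_abs2 am bm p' = S p' / dist2 q p' ^+ m.
    by rewrite /S /sum_abs2 mulr_suml; apply: eq_bigr => k _; have [_ ->] := P k.
  have ET p' : O p' -> sum_dbar2 am bm p' = sum_dbar2 a b p' / dist2 q p' ^+ m.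
    move=> Op'; rewrite /sum_dbar2 mulr_suml; apply: eq_bigr => k _.
    by have [_ _ ->] := P k.
  have i0 p' : 0 <= (dist2 q p' ^+ m)^-1.
    by rewrite invr_ge0 exprn_ge0// addr_ge0 ?sqr_ge0.
  have TSm p' : csq q (2 * rho) p' -> sum_dbar2 am bm p' <= C * sum_abs2 am bm p'.
    by move=> Bp; rewrite (ET _ (BO Bp)) ES mulrA ler_wpM2r//; exact: TS.
  have H := cutoff_estimate oO rho0 BO sam sbm TSm Cr.
  have sSm : smooth_on O (sum_abs2 am bm) by exact: smooth_sum_abs2.
  have schi := smooth_plateau q rho oO.
  pose w := (rho ^+ 2) ^+ m.
  have w0 : 0 < w by rewrite !exprn_gt0.
  have h1 : 2 ^+ m * I2c q (2 * rho) (fun p => zeta p * S p) <=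
      w * I2c q (2 * rho) (fun p => plateau q rho p ^+ 2 * sum_abs2 am bm p).
    have s1 : smooth_on O (fun p => plateau q rho p ^+ 2 * sum_abs2 am bm p).
      by apply: smooth_mul => //; exact: smooth_exp.
    rewrite -(I2c_scale oO r0 BO (2 ^+ m) szS) -(I2c_scale oO r0 BO w s1).
    apply: (I2c_le oO r0 BO); [exact: (smooth_scale (2 ^+ m) oO szS)|exact: (smooth_scale w oO s1)|].
    move=> p' _; rewrite ES; have S0 : 0 <= S p' by exact: sum_abs2_ge0.
    have [hz|hz] := pselect (sq q (rho / 2) p'); last first.
      rewrite /zeta sqbump_eq0// mul0r mulr0 mulr_ge0 ?(ltW w0)//.
      by rewrite mulr_ge0 ?sqr_ge0// mulr_ge0.
    have hz' : sq q rho p'.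
      by move: hz => [h1 h2]; split; [apply: lt_trans h1 _|apply: lt_trans h2 _]; have := rho0; lra.
    rewrite plateau1// expr1n mul1r.
    have [E|n0] := eqVneq (dist2 q p') 0.
      have -> : S p' = 0.
        rewrite (dist2_eq0 E) /S /sum_abs2 big1// => k _.
        have [_ _ /(_ q)[|h1 h2]] := tab k; first by split; rewrite subrr normr0.
        by rewrite /abs2 h1 h2 expr0n addr0.
      by rewrite mulr0 mul0r !mulr0.
    have dp : 0 < dist2 q p' ^+ m.
      by rewrite exprn_gt0// lt_neqAle eq_sym n0 addr_ge0 ?sqr_ge0.
    rewrite [leRHS]mulrA ler_pdivlMr// [leLHS](_ : _ = (2 ^+ m * dist2 q p' ^+ m) * (zeta p' * S p')); last by ring.
    apply: ler_pM.
    - by rewrite mulr_ge0 ?(ltW dp)// exprn_ge0.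
    - exact: mulr_ge0.
    - rewrite -exprMn lerXn2r ?nnegrE ?sqr_ge0//; last exact: ball1.
      by rewrite mulr_ge0// addr_ge0 ?sqr_ge0.
    - by rewrite ler_piMl// sqbump_le1.
  have h2 : w * I2c q (2 * rho) (fun p => plateau_grad2 q rho p * sum_abs2 am bm p) <=
      I2c q (2 * rho) (fun p => plateau_grad2 q rho p * S p).
    have s1 : smooth_on O (fun p => plateau_grad2 q rho p * sum_abs2 am bm p) by exact: smooth_mul.
    rewrite -(I2c_scale oO r0 BO w s1); apply: (I2c_le oO r0 BO) => //.
      exact: (smooth_scale w oO s1).
    move=> p' _; rewrite ES; have S0 : 0 <= S p' by exact: sum_abs2_ge0.
    have [hz|hz] := pselect (sq q rho p').
      have [g1 g2] := plateau_flat rho0 hz.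
      by rewrite /plateau_grad2 g1 g2 expr0n addr0 !mul0r mulr0.
    have dp : 0 < dist2 q p' by apply: lt_le_trans (ball2 hz); rewrite exprn_gt0.
    rewrite mulrCA ler_wpM2l ?addr_ge0 ?sqr_ge0// mulrCA ler_piMr//.
    rewrite ler_pdivrMr ?exprn_gt0// mul1r lerXn2r ?nnegrE ?sqr_ge0 ?(ltW dp)//.
    exact: ball2.
  apply: le_trans h1 _; apply: le_trans (_ : w * (64 * rho ^+ 2 * _) <= _).
    by rewrite ler_wpM2l ?(ltW w0)//; exact: H.
  by rewrite mulrCA ler_wpM2l ?h2// mulr_ge0// sqr_ge0.
have I0 : 0 <= I2c q (2 * rho) (fun p => zeta p * S p).
  by rewrite /I2c; apply: I2_ge0 => p' _; rewrite mulr_ge0// sum_abs2_ge0.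
have Iz : I2c q (2 * rho) (fun p => zeta p * S p) = 0.
  apply/eqP; rewrite eq_le I0 andbT leNgt; apply/negP => Ip.
  have [m Hm] : exists m : nat, K < m%:R * I2c q (2 * rho) (fun p => zeta p * S p).
    exists (Num.bound `|K / I2c q (2 * rho) (fun p => zeta p * S p)|).
    by rewrite -ltr_pdivrMr//; apply: le_lt_trans (ler_norm _) _; exact: archi_boundP (normr_ge0 _).
  have := main m; apply/negP; rewrite -ltNge; apply: lt_le_trans Hm _.
  by rewrite ler_wpM2r// -natrX ler_nat ltnW// ltn_expl.
have l1 : q.1 - 2 * rho < q.1 + 2 * rho by have := rho0; lra.
have l2 : q.2 - 2 * rho < q.2 + 2 * rho by have := rho0; lra.
have f0 : zeta p * S p = 0.
  apply: (I2_eq0 l1 l2 oO BO _ _ Iz).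
  - by move=> p' Op'; exact: (smooth_continuous szS Op').
  - by move=> p' _; rewrite mulr_ge0// sum_abs2_ge0.
  - by move: hp => [+ _]; rewrite ltr_norml; have := rho0; lra.
  - by move: hp => [_ +]; rewrite ltr_norml; have := rho0; lra.
move/eqP: f0; rewrite mulf_eq0 gt_eqF/=; last by case: hp; exact: sqbump_gt0.
by move/eqP.
Qed.

End Carleman.

(** * Unique continuation *)
Section Propagation.
Variable R : realType.

(** Every q close enough to p is the centre of a square which contains p and is
   small enough, in terms of C, for the previous lemma. *)
Lemma dbar_propagation (N : nat) (O : set (R * R)) (p : R * R) (C : R) (A : Type)
    (a b : A -> 'I_N -> R * R -> R) :
  open O -> O p -> 0 <= C ->
  (forall l k, smooth_on O (a l k)) -> (forall l k, smooth_on O (b l k)) ->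
  (\near p, forall l, sum_dbar2 (a l) (b l) p <= C * sum_abs2 (a l) (b l) p) ->
  exists2 r : R, 0 < r & forall l q, sq p r q -> (\near q, forall k, a l k q = 0 /\ b l k q = 0) ->
    forall p', sq p r p' -> forall k, a l k p' = 0.
Proof.
move=> oO Op C0 sa sb nT.
have : nbhs p [set q | O q /\ forall l, sum_dbar2 (a l) (b l) q <= C * sum_abs2 (a l) (b l) q].
  exact: (filterI (open_nbhs_nbhs (conj oO Op)) nT).
move=> /nbhs_squareP[s s0 H].
have {}H p' : sq p s p' -> O p' /\ forall l, sum_dbar2 (a l) (b l) p' <= C * sum_abs2 (a l) (b l) p'.
  by move=> [h1 h2]; exact: H.
(* The first bound keeps the square around q inside the one around p, the second
   gives 64 rho^2 C <= 1. *)
pose rho := Num.min (s / 4) (8 * (1 + C))^-1.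
have C1 : 0 < 8 * (1 + C) by lra.
have rho0 : 0 < rho by rewrite lt_min invr_gt0 C1 andbT divr_gt0.
have rs : rho <= s / 4 by rewrite ge_min lexx.
have rC : rho * (8 * (1 + C)) <= 1.
  by rewrite -ler_pdivlMr// mul1r ge_min lexx orbT.
have Cr : 64 * rho ^+ 2 * C <= 1.
  have h : (rho * (8 * (1 + C))) * (rho * (8 * (1 + C))) <= 1 by rewrite mulr_ile1// mulr_ge0// ltW.
  apply: le_trans h; rewrite -subr_ge0.
  suff -> : rho * (8 * (1 + C)) * (rho * (8 * (1 + C))) - 64 * rho ^+ 2 * C
    = 64 * rho ^+ 2 * (1 + C + C ^+ 2) 
    by have h1 := sqr_ge0 C; apply: mulr_ge0; [apply: mulr_ge0; rewrite ?sqr_ge0|lra].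
  by ring.
exists (rho / 4); first by rewrite divr_gt0.
move=> l q [q1 q2] /nbhs_squareP[d d0 Z] p' [p1 p2] k.
have sub : csq q (2 * rho) `<=` sq p s.
  move=> z /csqP[z1 z2]; split.
    apply: le_lt_trans (ler_distD q.1 _ _) _.
    by apply: lt_le_trans (ler_ltD z1 q1) _; lra.
  apply: le_lt_trans (ler_distD q.2 _ _) _.
  by apply: lt_le_trans (ler_ltD z2 q2) _; lra.
have BO : csq q (2 * rho) `<=` O by move=> z /sub/H[].
have TS z : csq q (2 * rho) z -> sum_dbar2 (a l) (b l) z <= C * sum_abs2 (a l) (b l) z.
  by move=> /sub/H[_ +]; apply.
have tab i : tame O q d (a l i) (b l i) by split => // z [h1 h2]; exact: Z.
have /eqP : sum_abs2 (a l) (b l) p' = 0.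
  apply: (carleman oO rho0 BO d0 Cr tab TS).
  split; [apply: le_lt_trans (ler_distD p.1 _ _) _|apply: le_lt_trans (ler_distD p.2 _ _) _].
    by rewrite (distrC p.1); have := ltrD p1 q1; lra.
  by rewrite (distrC p.2); have := ltrD p2 q2; lra.
rewrite /sum_abs2 psumr_eq0; last by move=> i _; exact: abs2_ge0.
move=> /allP /(_ k (mem_index_enum _)); rewrite /= paddr_eq0 ?sqr_ge0// !sqrf_eq0.
by move=> /andP[/eqP].
Qed.

End Propagation.

Section UniqueContinuation.
Variables (R : realType) (m : nat) (O : set (R * R)) (Y : R * R -> 'rV[R]_m.+1).
Hypothesis nl : null_lift O Y.
Hypothesis EL : forall q, O q -> projn Y q (ELv Y q) = 0.
Let oO := nl_open nl.
Let sY := nl_smooth nl.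

Section Annihilate.
Variables (l : 'rV[R]_m.+1).
Implicit Types f : R * R -> 'rV[R]_m.+1.

Lemma dx_lorr f p : smooth_on O f -> O p -> dx (fun q => lor l (f q)) p = lor l (dx f p).
Proof.
move=> sf Op; have sl : smooth_on O (fun=> l) by exact: smooth_cst.
by rewrite (dx_lor Op sl sf) dx_cst lor0l add0r.
Qed.
Lemma dy_lorr f p : smooth_on O f -> O p -> dy (fun q => lor l (f q)) p = lor l (dy f p).
Proof.
move=> sf Op; have sl : smooth_on O (fun=> l) by exact: smooth_cst.
by rewrite (dy_lor Op sl sf) dy_cst lor0l add0r.
Qed.
Lemma smooth_lorr f : smooth_on O f -> smooth_on O (fun q => lor l (f q)).
Proof. by move=> sf; apply: smooth_lor => //; exact: smooth_cst. Qed.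

Lemma dx_annihilated (U : set (R * R)) f : open U -> U `<=` O -> smooth_on O f ->
  (forall q, U q -> lor l (f q) = 0) -> forall q, U q -> lor l (dx f q) = 0.
Proof.
move=> oU UO sf f0 q Uq; rewrite -(dx_lorr sf (UO _ Uq)) (dx_on oU f0 Uq).
exact: dx_cst.
Qed.
Lemma dy_annihilated (U : set (R * R)) f : open U -> U `<=` O -> smooth_on O f ->
  (forall q, U q -> lor l (f q) = 0) -> forall q, U q -> lor l (dy f q) = 0.
Proof.
move=> oU UO sf f0 q Uq; rewrite -(dy_lorr sf (UO _ Uq)) (dy_on oU f0 Uq).
exact: dy_cst.
Qed.

End Annihilate.

Let sL := smooth_LY nl.
Let sP := smooth_PY nl.
Let sQ := smooth_QY nl.

(** W = (y, 2 y_z, L, 2 L_z, 4 y_zz) for the component y of Y along l: the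
   Willmore equation closes this into a first-order dbar system. *)
Let re (l : 'rV[R]_m.+1) (k : 'I_5) (q : R * R) : R :=
  nth 0 [:: lor l (Y q); lor l (dx Y q); lor l (LY Y q); lor l (dx (LY Y) q); lor l (PY Y q)] k.
Let im (l : 'rV[R]_m.+1) (k : 'I_5) (q : R * R) : R :=
  nth 0 [:: 0; - lor l (dy Y q); 0; - lor l (dy (LY Y) q); - lor l (QY Y q)] k.

Let sre l k : smooth_on O (re l k).
Proof.
case: k => -[|[|[|[|[|//]]]]] i; rewrite /re /=; apply: smooth_lorr => //; exact: smooth_dx.
Qed.
Let sim l k : smooth_on O (im l k).
Proof.
case: k => -[|[|[|[|[|//]]]]] i; rewrite /im /=; try (exact: smooth_cst);
  apply: smooth_opp => //; apply: smooth_lorr => //; exact: smooth_dy.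
Qed.

Let w q := ELv Y q.
Let c0 q := lor (w q) (LY Y q) / 2 + lor (w q) (Y q) * lor (LY Y q) (LY Y q) / 4.
Let c3 q := lor (w q) (Y q) / 2.
Let bilap l q : O q -> lor l (dx (dx (LY Y)) q) + lor l (dy (dy (LY Y)) q) =
  - pY Y q * lor l (PY Y q) - qY Y q * lor l (QY Y q) + lor (w q) (dx Y q) * lor l (dx Y q)
  + lor (w q) (dy Y q) * lor l (dy Y q) - c3 q * lor l (LY Y q) - c0 q * lor l (Y q).
Proof.
move=> Oq; have : lor l (projn Y q (w q)) = 0 by rewrite (EL Oq) lorC lor0l.
have lw : lor l (w q) = lor l (dx (dx (LY Y)) q) + lor l (dy (dy (LY Y)) q)
    + pY Y q * lor l (PY Y q) + qY Y q * lor l (QY Y q) by rewrite /w /ELv !lorDr !lorZr.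
have E v : lor l (projn Y q v) = lor l v - lor v (dx Y q) * lor l (dx Y q)
    - lor v (dy Y q) * lor l (dy Y q) + (lor v (Y q) / 2) * lor l (LY Y q)
    + (lor v (LY Y q) / 2 + lor v (Y q) * lor (LY Y q) (LY Y q) / 4) * lor l (Y q).
  by rewrite /projn !lorDr !lorNr !lorZr.
rewrite E lw -/(c0 q) -/(c3 q) => h.
by apply/eqP; rewrite -subr_eq0 -[X in _ == X]h; apply/eqP; ring.
Qed.

Let M q := pY Y q ^+ 2 + qY Y q ^+ 2 + lor (w q) (dx Y q) ^+ 2 + lor (w q) (dy Y q) ^+ 2
  + c3 q ^+ 2 + c0 q ^+ 2.

Let cauchy (a1 a2 a3 a4 a5 a6 x1 x2 x3 x4 x5 x6 : R) :
  (- a1 * x1 - a2 * x2 + a3 * x3 + a4 * x4 - a5 * x5 - a6 * x6) ^+ 2 <=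
  (a1 ^+ 2 + a2 ^+ 2 + a3 ^+ 2 + a4 ^+ 2 + a5 ^+ 2 + a6 ^+ 2)
  * (x1 ^+ 2 + x2 ^+ 2 + x3 ^+ 2 + x4 ^+ 2 + x5 ^+ 2 + x6 ^+ 2).
Proof.
rewrite -subr_ge0.
suff -> : (a1 ^+ 2 + a2 ^+ 2 + a3 ^+ 2 + a4 ^+ 2 + a5 ^+ 2 + a6 ^+ 2)
    * (x1 ^+ 2 + x2 ^+ 2 + x3 ^+ 2 + x4 ^+ 2 + x5 ^+ 2 + x6 ^+ 2)
    - (- a1 * x1 - a2 * x2 + a3 * x3 + a4 * x4 - a5 * x5 - a6 * x6) ^+ 2
  = (- a1 * x2 - (- a2) * x1) ^+ 2
    + (- a1 * x3 - (a3) * x1) ^+ 2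
    + (- a1 * x4 - (a4) * x1) ^+ 2
    + (- a1 * x5 - (- a5) * x1) ^+ 2
    + (- a1 * x6 - (- a6) * x1) ^+ 2
    + (- a2 * x3 - (a3) * x2) ^+ 2
    + (- a2 * x4 - (a4) * x2) ^+ 2
    + (- a2 * x5 - (- a5) * x2) ^+ 2
    + (- a2 * x6 - (- a6) * x2) ^+ 2
    + (a3 * x4 - (a4) * x3) ^+ 2
    + (a3 * x5 - (- a5) * x3) ^+ 2
    + (a3 * x6 - (- a6) * x3) ^+ 2
    + (a4 * x5 - (- a5) * x4) ^+ 2
    + (a4 * x6 - (- a6) * x4) ^+ 2
    + (- a5 * x6 - (- a6) * x5) ^+ 2.
  by rewrite !addr_ge0 ?sqr_ge0.
by ring.
Qed.

Let ineq l q : O q -> sum_dbar2 (re l) (im l) q <= (2 + M q) * sum_abs2 (re l) (im l) q.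
Proof.
move=> Oq; rewrite /sum_dbar2 /sum_abs2 !big_ord_recl !big_ord0 /dbar2 /abs2 /dbr /dbi /re /im /=.
have s1 := smooth_dx sY; have s2 := smooth_dy sY.
have s3 := smooth_dx sL; have s4 := smooth_dy sL.
rewrite !dx_cst !dy_cst.
rewrite !(dx_opp Oq (smooth_lorr l _)) // !(dy_opp Oq (smooth_lorr l _))//.
rewrite !dx_lorr // !dy_lorr //.
rewrite (schwarz oO sY Oq) (schwarz oO sL Oq).
have e1 : lor l (dx (dx Y) q) - - lor l (dy (dy Y) q) = lor l (LY Y q).
  by rewrite opprK -lorDr LY.unlock.
have e2 : lor l (dx (PY Y) q) - - lor l (dy (QY Y) q) = lor l (dx (LY Y) q).
  by rewrite opprK -lorDr (L_dx nl Oq).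
have e3 : - lor l (dx (QY Y) q) + lor l (dy (PY Y) q) = - lor l (dy (LY Y) q).
  by rewrite (L_dy nl Oq) lorDr lorNr; ring.
have e4 : (lor l (dx (dx (LY Y)) q) - - lor l (dy (dy (LY Y)) q)) ^+ 2 <= M q *
    (lor l (PY Y q) ^+ 2 + lor l (QY Y q) ^+ 2 + lor l (dx Y q) ^+ 2 + lor l (dy Y q) ^+ 2
     + lor l (LY Y q) ^+ 2 + lor l (Y q) ^+ 2).
  by rewrite opprK (bilap l Oq); exact: cauchy.
rewrite e1 e2 e3 !addNr; move: e4.
move: ((lor l (dx (dx (LY Y)) q) - - lor l (dy (dy (LY Y)) q)) ^+ 2) => E.
have M0 : 0 <= M q by rewrite /M !addr_ge0 ?sqr_ge0.
move: (M q) M0 (lor l (PY Y q)) (lor l (QY Y q)) (lor l (dx Y q)) (lor l (dy Y q)) (lor l (LY Y q))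
  (lor l (Y q)) (lor l (dx (LY Y) q)) (lor l (dy (LY Y) q)).
move=> K K0 f6 f7 f1 f2 f3 f0 f4 f5 HE.
have h := mulr_ge0 K0 (addr_ge0 (sqr_ge0 f4) (sqr_ge0 f5)).
have z0 := sqr_ge0 f0; have z1 := sqr_ge0 f1; have z2 := sqr_ge0 f2; have z3 := sqr_ge0 f3.
have z4 := sqr_ge0 f4; have z5 := sqr_ge0 f5; have z6 := sqr_ge0 f6; have z7 := sqr_ge0 f7.
rewrite !sqrrN subr0 add0r subr0 add0r expr0n !addr0 /=; lra.
Qed.

Let smooth_M : smooth_on O M.
Proof.
have sw : smooth_on O w := smooth_ELv nl.
have s1 := smooth_dx sY; have s2 := smooth_dy sY.
have h1 := smooth_lor oO sw s1; have h2 := smooth_lor oO sw s2.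
have h3 := smooth_lor oO sw sY; have h4 := smooth_lor oO sw sL; have h5 := smooth_lor oO sL sL.
have k (c : R) (f : R * R -> R) : smooth_on O f -> smooth_on O (fun q => f q * c).
  by move=> sf; apply: smooth_mul => //; exact: smooth_cst.
have h6 : smooth_on O c3 by exact: k.
have h7 : smooth_on O c0 by exact: (smooth_add oO (k _ _ h4) (k _ _ (smooth_mul oO h3 h5))).
have h8 := smooth_pY nl; have h9 := smooth_qY nl.
have x8 := smooth_exp 2 oO h8; have x9 := smooth_exp 2 oO h9; have x1 := smooth_exp 2 oO h1.
have x2 := smooth_exp 2 oO h2; have x6 := smooth_exp 2 oO h6; have x7 := smooth_exp 2 oO h7.
exact: (smooth_add oO (smooth_add oO (smooth_add oO (smooth_add oO (smooth_add oO x8 x9) x1) x2) x6) x7).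
Qed.

(** The size r is uniform in l and q: this is what makes the set where a
   linear relation holds locally closed in the surface. *)
Theorem lift_continuation p : O p -> exists2 r : R, 0 < r &
  forall (l : 'rV[R]_m.+1) q, sq p r q -> (\near q, lor l (Y q) = 0) ->
  forall p', sq p r p' -> lor l (Y p') = 0.
Proof.
move=> Op; pose C := 3 + M p.
have M0 q : 0 <= M q by rewrite /M !addr_ge0 ?sqr_ge0.
have C0 : 0 <= C by have := M0 p; rewrite /C; lra.
have nM : nbhs p [set q | O q /\ M q < M p + 1].
  have oN := @open_lt R (M p + 1).
  have Mp : M p < M p + 1 by lra.
  have e1 : nbhs p [set q | M q < M p + 1] := smooth_continuous smooth_M Op (open_nbhs_nbhs (conj oN Mp)).
  exact: (filterI (open_nbhs_nbhs (conj oO Op)) e1).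
have [|r0 r00 H] := @dbar_propagation R 5 O p C 'rV[R]_m.+1 re im oO Op C0 sre sim.
  apply: filterS nM => q [Oq Mq] l; apply: le_trans (ineq l Oq) _.
  by rewrite ler_wpM2r ?sum_abs2_ge0// /C; lra.
have /nbhs_squareP[s s0 sO] := open_nbhs_nbhs (conj oO Op).
exists (Num.min r0 s) => [|l q [q1 q2] Z p' [p1 p2]]; first by rewrite lt_min r00 s0.
move: q1 q2 p1 p2; rewrite !lt_min => /andP[q1 q1'] /andP[q2 q2'] /andP[p1 _] /andP[p2 _].
have Oq := sO q q1' q2'.
have : nbhs q [set q' | O q' /\ lor l (Y q') = 0] by exact: (filterI (open_nbhs_nbhs (conj oO Oq)) Z).
move=> /nbhs_squareP[d d0 hd].
have oU := @open_sq R q d; have UO : sq q d `<=` O by move=> z [z1 z2]; have [] := hd z z1 z2.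
have U0 z : sq q d z -> lor l (Y z) = 0 by move=> [z1 z2]; have [] := hd z z1 z2.
have s1 := smooth_dx sY; have s2 := smooth_dy sY.
have s3 := smooth_dx sL; have s4 := smooth_dy sL.
have U1 := dx_annihilated oU UO sY U0; have U2 := dy_annihilated oU UO sY U0.
have U11 := dx_annihilated oU UO s1 U1; have U12 := dy_annihilated oU UO s1 U1.
have U22 := dy_annihilated oU UO s2 U2.
have U3 z : sq q d z -> lor l (LY Y z) = 0.
  by move=> Uz; rewrite LY.unlock lorDr U11// U22// addr0.
have U4 := dx_annihilated oU UO sL U3; have U5 := dy_annihilated oU UO sL U3.
have U6 z : sq q d z -> lor l (PY Y z) = 0.
  by move=> Uz; rewrite PY.unlock lorDr lorNr U11// U22// subr0.
have U7 z : sq q d z -> lor l (QY Y z) = 0.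
  by move=> Uz; rewrite QY.unlock lorZr U12// mulr0.
have Uq : nbhs q (sq q d).
  by apply: open_nbhs_nbhs; split => //; split; rewrite subrr normr0.
apply: (H l q (conj q1 q2) _ p' (conj p1 p2) ord0).
apply: filterS Uq => z Uz -[[|[|[|[|[|//]]]]] i]; rewrite /re /im /=;
  by rewrite ?U0 ?U1 ?U2 ?U3 ?U4 ?U5 ?U6 ?U7 ?oppr0.
Qed.

End UniqueContinuation.

(** * Linear differential systems *)
Section LinearSystem.
Variable R : realType.

(** Both s exp (-K x) and s exp (K x) are monotone. *)
Lemma gronwall (s ds : R -> R) (a d K : R) :
  (forall x, `|x - a| < d -> is_derive x 1 s (ds x)) ->
  (forall x, `|x - a| < d -> 0 <= s x /\ `|ds x| <= K * s x) -> s a = 0 ->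
  forall x, `|x - a| < d -> s x = 0.
Proof.
move=> Ds H s0 x xa; apply/eqP; rewrite eq_le (H x xa).1 andbT.
have mono (k : R) : (forall y, `|y - a| <= `|x - a| -> (ds y + k * s y) * (x - a) <= 0) -> s x <= 0.
  move=> sgn; pose f (y : R) := s y * expR (k * y).
  have Df y : `|y - a| <= `|x - a| -> is_derive y 1 f ((ds y + k * s y) * expR (k * y)).
    move=> ya; have D1 := Ds y (le_lt_trans ya xa).
    have D3 : is_derive y 1 (fun y : R => k * y) k.
      exact: (is_derive_eq (is_deriveZ _ _) (mulr1 k)).
    have D2 : is_derive y 1 (expR \o (fun y : R => k * y)) (expR (k * y) * k).
      exact: (is_derive_comp1 D3 (is_derive_expR _)).
    apply: (is_derive_eq (is_deriveM D1 D2)).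
    by rewrite /GRing.scale /=; ring.
  have [c ca E] := MVT_dist Df.
  move: E; rewrite (_ : a + (x - a) = x); last by ring.
  rewrite /f s0 mul0r subr0 => E.
  rewrite -(pmulr_lle0 _ (expR_gt0 (k * x))) E mulrAC.
  by rewrite pmulr_lle0 ?expR_gt0// sgn.
have [h|h] := leP a x.
  apply: (mono (- K)) => y ya; have [_] := H y (le_lt_trans ya xa).
  rewrite ler_norml => /andP[_ h1]; apply: mulr_le0_ge0; last by lra.
  by lra.
apply: (mono K) => y ya; have [_] := H y (le_lt_trans ya xa).
rewrite ler_norml => /andP[h1 _]; apply: mulr_ge0_le0; last by lra.
by lra.
Qed.

Variables (N : nat) (g : 'I_N -> R * R -> R) (A B : 'I_N -> 'I_N -> R * R -> R).
Variables (O : set (R * R)) (p0 : R * R).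
Hypotheses (oO : open O) (Op0 : O p0).
Hypotheses (sg : forall i, smooth_on O (g i)).
Hypotheses (sA : forall i j, smooth_on O (A i j)) (sB : forall i j, smooth_on O (B i j)).
Hypothesis gx : forall i p, O p -> dx (g i) p = \sum_j A i j p * g j p.
Hypothesis gy : forall i p, O p -> dy (g i) p = \sum_j B i j p * g j p.

Let S p := \sum_i g i p ^+ 2.
Let sS : smooth_on O S. Proof. by apply: smooth_sum => // i; exact: smooth_exp. Qed.
Let S0 p : 0 <= S p. Proof. by apply: sumr_ge0 => i _; exact: sqr_ge0. Qed.

Let quad (M : 'I_N -> 'I_N -> R) (x : 'I_N -> R) (s : R) : (forall k, x k ^+ 2 <= s) ->
  `|\sum_i 2 * (x i * \sum_j M i j * x j)| <= 2 * (\sum_i \sum_j (1 + M i j ^+ 2)) * s.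
Proof.
move=> h; rewrite [2 * _]mulr_sumr mulr_suml.
apply: le_trans (ler_norm_sum _ _ _) _; apply: ler_sum => i _.
rewrite normrM (ger0_norm (ler0n _ _)) -mulrA; apply: ler_wpM2l => //.
rewrite mulr_sumr mulr_suml; apply: le_trans (ler_norm_sum _ _ _) _; apply: ler_sum => j _.
have [hi hj] := (h i, h j).
rewrite mulrCA normrM.
have m1 : `|M i j| <= 1 + M i j ^+ 2.
  have := sqr_ge0 (1 - `|M i j|); have := normr_ge0 (M i j).
  by rewrite -(real_normK (num_real (M i j))); nra.
have m2 : `|x i * x j| <= s.
  have := sqr_ge0 (x i - x j); have := sqr_ge0 (x i + x j).
  by rewrite ler_norml => *; apply/andP; split; nra.
by apply: ler_pM => //; exact: normr_ge0.
Qed.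

(** Gronwall's inequality for the sum of the squares, along a horizontal and then
   along vertical segments. *)
Lemma linear_system_unique : (forall i, g i p0 = 0) ->
  \near p0, forall i, g i p0 = 0.
Proof.
move=> g0.
pose K p := 2 * (\sum_i \sum_j (1 + A i j p ^+ 2)) + 2 * (\sum_i \sum_j (1 + B i j p ^+ 2)).
have sK : smooth_on O K.
  have sM (M : 'I_N -> 'I_N -> R * R -> R) : (forall i j, smooth_on O (M i j)) ->
      smooth_on O (fun p => 2 * (\sum_i \sum_j (1 + M i j p ^+ 2))).
    move=> sM; apply: smooth_mul => //; first exact: smooth_cst.
    apply: smooth_sum => // i; apply: smooth_sum => // j.
    by apply: smooth_add => //; [exact: smooth_cst|exact: smooth_exp].
  exact: (smooth_add oO (sM _ sA) (sM _ sB)).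
have oN := @open_lt R (K p0 + 1).
have Kp : K p0 < K p0 + 1 by lra.
have nK : nbhs p0 [set q | K q < K p0 + 1] := smooth_continuous sK Op0 (open_nbhs_nbhs (conj oN Kp)).
have : nbhs p0 [set q | O q /\ K q < K p0 + 1] by exact: (filterI (open_nbhs_nbhs (conj oO Op0)) nK).
move=> /nbhs_squareP[d d0 H].
have P0 (M : 'I_N -> 'I_N -> R) : 0 <= \sum_i \sum_j (1 + M i j ^+ 2).
  by apply: sumr_ge0 => i _; apply: sumr_ge0 => j _; rewrite addr_ge0// sqr_ge0.
have le_S p k : g k p ^+ 2 <= S p.
  by rewrite /S (bigD1 k)//= lerDl sumr_ge0// => ? _; exact: sqr_ge0.
have pos (M : 'I_N -> 'I_N -> R * R -> R) p : 0 <= 2 * (\sum_i \sum_j (1 + M i j p ^+ 2)).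
  by rewrite mulr_ge0.
have Sx p : O p -> is_derive p (e1 R) S (\sum_i 2 * (g i p * \sum_j A i j p * g j p)).
  move=> Op; apply: (is_derive_eq (is_dx sS Op)); rewrite /S.
  have -> : (fun p => \sum_i g i p ^+ 2) = \sum_i (fun p => g i p ^+ 2).
    by apply/funext => z; rewrite fct_sumE.
  apply: dx_eq; apply: is_derive_sum => i.
  apply: (is_derive_eq (is_dx (smooth_exp 2 oO (sg i)) Op)).
  have -> : (fun p => g i p ^+ 2) = (fun p => g i p * g i p) by apply/funext => z; rewrite expr2.
  by rewrite (dx_mul Op (sg i) (sg i)) gx//; ring.
have Sy p : O p -> is_derive p (e2 R) S (\sum_i 2 * (g i p * \sum_j B i j p * g j p)).
  move=> Op; apply: (is_derive_eq (is_dy sS Op)); rewrite /S.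
  have -> : (fun p => \sum_i g i p ^+ 2) = \sum_i (fun p => g i p ^+ 2).
    by apply/funext => z; rewrite fct_sumE.
  apply: dy_eq; apply: is_derive_sum => i.
  apply: (is_derive_eq (is_dy (smooth_exp 2 oO (sg i)) Op)).
  have -> : (fun p => g i p ^+ 2) = (fun p => g i p * g i p) by apply/funext => z; rewrite expr2.
  by rewrite (dy_mul Op (sg i) (sg i)) gy//; ring.
have bx p : O p -> K p < K p0 + 1 ->
    `|\sum_i 2 * (g i p * \sum_j A i j p * g j p)| <= (K p0 + 1) * S p.
  move=> Op Kl; apply: le_trans (quad _ (le_S p)) _; apply: ler_wpM2r => //.
  by apply: le_trans (ltW Kl); rewrite lerDl pos.
have by_ p : O p -> K p < K p0 + 1 ->
    `|\sum_i 2 * (g i p * \sum_j B i j p * g j p)| <= (K p0 + 1) * S p.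
  move=> Op Kl; apply: le_trans (quad _ (le_S p)) _; apply: ler_wpM2r => //.
  by apply: le_trans (ltW Kl); rewrite lerDr pos.
have Sp0 : S p0 = 0 by rewrite /S big1// => i _; rewrite g0 expr0n.
have hor u : `|u - p0.1| < d -> S (u, p0.2) = 0.
  apply: (gronwall (ds := fun u => \sum_i 2 * (g i (u, p0.2) * \sum_j A i j (u, p0.2) * g j (u, p0.2)))
    (s := fun u => S (u, p0.2)) (K := K p0 + 1)) => [x xd|x xd|].
  - have [Ox Kx] : O (x, p0.2) /\ K (x, p0.2) < K p0 + 1 by apply: H; rewrite //= subrr normr0.
    exact/is_derive_du/Sx.
  - have [Ox Kx] : O (x, p0.2) /\ K (x, p0.2) < K p0 + 1 by apply: H; rewrite //= subrr normr0.
    by split => //; exact: bx.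
  - by rewrite -[RHS]Sp0; case: (p0).
apply/nbhs_squareP; exists d => // -[u v] /= hu hv.
have : S (u, v) = 0.
  apply: (gronwall (ds := fun v => \sum_i 2 * (g i (u, v) * \sum_j B i j (u, v) * g j (u, v)))
    (s := fun v => S (u, v)) (K := K p0 + 1) (a := p0.2) (d := d)) => [x xd|x xd||//].
  - have [Ox Kx] : O (u, x) /\ K (u, x) < K p0 + 1 by exact: H.
    exact/is_derive_dv/Sy.
  - have [Ox Kx] : O (u, x) /\ K (u, x) < K p0 + 1 by exact: H.
    by split => //; exact: by_.
  - exact: hor.
move=> /eqP; rewrite /S psumr_eq0; last by move=> i _; exact: sqr_ge0.
move=> /allP h i; have := h i (mem_index_enum _).
by rewrite /= sqrf_eq0 => /eqP.
Qed.

End LinearSystem.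

Section Span.
Variables (R : realType) (m : nat) (O : set (R * R)).
Hypothesis oO : open O.
Implicit Types (f g : R * R -> 'rV[R]_m.+1) (a : R * R -> R).

(** Membership in the module generated by the E_i over the smooth functions. *)
Definition spans (N : nat) (E : 'I_N -> R * R -> 'rV[R]_m.+1) f : Prop :=
  exists2 c : 'I_N -> R * R -> R, (forall i, smooth_on O (c i)) &
    forall p, O p -> f p = \sum_i c i p *: E i p.

Section OneFamily.
Variables (N : nat) (E : 'I_N -> R * R -> 'rV[R]_m.+1).

Lemma spans_ext f g : (forall p, O p -> f p = g p) -> spans E g -> spans E f.
Proof. by move=> fg [c sc cE]; exists c => // p Op; rewrite fg// cE. Qed.

Lemma spans_gen i : spans E (E i).
Proof.
exists (fun j _ => (j == i)%:R) => [j|p _]; first exact: smooth_cst.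
by rewrite (bigD1 i)//= eqxx scale1r big1 ?addr0// => j /negPf ->; rewrite scale0r.
Qed.

Lemma spans0 : spans E (fun=> 0).
Proof.
exists (fun _ _ => 0) => [j|p _]; first exact: smooth_cst.
by rewrite big1// => j _; rewrite scale0r.
Qed.

Lemma spans_add f g : spans E f -> spans E g -> spans E (fun p => f p + g p).
Proof.
move=> [c sc cE] [d sd dE]; exists (fun i p => c i p + d i p) => [i|p Op].
  exact: smooth_add.
by rewrite cE// dE// -big_split; apply: eq_bigr => i _; rewrite scalerDl.
Qed.

Lemma spans_scale a f : smooth_on O a -> spans E f -> spans E (fun p => a p *: f p).
Proof.
move=> sa [c sc cE]; exists (fun i p => a p * c i p) => [i|p Op].
  exact: smooth_mul.
by rewrite cE// scaler_sumr; apply: eq_bigr => i _; rewrite scalerA.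
Qed.

Lemma spans_opp f : spans E f -> spans E (fun p => - f p).
Proof.
move=> sf; apply: (@spans_ext _ (fun p => (-1) *: f p)) => [p _|]; first by rewrite scaleN1r.
by apply: (spans_scale (a := fun=> -1)) => //; exact: smooth_cst.
Qed.

Lemma spans_sum (I : Type) (s : seq I) (F : I -> R * R -> 'rV[R]_m.+1) :
  (forall i, spans E (F i)) -> spans E (fun p => \sum_(i <- s) F i p).
Proof.
move=> sF; elim: s => [|i s IH].
  by apply: spans_ext spans0 => p _; rewrite big_nil.
by apply: spans_ext (spans_add (sF i) IH) => p _; rewrite big_cons.
Qed.

End OneFamily.

Lemma spans_trans (N N' : nat) (E : 'I_N -> R * R -> 'rV[R]_m.+1)
    (E' : 'I_N' -> R * R -> 'rV[R]_m.+1) f :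
  (forall i, spans E' (E i)) -> spans E f -> spans E' f.
Proof.
move=> sE [c sc cE]; apply: spans_ext cE _; apply: spans_sum => i.
exact: spans_scale.
Qed.

Lemma is_dx_zscale a f p : smooth_on O a -> smooth_on O f -> O p ->
  is_derive p (e1 R) (fun q => a q *: f q) (a p *: dx f p + dx a p *: f p).
Proof.
move=> sa sf Op; rewrite addrC -(dx_zscale Op sa sf); apply: (is_dx (O := O)) => //.
exact: smooth_zscale.
Qed.
Lemma is_dy_zscale a f p : smooth_on O a -> smooth_on O f -> O p ->
  is_derive p (e2 R) (fun q => a q *: f q) (a p *: dy f p + dy a p *: f p).
Proof.
move=> sa sf Op; rewrite addrC -(dy_zscale Op sa sf); apply: (is_dy (O := O)) => //.
exact: smooth_zscale.
Qed.

Lemma spans_deriv (N N' : nat) (E : 'I_N -> R * R -> 'rV[R]_m.+1)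
    (E' : 'I_N' -> R * R -> 'rV[R]_m.+1) f :
  (forall i, smooth_on O (E i)) -> (forall i, spans E' (E i)) -> spans E f ->
  ((forall i, spans E' (dx (E i))) -> spans E' (dx f)) /\
  ((forall i, spans E' (dy (E i))) -> spans E' (dy f)).
Proof.
move=> sE sEE [c sc cE].
have E1 : (fun p => \sum_i c i p *: E i p) = \sum_i (fun p => c i p *: E i p).
  by apply/funext => z; rewrite fct_sumE.
split=> sD.
  apply: (@spans_ext _ _ _ (fun p => \sum_i (c i p *: dx (E i) p + dx (c i) p *: E i p))).
    move=> p Op; rewrite (dx_on oO cE Op) E1; apply: dx_eq.
    by apply: is_derive_sum => i; exact: is_dx_zscale.
  apply: spans_sum => i; apply: spans_add; first exact: spans_scale.
  by apply: spans_scale => //; exact: smooth_dx.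
apply: (@spans_ext _ _ _ (fun p => \sum_i (c i p *: dy (E i) p + dy (c i) p *: E i p))).
  move=> p Op; rewrite (dy_on oO cE Op) E1; apply: dy_eq.
  by apply: is_derive_sum => i; exact: is_dy_zscale.
apply: spans_sum => i; apply: spans_add; first exact: spans_scale.
by apply: spans_scale => //; exact: smooth_dy.
Qed.

(** The functions lor l (E_i) solve a linear first-order system with smooth
   coefficients. *)
Lemma closed_family_annihilated (N : nat) (E : 'I_N -> R * R -> 'rV[R]_m.+1) p0
    (l : 'rV[R]_m.+1) :
  O p0 -> (forall i, smooth_on O (E i)) ->
  (forall i, spans E (dx (E i)) /\ spans E (dy (E i))) ->
  (forall i, lor l (E i p0) = 0) -> \near p0, forall i, lor l (E i p0) = 0.
Proof.
move=> Op0 sE cE l0.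
have hx i : exists A : 'I_N -> R * R -> R, (forall j, smooth_on O (A j)) /\
    forall p, O p -> dx (E i) p = \sum_j A j p *: E j p.
  by have [[A h1 h2] _] := cE i; exists A.
have hy i : exists A : 'I_N -> R * R -> R, (forall j, smooth_on O (A j)) /\
    forall p, O p -> dy (E i) p = \sum_j A j p *: E j p.
  by have [_ [A h1 h2]] := cE i; exists A.
have [A HA] := choice hx; have [B HB] := choice hy.
have ls (c : 'I_N -> R) (F : 'I_N -> 'rV[R]_m.+1) : lor l (\sum_j c j *: F j) = \sum_j c j * lor l (F j).
  elim/big_ind2: _ => [|x1 x2 y1 y2 <- <-|i _]; first by rewrite lorC lor0l.
    exact: lorDr.
  exact: lorZr.
have sl : smooth_on O (fun=> l) by exact: smooth_cst.
apply: (@linear_system_unique R N (fun i p => lor l (E i p)) A B O p0) => //.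
- by move=> i; exact: smooth_lor.
- by move=> i j; have [] := HA i.
- by move=> i j; have [] := HB i.
- move=> i p Op; rewrite (dx_lor Op sl (sE i)) dx_cst lor0l add0r.
  by have [_ ->//] := HA i; exact: ls.
- move=> i p Op; rewrite (dy_lor Op sl (sE i)) dy_cst lor0l add0r.
  by have [_ ->//] := HB i; exact: ls.
Qed.

End Span.

(** * The rank bound *)
Section SecondDerivatives.
Variables (R : realType) (m : nat) (O : set (R * R)).
Hypothesis oO : open O.
Implicit Types (f g : R * R -> 'rV[R]_m.+1) (a : R * R -> R).

(** 4 f_zz = hessr f - i hessi f. *)
Definition hessr (W : normedModType R) (f : R * R -> W) p := dx (dx f) p - dy (dy f) p.
Definition hessi (W : normedModType R) (f : R * R -> W) p := 2 *: dy (dx f) p.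

(** Leibniz rules; all terms but the first are of lower order in f. *)
Lemma hessr_zscale a f p : smooth_on O a -> smooth_on O f -> O p ->
  hessr (fun q => a q *: f q) p = a p *: hessr f p
    + (hessr a p *: f p + (2 * dx a p) *: dx f p + (- 2 * dy a p) *: dy f p).
Proof.
move=> sa sf Op; rewrite /hessr.
have s1 := smooth_dx sa; have s2 := smooth_dy sa; have s3 := smooth_dx sf; have s4 := smooth_dy sf.
have E1 q : O q -> dx (fun q => a q *: f q) q = dx a q *: f q + a q *: dx f q.
  by move=> Oq; exact: (dx_zscale Oq sa sf).
have E2 q : O q -> dy (fun q => a q *: f q) q = dy a q *: f q + a q *: dy f q.
  by move=> Oq; exact: (dy_zscale Oq sa sf).
rewrite (dx_on oO E1 Op) (dy_on oO E2 Op).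
rewrite (dx_add Op (smooth_zscale oO s1 sf) (smooth_zscale oO sa s3)).
rewrite (dy_add Op (smooth_zscale oO s2 sf) (smooth_zscale oO sa s4)).
rewrite (dx_zscale Op s1 sf) (dx_zscale Op sa s3) (dy_zscale Op s2 sf) (dy_zscale Op sa s4).
move: (dx (dx a) p) (dy (dy a) p) (dx a p) (dy a p) (a p) => axx ayy ax ay a0.
move: (dx (dx f) p) (dy (dy f) p) (dx f p) (dy f p) (f p) => fxx fyy fx fy f0.
by apply/rowP => i; rewrite !mxE; ring.
Qed.

Lemma hessi_zscale a f p : smooth_on O a -> smooth_on O f -> O p ->
  hessi (fun q => a q *: f q) p = a p *: hessi f p
    + (hessi a p *: f p + (2 * dx a p) *: dy f p + (2 * dy a p) *: dx f p).
Proof.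
move=> sa sf Op; rewrite /hessi.
have s1 := smooth_dx sa; have s3 := smooth_dx sf.
have E1 q : O q -> dx (fun q => a q *: f q) q = dx a q *: f q + a q *: dx f q.
  by move=> Oq; exact: (dx_zscale Oq sa sf).
rewrite (dy_on oO E1 Op).
rewrite (dy_add Op (smooth_zscale oO s1 sf) (smooth_zscale oO sa s3)).
rewrite (dy_zscale Op s1 sf) (dy_zscale Op sa s3).
move: (dy (dx a) p) (dx a p) (dy a p) (a p) => axy ax ay a0.
move: (dy (dx f) p) (dx f p) (dy f p) (f p) => fxy fx fy f0.
by apply/rowP => i; rewrite !mxE /GRing.scale /=; ring.
Qed.

Lemma hessr_add f g p : smooth_on O f -> smooth_on O g -> O p ->
  hessr (fun q => f q + g q) p = hessr f p + hessr g p.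
Proof.
move=> sf sg Op; rewrite /hessr.
have E1 q : O q -> dx (fun q => f q + g q) q = dx f q + dx g q by move=> Oq; exact: (dx_add Oq sf sg).
have E2 q : O q -> dy (fun q => f q + g q) q = dy f q + dy g q by move=> Oq; exact: (dy_add Oq sf sg).
rewrite (dx_on oO E1 Op) (dy_on oO E2 Op).
rewrite (dx_add Op (smooth_dx sf) (smooth_dx sg)) (dy_add Op (smooth_dy sf) (smooth_dy sg)).
by apply/rowP => i; rewrite !mxE; ring.
Qed.

Lemma hessi_add f g p : smooth_on O f -> smooth_on O g -> O p ->
  hessi (fun q => f q + g q) p = hessi f p + hessi g p.
Proof.
move=> sf sg Op; rewrite /hessi.
have E1 q : O q -> dx (fun q => f q + g q) q = dx f q + dx g q by move=> Oq; exact: (dx_add Oq sf sg).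
by rewrite (dy_on oO E1 Op) (dy_add Op (smooth_dx sf) (smooth_dx sg)) scalerDr.
Qed.

Lemma hessr_on f g p : (forall q, O q -> f q = g q) -> O p -> hessr f p = hessr g p.
Proof.
move=> fg Op; rewrite /hessr.
have E1 q : O q -> dx f q = dx g q by move=> Oq; exact: (dx_on oO fg Oq).
have E2 q : O q -> dy f q = dy g q by move=> Oq; exact: (dy_on oO fg Oq).
by rewrite (dx_on oO E1 Op) (dy_on oO E2 Op).
Qed.
Lemma hessi_on f g p : (forall q, O q -> f q = g q) -> O p -> hessi f p = hessi g p.
Proof.
move=> fg Op; rewrite /hessi.
have E1 q : O q -> dx f q = dx g q by move=> Oq; exact: (dx_on oO fg Oq).
by rewrite (dy_on oO E1 Op).
Qed.

Lemma hessr_lap_x f p : smooth_on O f -> O p ->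
  dx (fun q => dx (dx f) q + dy (dy f) q) p = dx (hessr f) p + dy (hessi f) p.
Proof.
move=> sf Op; have s1 := smooth_dx sf; have s2 := smooth_dy sf.
have s11 := smooth_dx s1; have s12 := smooth_dy s1; have s22 := smooth_dy s2.
rewrite (dx_add Op s11 s22) /hessr /hessi (dx_sub Op s11 s22) (dy_scale Op 2 s12).
have E q : O q -> dy (dx f) q = dx (dy f) q by move=> Oq; exact: (schwarz oO sf Oq).
rewrite (dy_on oO E Op) (schwarz oO s2 Op).
move: (dx (dx (dx f)) p) (dx (dy (dy f)) p) => u v.
by apply/rowP => i; rewrite !mxE; ring.
Qed.
Lemma hessr_lap_y f p : smooth_on O f -> O p ->
  dy (fun q => dx (dx f) q + dy (dy f) q) p = dx (hessi f) p - dy (hessr f) p.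
Proof.
move=> sf Op; have s1 := smooth_dx sf; have s2 := smooth_dy sf.
have s11 := smooth_dx s1; have s12 := smooth_dy s1; have s22 := smooth_dy s2.
rewrite (dy_add Op s11 s22) /hessr /hessi (dy_sub Op s11 s22) (dx_scale Op 2 s12).
rewrite (schwarz oO s1 Op).
move: (dx (dy (dx f)) p) (dy (dy (dy f)) p) => u v.
by apply/rowP => i; rewrite !mxE; ring.
Qed.

End SecondDerivatives.

Section Closure.
Variables (R : realType) (m : nat) (O : set (R * R)) (Y : R * R -> 'rV[R]_m.+1).
Hypothesis nl : null_lift O Y.
Hypothesis EL : forall q, O q -> projn Y q (ELv Y q) = 0.
Let oO := nl_open nl.
Let sY := nl_smooth nl.
Let sL := smooth_LY nl.
Let sP := smooth_PY nl.
Let sQ := smooth_QY nl.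

(** Both equations come from differentiating the Codazzi equations once more. *)
Lemma codazzi_bilap p : O p ->
  hessr (PY Y) p + hessi (QY Y) p = dx (dx (LY Y)) p + dy (dy (LY Y)) p.
Proof.
move=> Op; rewrite (dx_on oO (L_dx nl) Op) (dy_on oO (L_dy nl) Op) /hessr /hessi.
have s1 := smooth_dx sP; have s2 := smooth_dy sP; have s3 := smooth_dx sQ; have s4 := smooth_dy sQ.
rewrite (dx_add Op s1 s4) (dy_sub Op s3 s2) (schwarz oO sQ Op).
move: (dx (dx (PY Y)) p) (dy (dy (PY Y)) p) (dx (dy (QY Y)) p) => u v w.
by apply/rowP => i; rewrite !mxE; ring.
Qed.

Lemma codazzi_curl p : O p -> hessi (PY Y) p = hessr (QY Y) p.
Proof.
move=> Op; have := schwarz oO sL Op.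
rewrite (dy_on oO (L_dx nl) Op) (dx_on oO (L_dy nl) Op) /hessr /hessi.
have s1 := smooth_dx sP; have s2 := smooth_dy sP; have s3 := smooth_dx sQ; have s4 := smooth_dy sQ.
rewrite (dy_add Op s1 s4) (dx_sub Op s3 s2) (schwarz oO sP Op).
move: (dx (dx (QY Y)) p) (dx (dy (PY Y)) p) (dy (dy (QY Y)) p) => u v w /rowP h.
by apply/rowP => i; have := h i; rewrite !mxE => hi; lra.
Qed.

Variables (xi : R * R -> 'rV[R]_m.+1) (a b c e : R * R -> R).
Hypotheses (sxi : smooth_on O xi) (sa : smooth_on O a) (sb : smooth_on O b)
  (sc : smooth_on O c) (se : smooth_on O e).
Hypothesis HP : forall p, O p -> PY Y p = a p *: xi p + c p *: Y p.
Hypothesis HQ : forall p, O p -> QY Y p = b p *: xi p + e p *: Y p.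

(** The fields of order lower than that of the Laplacian of xi. *)
Definition jets7 (i : 'I_7) : R * R -> 'rV[R]_m.+1 :=
  nth (fun=> 0) [:: Y; dx Y; dy Y; LY Y; xi; dx xi; dy xi] i.
Definition laplacian (f : R * R -> 'rV[R]_m.+1) q := dx (dx f) q + dy (dy f) q.
Definition jets8 (i : 'I_8) : R * R -> 'rV[R]_m.+1 :=
  nth (fun=> 0) [:: Y; dx Y; dy Y; LY Y; xi; dx xi; dy xi; laplacian xi] i.

Let sY1 := smooth_dx sY.
Let sY2 := smooth_dy sY.
Let sx1 := smooth_dx sxi.
Let sx2 := smooth_dy sxi.

Let slap : smooth_on O (laplacian xi).
Proof. exact: (smooth_add oO (smooth_dx sx1) (smooth_dy sx2)). Qed.

Lemma smooth_jets8 i : smooth_on O (jets8 i).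
Proof. by case: i => -[|[|[|[|[|[|[|[|//]]]]]]]] i; rewrite /jets8 /=. Qed.

Local Notation sp7 := (spans O jets7).
Local Notation sp8 := (spans O jets8).
Let g0 : sp7 Y. Proof. exact: (spans_gen O jets7 (Ordinal (isT : 0 < 7)%N)). Qed.
Let g1 : sp7 (dx Y). Proof. exact: (spans_gen O jets7 (Ordinal (isT : 1 < 7)%N)). Qed.
Let g2 : sp7 (dy Y). Proof. exact: (spans_gen O jets7 (Ordinal (isT : 2 < 7)%N)). Qed.
Let g3 : sp7 (LY Y). Proof. exact: (spans_gen O jets7 (Ordinal (isT : 3 < 7)%N)). Qed.
Let g4 : sp7 xi. Proof. exact: (spans_gen O jets7 (Ordinal (isT : 4 < 7)%N)). Qed.
Let g5 : sp7 (dx xi). Proof. exact: (spans_gen O jets7 (Ordinal (isT : 5 < 7)%N)). Qed.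
Let g6 : sp7 (dy xi). Proof. exact: (spans_gen O jets7 (Ordinal (isT : 6 < 7)%N)). Qed.
Let g7 : sp8 (laplacian xi). Proof. exact: (spans_gen O jets8 (Ordinal (isT : 7 < 8)%N)). Qed.
Let s78 f : sp7 f -> sp8 f.
Proof.
apply: spans_trans => // i; have g := spans_gen O jets8 (widen_ord (leqnSn 7) i); move: g.
by case: i => -[|[|[|[|[|[|[|//]]]]]]] i.
Qed.

Let cZ (N : nat) (E : 'I_N -> R * R -> 'rV[R]_m.+1) (k : R) f : spans O E f -> spans O E (fun p => k *: f p).
Proof. by move=> sf; apply: (spans_scale oO (a := fun=> k)) => //; exact: smooth_cst. Qed.

Let spP : sp7 (PY Y).
Proof. by apply: spans_ext HP _; apply: spans_add => //; exact: spans_scale. Qed.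
Let spQ : sp7 (QY Y).
Proof. by apply: spans_ext HQ _; apply: spans_add => //; exact: spans_scale. Qed.

Let hess_Y p : O p -> hessr Y p = PY Y p /\ hessi Y p = QY Y p.
Proof. by move=> Op; rewrite /hessr /hessi PY.unlock QY.unlock. Qed.

Let lowr (k : R * R -> R) (f : R * R -> 'rV[R]_m.+1) p :=
  hessr k p *: f p + (2 * dx k p) *: dx f p + (- 2 * dy k p) *: dy f p.
Let lowi (k : R * R -> R) (f : R * R -> 'rV[R]_m.+1) p :=
  hessi k p *: f p + (2 * dx k p) *: dy f p + (2 * dy k p) *: dx f p.

Let sp_low k f : smooth_on O k -> sp7 f -> sp7 (dx f) -> sp7 (dy f) ->
  sp7 (lowr k f) /\ sp7 (lowi k f).
Proof.
move=> sk h h1 h2; have k1 := smooth_dx sk; have k2 := smooth_dy sk.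
have r1 (d : R) (w : R * R -> R) : smooth_on O w -> smooth_on O (fun p => d * w p).
  by move=> sw; exact: (smooth_scale d oO sw).
have s1 : smooth_on O (hessr k) by exact: (smooth_subr oO (smooth_dx k1) (smooth_dy k2)).
have s2 : smooth_on O (hessi k) by exact: (smooth_scale 2 oO (smooth_dy k1)).
by split; apply: spans_add => //; try apply: spans_add => //; apply: spans_scale => //; exact: r1.
Qed.

Let comb (k d : R * R -> R) (F : R * R -> 'rV[R]_m.+1) : smooth_on O k -> smooth_on O d ->
  (forall p, O p -> F p = k p *: xi p + d p *: Y p) ->
  exists r i : R * R -> 'rV[R]_m.+1, [/\ sp7 r, sp7 i,
    forall p, O p -> hessr F p = k p *: hessr xi p + r p &
    forall p, O p -> hessi F p = k p *: hessi xi p + i p].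
Proof.
move=> sk sd E; have [l1 l2] := sp_low sk g4 g5 g6; have [l3 l4] := sp_low sd g0 g1 g2.
have z1 := smooth_zscale oO sk sxi; have z2 := smooth_zscale oO sd sY.
exists (fun p => lowr k xi p + (d p *: PY Y p + lowr d Y p)).
exists (fun p => lowi k xi p + (d p *: QY Y p + lowi d Y p)); split.
- by apply: spans_add => //; apply: spans_add => //; exact: spans_scale.
- by apply: spans_add => //; apply: spans_add => //; exact: spans_scale.
- move=> p Op; rewrite (hessr_on oO E Op) (hessr_add oO z1 z2 Op).
  rewrite (hessr_zscale oO sk sxi Op) (hessr_zscale oO sd sY Op) (hess_Y Op).1.
  by rewrite -addrA.
- move=> p Op; rewrite (hessi_on oO E Op) (hessi_add oO z1 z2 Op).
  rewrite (hessi_zscale oO sk sxi Op) (hessi_zscale oO sd sY Op) (hess_Y Op).2.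
  by rewrite -addrA.
Qed.

Let sp_bilap : sp7 (fun p => dx (dx (LY Y)) p + dy (dy (LY Y)) p).
Proof.
pose w q := ELv Y q.
have sw : smooth_on O w := smooth_ELv nl.
have h1 := smooth_lor oO sw sY1; have h2 := smooth_lor oO sw sY2.
have h3 := smooth_lor oO sw sY; have h4 := smooth_lor oO sw sL; have h5 := smooth_lor oO sL sL.
have k (d : R) (f : R * R -> R) : smooth_on O f -> smooth_on O (fun q => f q * d).
  by move=> sf; apply: smooth_mul => //; exact: smooth_cst.
have h6 : smooth_on O (fun q => lor (w q) (Y q) / 2) by exact: k.
have h7 : smooth_on O (fun q => lor (w q) (LY Y q) / 2 + lor (w q) (Y q) * lor (LY Y q) (LY Y q) / 4).
  by exact: (smooth_add oO (k _ _ h4) (k _ _ (smooth_mul oO h3 h5))).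
have h8 := smooth_pY nl; have h9 := smooth_qY nl.
apply: (@spans_ext _ _ _ _ _ _ (fun q => lor (w q) (dx Y q) *: dx Y q + lor (w q) (dy Y q) *: dy Y q
  + (- ((lor (w q) (Y q) / 2) *: LY Y q) + (- ((lor (w q) (LY Y q) / 2 +
     lor (w q) (Y q) * lor (LY Y q) (LY Y q) / 4) *: Y q)
  + (- (pY Y q *: PY Y q) + - (qY Y q *: QY Y q)))))).
  move=> q Oq; have := EL Oq; rewrite /projn -/(w q).
  have : w q = dx (dx (LY Y)) q + dy (dy (LY Y)) q + pY Y q *: PY Y q + qY Y q *: QY Y q by [].
  move: (w q) (dx (dx (LY Y)) q) (dy (dy (LY Y)) q) (pY Y q) (qY Y q) (PY Y q) (QY Y q) (LY Y q).
  move=> W u v p1 q1 P1 Q1 L1.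
  move: (lor W (dx Y q)) (lor W (dy Y q)) (lor W (Y q)) (lor W L1) (lor L1 L1) => n1 n2 n3 n4 n5 E1.
  rewrite E1 => /rowP h; apply/rowP => i; have := h i; rewrite !mxE => hi.
  by apply/eqP; rewrite -subr_eq0 -[X in _ == X]hi; apply/eqP; ring.
by do ?[apply: spans_add => //]; do ?[apply: spans_opp => //]; exact: spans_scale.
Qed.

(** Modulo lower order jets, the Willmore equation reads a A + b B = 0 and the
   Codazzi equation a B - b A = 0, where A = hessr xi and B = hessi xi.  The
   determinant of this linear system is a^2 + b^2. *)
Lemma hess_spans : (forall p, O p -> a p ^+ 2 + b p ^+ 2 != 0) ->
  sp7 (hessr xi) /\ sp7 (hessi xi).
Proof.
move=> ab; have [rP [iP [s1 s2 EP1 EP2]]] := comb sa sc HP.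
have [rQ [iQ [s3 s4 EQ1 EQ2]]] := comb sb se HQ.
pose D p := (a p ^+ 2 + b p ^+ 2)^-1.
have sD : smooth_on O D.
  by apply: (smooth_inv oO ab); exact: (smooth_add oO (smooth_exp 2 oO sa) (smooth_exp 2 oO sb)).
pose o1 p := (dx (dx (LY Y)) p + dy (dy (LY Y)) p) + (- rP p + - iQ p).
pose o2 p := rQ p + - iP p.
have so1 : sp7 o1 by apply: spans_add => //; apply: spans_add => //; exact: spans_opp.
have so2 : sp7 o2 by apply: spans_add => //; exact: spans_opp.
have e1 p : O p -> a p *: hessr xi p + b p *: hessi xi p = o1 p.
  move=> Op; rewrite /o1 -codazzi_bilap// EP1// EQ2//.
  by apply/rowP => i; rewrite !mxE; ring.
have e2 p : O p -> a p *: hessi xi p - b p *: hessr xi p = o2 p.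
  move=> Op; have := codazzi_curl Op; rewrite EP2// EQ1// /o2 => /rowP h.
  by apply/rowP => i; have := h i; rewrite !mxE => hi; lra.
have k d f : smooth_on O d -> sp7 f -> sp7 (fun p => (D p * d p) *: f p).
  by move=> sd sf; apply: spans_scale => //; exact: smooth_mul.
split.
  apply: (@spans_ext _ _ _ _ _ _ (fun p => (D p * a p) *: o1 p + - ((D p * b p) *: o2 p))).
    move=> p Op; rewrite -e1// -e2// /D; have := ab p Op.
    by move=> h; apply/rowP => i; rewrite !mxE; field.
  by apply: spans_add => //; [|apply: spans_opp => //]; apply: k.
apply: (@spans_ext _ _ _ _ _ _ (fun p => (D p * b p) *: o1 p + (D p * a p) *: o2 p)).
  move=> p Op; rewrite -e1// -e2// /D; have := ab p Op.
  by move=> h; apply/rowP => i; rewrite !mxE; field.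
by apply: spans_add => //; apply: k.
Qed.

(** The Laplacian of xi is the only second order field that has to be added:
   its first derivatives are combinations of the first derivatives of hessr xi
   and hessi xi. *)
Lemma jets8_closed : sp7 (hessr xi) -> sp7 (hessi xi) ->
  forall i, sp8 (dx (jets8 i)) /\ sp8 (dy (jets8 i)).
Proof.
move=> hr hi.
have hxx : sp8 (dx (dx xi)).
  apply: (@spans_ext _ _ _ _ _ _ (fun p => 2^-1 *: (laplacian xi p + hessr xi p))).
    by move=> p Op; apply/rowP => i; rewrite /laplacian /hessr !mxE; field.
  by apply: cZ; apply: spans_add => //; exact: s78.
have hyy : sp8 (dy (dy xi)).
  apply: (@spans_ext _ _ _ _ _ _ (fun p => 2^-1 *: (laplacian xi p + - hessr xi p))).
    by move=> p Op; apply/rowP => i; rewrite /laplacian /hessr !mxE; field.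
  by apply: cZ; apply: spans_add => //; apply: spans_opp => //; exact: s78.
have hxy : sp8 (dy (dx xi)).
  apply: (@spans_ext _ _ _ _ _ _ (fun p => 2^-1 *: hessi xi p)).
    by move=> p Op; apply/rowP => i; rewrite /hessi !mxE; field.
  by apply: cZ; exact: s78.
have hyx : sp8 (dx (dy xi)).
  by apply: spans_ext hxy => p Op; rewrite (schwarz oO sxi Op).
have yxx : sp8 (dx (dx Y)).
  apply: (@spans_ext _ _ _ _ _ _ (fun p => 2^-1 *: (LY Y p + PY Y p))).
    by move=> p Op; exact: Yxx_LP.
  by apply: cZ; apply: spans_add => //; exact: s78.
have yyy : sp8 (dy (dy Y)).
  apply: (@spans_ext _ _ _ _ _ _ (fun p => 2^-1 *: (LY Y p + - PY Y p))).
    by move=> p Op; exact: Yyy_LP.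
  by apply: cZ; apply: spans_add => //; [|apply: spans_opp => //]; exact: s78.
have yxy : sp8 (dy (dx Y)).
  apply: (@spans_ext _ _ _ _ _ _ (fun p => 2^-1 *: QY Y p)).
    by move=> p Op; exact: Yxy_Q.
  by apply: cZ; exact: s78.
have yyx : sp8 (dx (dy Y)).
  by apply: spans_ext yxy => p Op; rewrite (schwarz oO sY Op).
have h0 := s78 g0; have h1 := s78 g1; have h2 := s78 g2; have h3 := s78 g3.
have h4 := s78 g4; have h5 := s78 g5; have h6 := s78 g6.
have d2 (k d : R * R -> R) : smooth_on O k -> smooth_on O d ->
    sp8 (dx (fun p => k p *: xi p + d p *: Y p)) /\ sp8 (dy (fun p => k p *: xi p + d p *: Y p)).
  move=> sk sd; have z1 := smooth_zscale oO sk sxi; have z2 := smooth_zscale oO sd sY.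
  have k1 := smooth_dx sk; have k2 := smooth_dy sk; have e1 := smooth_dx sd; have e2 := smooth_dy sd.
  split.
    apply: (@spans_ext _ _ _ _ _ _ (fun p => (dx k p *: xi p + k p *: dx xi p) + (dx d p *: Y p + d p *: dx Y p))).
      by move=> p Op; rewrite (dx_add Op z1 z2) (dx_zscale Op sk sxi) (dx_zscale Op sd sY).
    by apply: spans_add => //; apply: spans_add => //; exact: spans_scale.
  apply: (@spans_ext _ _ _ _ _ _ (fun p => (dy k p *: xi p + k p *: dy xi p) + (dy d p *: Y p + d p *: dy Y p))).
    by move=> p Op; rewrite (dy_add Op z1 z2) (dy_zscale Op sk sxi) (dy_zscale Op sd sY).
  by apply: spans_add => //; apply: spans_add => //; exact: spans_scale.
have [Px Py] := d2 _ _ sa sc; have [Qx Qy] := d2 _ _ sb se.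
have {}Px : sp8 (dx (PY Y)) by apply: spans_ext Px => p Op; exact: (dx_on oO HP Op).
have {}Py : sp8 (dy (PY Y)) by apply: spans_ext Py => p Op; exact: (dy_on oO HP Op).
have {}Qx : sp8 (dx (QY Y)) by apply: spans_ext Qx => p Op; exact: (dx_on oO HQ Op).
have {}Qy : sp8 (dy (QY Y)) by apply: spans_ext Qy => p Op; exact: (dy_on oO HQ Op).
have Lx : sp8 (dx (LY Y)) by apply: spans_ext (L_dx nl) _; exact: spans_add.
have Ly : sp8 (dy (LY Y)) by apply: spans_ext (L_dy nl) _; apply: spans_add => //; exact: spans_opp.
have s7 i : smooth_on O (jets7 i).
  by case: i => -[|[|[|[|[|[|[|//]]]]]]] i; rewrite /jets7 /=.
have e7 i : sp8 (jets7 i) by apply: s78; exact: spans_gen.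
have x7 i : sp8 (dx (jets7 i)) by case: i => -[|[|[|[|[|[|[|//]]]]]]] i; rewrite /jets7 /=.
have y7 i : sp8 (dy (jets7 i)) by case: i => -[|[|[|[|[|[|[|//]]]]]]] i; rewrite /jets7 /=.
have [/(_ x7) rx /(_ y7) ry] := spans_deriv oO s7 e7 hr.
have [/(_ x7) ix /(_ y7) iy] := spans_deriv oO s7 e7 hi.
have lx : sp8 (dx (laplacian xi)).
  by apply: (spans_ext (fun p Op => hessr_lap_x oO sxi Op)); exact: spans_add.
have ly : sp8 (dy (laplacian xi)).
  apply: (spans_ext (fun p Op => hessr_lap_y oO sxi Op)); apply: spans_add => //.
  exact: spans_opp.
by case=> -[|[|[|[|[|[|[|[|//]]]]]]]] i; rewrite /jets8 /=; split.
Qed.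

End Closure.

Section Rank.
Variables (R : realType) (m : nat) (O : set (R * R)) (Y : R * R -> 'rV[R]_m.+1).
Hypothesis nl : null_lift O Y.
Hypothesis EL : forall q, O q -> projn Y q (ELv Y q) = 0.
Hypothesis flatPQ : forall p, O p -> lor (PY Y p) (QY Y p) ^+ 2 = lor (PY Y p) (PY Y p) * lor (QY Y p) (QY Y p).
Let oO := nl_open nl.
Let sP := smooth_PY nl.
Let sQ := smooth_QY nl.

Lemma null_lift_sub (U : set (R * R)) : open U -> U `<=` O -> null_lift U Y.
Proof.
case: nl => _ sY h1 h2 h3 h4 h5 h6 oU UO; split => //.
- exact: smooth_sub UO sY.
- by move=> p /UO; exact: h1.
- by move=> p /UO; exact: h2.
- by move=> p /UO; exact: h3.
- by move=> p /UO; exact: h4.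
- by move=> p w /UO; exact: h5.
- by move=> p w /UO; exact: h6.
Qed.

(** Near some point Y takes its values in a space of dimension at most 8.  The
   space is given through its annihilators because these are what unique
   continuation propagates. *)
Definition rank_le8 := exists2 p0, O p0 & exists E : 'I_8 -> 'rV[R]_m.+1,
  forall l, (forall i, lor l (E i) = 0) -> \near p0, lor l (Y p0) = 0.

(** In the second alternative xi is a placeholder: then P and Q are multiples of Y
   and the four fields Y, Y_x, Y_y, L already form a closed family. *)
Lemma rank_of_normal_form (U : set (R * R)) (xi : R * R -> 'rV[R]_m.+1) (a b c e : R * R -> R) p0 :
  open U -> U `<=` O -> U p0 -> smooth_on U xi -> smooth_on U a -> smooth_on U b ->
  smooth_on U c -> smooth_on U e ->
  (forall p, U p -> PY Y p = a p *: xi p + c p *: Y p) ->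
  (forall p, U p -> QY Y p = b p *: xi p + e p *: Y p) ->
  (forall p, U p -> a p ^+ 2 + b p ^+ 2 != 0) \/ (forall p, U p -> xi p = 0) ->
  rank_le8.
Proof.
move=> oU UO Up sxi sa sb sc se HP HQ ab; have nU := null_lift_sub oU UO.
have EU q : U q -> projn Y q (ELv Y q) = 0 by move=> /UO; exact: EL.
have [h1 h2] : spans U (jets7 Y xi) (hessr xi) /\ spans U (jets7 Y xi) (hessi xi).
  case: ab => [ab|xi0]; first exact: (hess_spans nU EU sxi sa sb sc se HP HQ ab).
  have z := spans0 U (jets7 Y xi).
  split; apply: spans_ext z => p Vp.
    have E : hessr xi p = hessr (fun=> 0) p := hessr_on oU xi0 Vp.
    rewrite E /hessr.
    have [-> ->] : dx (fun=> 0 : 'rV[R]_m.+1) = (fun=> 0) /\ dy (fun=> 0 : 'rV[R]_m.+1) = (fun=> 0).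
      by split; apply/funext => q; rewrite ?dx_cst ?dy_cst.
    by rewrite dx_cst dy_cst subr0.
  have E : hessi xi p = hessi (fun=> 0) p := hessi_on oU xi0 Vp.
  rewrite E /hessi.
  have -> : dx (fun=> 0 : 'rV[R]_m.+1) = (fun=> 0) by apply/funext => q; rewrite dx_cst.
  by rewrite dy_cst scaler0.
exists p0; first exact: UO.
exists (fun i => jets8 Y xi i p0) => l l0.
have cl := jets8_closed nU sxi sa sb sc se HP HQ h1 h2.
have sj := smooth_jets8 nU sxi.
have := closed_family_annihilated oU Up sj cl l0.
by apply: filterS => p /(_ ord0).
Qed.

Let null_normal p w : O p -> lor w (Y p) = 0 -> lor w w = 0 ->
  w = (- lor w (LY Y p) / 2) *: Y p.
Proof.
move=> Op wY ww; have [k wk] := nl_def nl Op wY ww; rewrite {1}wk; congr (_ *: _).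
rewrite wk lorZl lorC (LY_Y nl Op); by field.
Qed.

(** By flatness P and Q are parallel modulo Y.  Hence both are combinations of Y
   and of xi = P near a point where P is not null, of xi = Q if P is null
   everywhere but Q is not, and of Y alone if both are null everywhere. *)
Lemma rank_bound p1 : O p1 -> rank_le8.
Proof.
move=> Op1.
have sPP := smooth_lor oO sP sP; have sPQ := smooth_lor oO sP sQ.
have sp := smooth_pY nl; have sq := smooth_qY nl.
have sh (U : set (R * R)) (f : R * R -> R) : open U -> U `<=` O -> smooth_on O f ->
    smooth_on U (fun p => - f p / 2).
  move=> oU UO sf; have s1 := smooth_opp oU (smooth_sub UO sf).
  by apply: smooth_mul => //; exact: smooth_cst.
have [[p0 [Op0 n0]]|] := pselect (exists p0, O p0 /\ lor (PY Y p0) (PY Y p0) != 0).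
  pose U := [set p | O p /\ lor (PY Y p) (PY Y p) != 0].
  have oU : open U.
    have oN : open [set x : R | x != 0] by exact: open_neq.
    rewrite openE => p [Op hp]; rewrite /interior.
    have nP : nbhs p [set p' | lor (PY Y p') (PY Y p') != 0] :=
      smooth_continuous sPP Op (open_nbhs_nbhs (conj oN hp)).
    exact: (filterI (open_nbhs_nbhs (conj oO Op)) nP).
  have UO : U `<=` O by move=> p [].
  pose h p := lor (PY Y p) (QY Y p) * (lor (PY Y p) (PY Y p))^-1.
  have s1 : smooth_on U h.
    apply: smooth_mul => //; first exact: smooth_sub sPQ.
    by apply: smooth_inv => //; [move=> p []|exact: smooth_sub sPP].
  pose e p := - (qY Y p - h p * pY Y p) / 2.
  have s2 : smooth_on U e.
    have s3 := smooth_subr oU (smooth_sub UO sq) (smooth_mul oU s1 (smooth_sub UO sp)).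
    have s4 := smooth_opp oU s3.
    by apply: smooth_mul => //; exact: smooth_cst.
  apply: (@rank_of_normal_form U (PY Y) (fun=> 1) h (fun=> 0) e p0) => //.
  - exact: smooth_sub sP.
  - exact: smooth_cst.
  - exact: smooth_cst.
  - by move=> p _; rewrite scale1r scale0r addr0.
  - move=> p [Op hp].
    have z1 : lor (QY Y p - h p *: PY Y p) (Y p) = 0.
      by rewrite lorDl lorNl lorZl (QY_Y nl Op) (PY_Y nl Op) mulr0 subr0.
    have z2 : lor (QY Y p - h p *: PY Y p) (QY Y p - h p *: PY Y p) = 0.
      rewrite !lorE !(lorC (QY Y p) (PY Y p)) /h.
      have := flatPQ Op; move: hp.
      move: (lor (PY Y p) (PY Y p)) (lor (PY Y p) (QY Y p)) (lor (QY Y p) (QY Y p)) => x y z x0 E.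
      have -> : z = y ^+ 2 / x by rewrite E mulrC mulKf.
      by field.
    have := null_normal Op z1 z2; rewrite lorDl lorNl lorZl.
    rewrite (lorC (QY Y p)) (lorC (PY Y p)) -/(pY Y p) -/(qY Y p) -/(e p) => <-.
    by rewrite addrC subrK.
  - by left => p _; rewrite expr1n gt_eqF// ltr_pwDl// sqr_ge0.
move=> /forallNP noP.
have P0 p : O p -> PY Y p = (- pY Y p / 2) *: Y p.
  move=> Op; rewrite {1}(null_normal Op (PY_Y nl Op) _).
    by rewrite /pY lorC.
  by have := noP p => /not_andP[//|/negP]; rewrite negbK => /eqP.
have [[p0 [Op0 n0]]|] := pselect (exists p0, O p0 /\ lor (QY Y p0) (QY Y p0) != 0).
  apply: (@rank_of_normal_form O (QY Y) (fun=> 0) (fun=> 1) (fun p => - pY Y p / 2) (fun=> 0) p0) => //.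
  - exact: smooth_cst.
  - exact: smooth_cst.
  - exact: sh.
  - exact: smooth_cst.
  - by move=> p Op; rewrite scale0r add0r P0.
  - by move=> p _; rewrite scale1r scale0r addr0.
  - by left => p _; rewrite expr1n expr0n add0r oner_eq0.
move=> /forallNP noQ.
have Q0 p : O p -> QY Y p = (- qY Y p / 2) *: Y p.
  move=> Op; rewrite {1}(null_normal Op (QY_Y nl Op) _).
    by rewrite /qY lorC.
  by have := noQ p => /not_andP[//|/negP]; rewrite negbK => /eqP.
apply: (@rank_of_normal_form O (fun=> 0) (fun=> 0) (fun=> 0) (fun p => - pY Y p / 2) (fun p => - qY Y p / 2) p1) => //.
- exact: smooth_cst.
- exact: smooth_cst.
- exact: smooth_cst.
- exact: sh.
- exact: sh.
- by move=> p Op; rewrite scaler0 add0r P0.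
- by move=> p Op; rewrite scaler0 add0r Q0.
- by right.
Qed.

End Rank.

(** * Sphere sections *)
Section LinearAlgebra.
Variables (R : realType) (n : nat).
Implicit Types u v w : 'rV[R]_n.+1.

Lemma dot_mulmx u v : u *m v^T = (dot u v)%:M.
Proof.
apply/matrixP => i j; rewrite !ord1 !mxE eqxx mulr1n.
by apply: eq_bigr => k _; rewrite !mxE.
Qed.

(** Gaussian elimination writes U as a product in which a unit matrix completes
   the rows of U to a basis; L consists of the first k rows of that matrix. *)
Lemma row_free_extension (k j : nat) (U : 'M[R]_(j, n.+1)) : (\rank U <= k <= n.+1)%N ->
  exists L : 'M[R]_(k, n.+1), row_free L /\ (U <= L)%MS.
Proof.
move=> /andP[rk kn]; exists (pid_mx k *m row_ebase U); split.
  by rewrite /row_free mxrankMfree ?row_free_unit ?row_ebase_unit// rank_pid_mx// minnn.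
rewrite -{1}(mulmx_ebase U); apply/submxP.
exists (col_ebase U *m (pid_mx (\rank U)   : 'M[R]_(j, k))).
rewrite -!mulmxA; congr (_ *m _); rewrite mulmxA; congr (_ *m _).
by rewrite mul_pid_mx; congr pid_mx; rewrite (minn_idPl rk); apply/esym/minn_idPr.
Qed.

(** The form being positive definite, the Gram matrix of the rows of L is
   invertible, and c is the component of u orthogonal to them. *)
Lemma orthogonal_split (k : nat) (L : 'M[R]_(k, n.+1)) u : row_free L ->
  exists2 c, (u - c <= L)%MS & forall w, (w <= L)%MS -> dot c w = 0.
Proof.
move=> fL; have uG : L *m L^T \in unitmx.
  rewrite -row_free_unit -kermx_eq0; apply/rowV0P => v /sub_kermxP h.
  have d0 : dot (v *m L) (v *m L) = 0.
    have := dot_mulmx (v *m L) (v *m L); rewrite trmx_mul -mulmxA (mulmxA L) (mulmxA v) h mul0mx.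
    by move=> /matrixP/(_ 0 0); rewrite !mxE eqxx mulr1n.
  by apply/eqP; rewrite -(mulmx_free_eq0 v fL); apply/eqP; exact: dot_eq0.
exists (u - u *m L^T *m invmx (L *m L^T) *m L).
  by rewrite opprB addrC subrK submxMl.
move=> w /submxP[D ->]; have := dot_mulmx (u - u *m L^T *m invmx (L *m L^T) *m L) (D *m L).
have h : (u - u *m L^T *m invmx (L *m L^T) *m L) *m L^T = 0.
  by rewrite mulmxBl -[X in _ - X]mulmxA -[X in _ - X]mulmxA mulVmx// mulmx1 subrr.
rewrite trmx_mul mulmxA h mul0mx.
by move=> /matrixP/(_ 0 0); rewrite !mxE eqxx mulr1n => <-.
Qed.

(** The sphere cuts the affine subspace through c directed by L in the round
   sphere of centre c, the point of the subspace closest to the origin. *)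
Lemma sphere_section (T : Type) (x : T -> 'rV[R]_n.+1) (k : nat) (L : 'M[R]_(k.+1, n.+1)) p0 :
  row_free L -> (forall p, on_sphere (x p)) -> (forall p, (x p - x p0 <= L)%MS) ->
  (exists p, x p != x p0) ->
  exists (c : 'rV[R]_n.+1) (r : R),
    [/\ 0 < r, forall y, round_sphere c r L y -> on_sphere y & forall p, round_sphere c r L (x p)].
Proof.
move=> fL sx xL [p1 x1]; have [c cL c0] := orthogonal_split (x p0) fL.
have xc p : (x p - c <= L)%MS.
  have -> : x p - c = (x p - x p0) + (x p0 - c) by rewrite addrA subrK.
  exact: addmx_sub.
have E y : (y - c <= L)%MS -> dot y y = dot c c + dot (y - c) (y - c).
  move=> /c0; have : y = c + (y - c) by rewrite addrC subrK.
  by move: (y - c) => d -> h; rewrite !dotE (dotC d c) h; ring.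
have xd p : dot (x p - c) (x p - c) = 1 - dot c c.
  by have := E _ (xc p); rewrite (sx p : dot _ _ = 1) => ->; ring.
have c1 : 0 < 1 - dot c c.
  rewrite lt_neqAle -(xd p0) dot_ge0 andbT eq_sym; apply/eqP => h.
  move: (h); rewrite xd -(xd p1) => /dot_eq0/eqP; rewrite subr_eq0 => /eqP h1.
  move: h => /dot_eq0/eqP; rewrite subr_eq0 => /eqP h0.
  by move: x1; rewrite h0 h1 eqxx.
exists c, (Num.sqrt (1 - dot c c)); split; first by rewrite sqrtr_gt0.
- by move=> y [yL]; rewrite sqr_sqrtr ?ltW// => h; rewrite /on_sphere (E _ yL) h; ring.
- by move=> p; split => //; rewrite sqr_sqrtr ?ltW.
Qed.

(** The hypothesis says that the null vectors (1, x p) span a space of dimension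
   at most 8.  This space is not contained in the hyperplane of vectors with
   first coordinate 0, which therefore cuts it in dimension at most 7 and
   contains the differences (0, x p - x p0). *)
Lemma affine_hull_bound (T : Type) (x : T -> 'rV[R]_n.+1) (E : 'I_8 -> 'rV[R]_n.+2) p0 :
  (forall l, (forall i, lor l (E i) = 0) -> forall p, lor l (hat (x p)) = 0) ->
  exists2 U : 'M[R]_(n.+2, n.+1), (\rank U <= 7)%N & forall p, (x p - x p0 <= U)%MS.
Proof.
move=> H; pose J (v : 'rV[R]_n.+2) : 'rV[R]_n.+2 :=
  row_mx (- lsubmx (v : 'rV_(1 + n.+1))) (rsubmx (v : 'rV_(1 + n.+1))).
pose W : 'M[R]_(8, n.+2) := \matrix_(i < 8) J (E i).
have Jr (b : 'rV[R]_1) w : J (row_mx b w) = row_mx (- b) w by rewrite /J row_mxKl row_mxKr.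
have lJ (l v : 'rV[R]_n.+2) : l *m (J v)^T = (lor l v)%:M.
  have [a [w ->]] := row_mx_split l; have [b [z ->]] := row_mx_split v.
  rewrite Jr lor_row_mx.
  have h : (row_mx a w : 'rV[R]_(1 + n.+1)) *m (row_mx (- b) z)^T = (- (a 0 0 * b 0 0) + dot w z)%:M.
    rewrite tr_row_mx mul_row_col dot_mulmx.
    by apply/matrixP => i j; rewrite !ord1 !mxE big_ord1 !mxE eqxx !mulr1n mulrN.
  exact: h.
have Jh w : J (hat w) = row_mx (const_mx (-1) : 'rV[R]_1) w.
  rewrite /hat Jr; suff -> : - (1 : 'rV[R]_1) = const_mx (-1) by [].
  by apply/rowP => i; rewrite !mxE ord1.
have inW p : (J (hat (x p)) <= W)%MS.
  rewrite submxE; apply/eqP/rowP => j.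
  pose l : 'rV[R]_n.+2 := (col j (cokermx W))^T.
  have lE i : lor l (E i) = 0.
    have : W *m col j (cokermx W) = 0 by rewrite colE mulmxA mulmx_coker mul0mx.
    move=> /(congr1 (row i)); rewrite row_mul rowK row0 => h.
    have := lJ l (E i); rewrite /l -[LHS]trmxK trmx_mul !trmxK h trmx0.
    by move=> /matrixP/(_ 0 0); rewrite !mxE eqxx mulr1n.
  have := lJ l (hat (x p)); rewrite (H l lE p) /l -[LHS]trmxK trmx_mul !trmxK => h.
  have : J (hat (x p)) *m col j (cokermx W) = 0.
    by rewrite -[LHS]trmxK h; apply/matrixP => ? ?; rewrite !mxE mul0rn.
  rewrite colE mulmxA -colE => /matrixP/(_ 0 0).
  by rewrite [in X in X -> _]mxE => ->; rewrite !mxE.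
pose Hy : 'M[R]_(n.+1, n.+2) := row_mx (0 : 'cV_n.+1) 1%:M.
pose Pr : 'M[R]_(n.+2, n.+1) := col_mx (0 : 'rV_n.+1) 1%:M.
have inH w : (row_mx (0 : 'rV_1) w <= Hy)%MS.
  apply/submxP; exists w; rewrite /Hy mul_mx_row mulmx0 mulmx1.
  by congr row_mx.
exists ((W :&: Hy)%MS *m Pr).
  apply: leq_trans (mxrankM_maxl _ _) _; rewrite -ltnS.
  apply: leq_trans (rank_leq_row W); apply: rank_ltmx.
  rewrite ltmxE capmxSl /=; apply/negP => /(submx_trans (inW p0)).
  rewrite sub_capmx => /andP[_]; rewrite Jh => /submxP[D].
  have -> : D *m Hy = row_mx (0 : 'rV_1) D.
    have h : D *m row_mx (0 : 'cV_n.+1) 1%:M = row_mx 0 D by rewrite mul_mx_row mulmx0 mulmx1.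
    exact: h.
  move=> h; have : (-1 : R) = 0.
    have := congr1 (fun M : 'rV[R]_n.+2 => M 0 ord0) h.
    by rewrite !row_mx_0 !mxE.
  by move=> /eqP; rewrite oppr_eq0 oner_eq0.
move=> p; have -> : x p - x p0 = row_mx (0 : 'rV_1) (x p - x p0) *m Pr.
  by rewrite /Pr mul_row_col mulmx0 mulmx1 add0r.
apply: submxMr; rewrite sub_capmx inH andbT.
have -> : row_mx (0 : 'rV_1) (x p - x p0) = J (hat (x p)) - J (hat (x p0)).
  have h (b : 'rV[R]_1) (w z : 'rV[R]_n.+1) : row_mx b w - row_mx b z = row_mx 0 (w - z).
    by rewrite opp_row_mx add_row_mx subrr.
  by rewrite !Jh; apply/esym; exact: h.
by apply: addmx_sub => //; rewrite eqmx_opp.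
Qed.

End LinearAlgebra.

(** * From one chart to the whole surface *)
Section Global.
Variables (R : realType) (n : nat) (M : topologicalType) (RS : riemann_surface R M).
Variable x : M -> 'rV[R]_n.+1.
Hypothesis hx : conformal_immersion RS x.
Hypothesis hW : willmore RS x.
Hypothesis hflat : flat_normal_bundle RS x.

Let sphere_x p : on_sphere (x p). Proof. by have [h _] := hx; exact: h. Qed.

Let chart_lift (c : chart R M) : atlas RS c -> exists Y : R * R -> 'rV[R]_n.+2,
  [/\ null_lift (chart_img c) Y,
      forall q, chart_img c q -> projn Y q (ELv Y q) = 0,
      forall q, chart_img c q ->
        lor (PY Y q) (QY Y q) ^+ 2 = lor (PY Y q) (PY Y q) * lor (QY Y q) (QY Y q) &
      forall q l, chart_img c q -> (lor l (Y q) = 0 <-> lor l (hat (x (param c q))) = 0)].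
Proof.
move=> ac; have oO : open (chart_img c) by exact: open_chart_img.
have [sX cX] := hx.2 c ac.
have oX p : chart_img c p -> on_sphere ((x \o param c) p) by move=> _; exact: sphere_x.
have cl := canonical_lift_exists oO sX oX cX.
set Y := (fun p => _) in cl.
have nl := canonical_null_lift oO oX cl.
exists Y; split => //.
- move=> q Oq; have /nbhs_squareP[d d0 H] := open_nbhs_nbhs (conj oO Oq).
  have r0 : 0 < d / 4 by rewrite divr_gt0.
  apply: (willmore_equation_at hx ac cl r0 _ hW) => q' /csqP[h1 h2].
  by apply: H; [apply: le_lt_trans h1 _|apply: le_lt_trans h2 _]; lra.
- by move=> q Oq; exact: (flat_PQ nl (hflat ac cl) Oq).
- move=> q l Oq; have [_ /(_ q Oq)[[r [r0 E]] _ _ _]] := cl.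
  rewrite E lorZr; split => [/eqP|->]; last by rewrite mulr0.
  by rewrite mulf_eq0 gt_eqF//= => /eqP.
Qed.

Hypothesis hM : connected [set: M].

(** The set of points near which the relation holds is open by definition, and
   closed by unique continuation. *)
Lemma annihilator_global (l : 'rV[R]_n.+2) (p0 : M) :
  (\near p0, lor l (hat (x p0)) = 0) -> forall p, lor l (hat (x p)) = 0.
Proof.
move=> near0; pose A : set M := [set p | \near p, lor l (hat (x p)) = 0].
have AT : A = [set: M].
  apply: hM.
  - by exists p0.
  - exists A; last by rewrite setTI.
    by rewrite openE => p /nbhs_interior.
  exists A; last by rewrite setTI.
  move=> p clA; have [c ac pc] := atlas_cover RS p.
  have [Y [nl EL _ YE]] := chart_lift ac.
  have [r r0 H] := lift_continuation nl EL (chart_img_coord pc).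
  have nU : nbhs p [set p' | chart_dom c p' /\ sq (coord c p) r (coord c p')].
    have pp : sq (coord c p) r (coord c p) by split; rewrite subrr normr0.
    have n1 : nbhs p [set p' | sq (coord c p) r (coord c p')] :=
      @Defs.coord_continuous _ _ c p pc _ (open_nbhs_nbhs (conj (@open_sq R (coord c p) r) pp)).
    exact: (filterI (open_nbhs_nbhs (conj (open_chart_dom c) pc)) n1).
  have [p1 [Ap1 [p1c p1r]]] := clA _ nU.
  have Oq1 := chart_img_coord p1c.
  have oO : open (chart_img c) by exact: open_chart_img.
  have Z : \forall q \near coord c p1, lor l (Y q) = 0.
    have n0 : nbhs (param c (coord c p1)) [set p' | lor l (hat (x p')) = 0].
      by rewrite coordK ?inE.
    have n1 : nbhs (coord c p1) [set q | lor l (hat (x (param c q))) = 0].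
      exact: (@param_continuous _ _ c _ Oq1 _ n0).
    apply: filterS (filterI (open_nbhs_nbhs (conj oO Oq1)) n1) => q [Oq h].
    exact/(YE q l Oq).
  have H1 := H l _ p1r Z.
  apply: filterS nU => p' [p'c p'r]; have := H1 _ p'r.
  by move=> /(YE _ l (chart_img_coord p'c)); rewrite coordK ?inE.
by move=> p; have : A p; [rewrite AT|exact: nbhs_singleton].
Qed.

Lemma rank_global (p : M) : exists E : 'I_8 -> 'rV[R]_n.+2,
  forall l, (forall i, lor l (E i) = 0) -> forall p, lor l (hat (x p)) = 0.
Proof.
have [c ac pc] := atlas_cover RS p.
have [Y [nl EL FL YE]] := chart_lift ac.
have oO : open (chart_img c) by exact: open_chart_img.
have [q0 Oq0 [E HE]] := rank_bound nl EL FL (chart_img_coord pc).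
exists E => l /HE Z; apply: (@annihilator_global l (param c q0)).
have [pd cK] := chart_imgP Oq0.
have n1 : nbhs (param c q0) [set p' | chart_dom c p' /\ lor l (Y (coord c p')) = 0].
  have n2 : nbhs (param c q0) [set p' | lor l (Y (coord c p')) = 0].
    have n0 : nbhs (coord c (param c q0)) [set q | lor l (Y q) = 0] by rewrite cK.
    exact: (@Defs.coord_continuous _ _ c _ pd _ n0).
  exact: (filterI (open_nbhs_nbhs (conj (open_chart_dom c) pd)) n2).
apply: filterS n1 => p' [p'c]; move/(YE _ l (chart_img_coord p'c)).
by rewrite coordK ?inE.
Qed.

(** The derivative of the constant map would be nonzero. *)
Lemma not_constant (p0 : M) : exists p, x p != x p0.
Proof.
apply: contrapT => /forallNP h.
have x0 p : x p = x p0 by apply/eqP; have := h p => /negP; rewrite negbK.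
have [c ac pc] := atlas_cover RS p0; have [_ cX] := hx.2 c ac.
have [d0 _ _] := cX _ (chart_img_coord pc); move: d0.
have -> : x \o param c = (fun=> x p0) by apply/funext => q; exact: x0.
have z : dot (0 : 'rV[R]_n.+1) 0 = 0 by rewrite -{1}(scale0r 0) dotZl mul0r.
by rewrite du_dx dx_cst z ltxx.
Qed.

End Global.

Theorem proposition6p1 (R : realType) (n : nat) (hn : (6 <= n)%N)
    (M : topologicalType) (RS : riemann_surface R M)
    (hM : connected [set: M])
    (x : M -> 'rV[R]_n.+1)
    (hx : conformal_immersion RS x)
    (hW : willmore RS x)
    (hflat : flat_normal_bundle RS x) :
  exists (c : 'rV[R]_n.+1) (r : R) (L : 'M[R]_(7, n.+1)),
    [/\ 0 < r,
        row_free L,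
        forall y, round_sphere c r L y -> on_sphere y
      & forall p, round_sphere c r L (x p)].
Proof.
(* An empty surface is contained in any great sphere. *)
have [[p0 _]|noM] := pselect (exists p : M, True); last first.
  have [|L [fL _]] := @row_free_extension R n 7 1 0; first by rewrite mxrank0.
  exists 0, 1, L; split => // [y [_]|p]; last by case: noM; exists p.
  by rewrite subr0 expr1n.
have [E HE] := rank_global hx hW hflat hM p0.
have [U rU xU] := affine_hull_bound p0 HE.
have [|L [fL UL]] := row_free_extension (k := 7) (U := U); first by rewrite rU.
have sx : forall p, on_sphere (x p) by have [h _] := hx.
have xL p : (x p - x p0 <= L)%MS := submx_trans (xU p) UL.
have [c [r [r0 sub inS]]] := sphere_section fL sx xL (not_constant hx p0).
by exists c, r, L.
Qed.
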